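(* Let $m,a,\alpha>0$ and suppose that $a\neq m$. Then there exists a sequence of generalized eigenfunctions of the operator $(\mathbf{A},D(\mathbf{A}))$ (defined in the context) that forms a Riesz basis for $\mathbf{H}$; and the characteristic equation of $(\mathbf{A},D(\mathbf{A}))$ is $$e^{2\lambda}\,[1+\alpha+(a+m)\lambda]+(1-\alpha)+(a-m)\lambda=0.$$
   Context: All functions are complex-valued; $m,a,\alpha$ are positive real constants. $H^1_E(0,1)=\{f\in H^1(0,1):f(0)=0\}$. $\mathbf{H}=H^1_E(0,1)\times L^2(0,1)\times\mathbb{C}$ with norm $\|(f,g,\eta)\|_{\mathbf{H}}^2=\int_0^1[|f'(x)|^2+|g(x)|^2]dx+\frac1{m+\alpha a}|\eta|^2$. $\mathbf{A}(f,g,\eta)=(g,f'',-f'(1)-\alpha g(1))$ with domain $D(\mathbf{A})=\{(f,g,\eta)\in(H^1_E(0,1)\cap H^2(0,1))\times H^1_E(0,1)\times\mathbb{C}:\ \eta=mg(1)+af'(1)\}$. A generalized eigenfunction of $\mathbf{A}$ is a nonzero vector in $\ker(\lambda-\mathbf{A})^k$ for some eigenvalue $\lambda$ and some $k\ge1$. ''Characteristic equation'' means the equation satisfied by $\lambda\in\mathbb{C}$ exactly when $\lambda$ is an eigenvalue of $\mathbf{A}$. *)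

(* Defs.v *)
From HB Require Import structures.
From mathcomp Require Import all_boot all_order all_algebra.
From mathcomp Require Import all_classical all_reals all_analysis.
From mathcomp Require Export complex.

Set Implicit Arguments.
Unset Strict Implicit.
Unset Printing Implicit Defensive.

Import Order.TTheory GRing.Theory Num.Theory.
Import numFieldNormedType.Exports.
Import complex.

Local Open Scope classical_set_scope.
Local Open Scope ring_scope.
Local Open Scope complex_scope.

Definition cexp {R : realType} (z : R[i]) : R[i] :=
  (expR (Re z) * cos (Im z)) +i* (expR (Re z) * sin (Im z)).

Section Sobolev.
Context {R : realType}.
Local Notation C := R[i].
Local Notation mu := (@lebesgue_measure R).
Local Notation I01 := (`]0%R, 1%R[%classic : set R).

(* Elements of L^2(0,1) and H^k(0,1) are represented by functions R -> C, of
   which only the restriction to (0,1) (resp. [0,1]) is relevant. *)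

Definition cintegral (f : R -> C) : C :=
  (\int[mu]_(x in I01) Re (f x)) +i* (\int[mu]_(x in I01) Im (f x)).

Definition L2 (f : R -> C) : Prop :=
  [/\ measurable_fun I01 (fun x => Re (f x)),
      measurable_fun I01 (fun x => Im (f x)) &
      (\int[mu]_(x in I01) (Normc.normc (f x) ^+ 2)%:E < +oo)%E].

(* C^1 functions with compact support in (0,1) (Brezis, Functional Analysis,
   Sobolev Spaces and PDE, Section 8.2); real-valued ones suffice by linearity. *)
Definition test_fun (phi : R -> R) : Prop :=
  [/\ forall x, derivable phi x 1,
      continuous (derive1 phi) &
      closure [set x | phi x != 0] `<=` I01].

Definition weak_deriv (f h : R -> C) : Prop :=
  forall phi, test_fun phi ->
    cintegral (fun x => f x * (derive1 phi x)%:C) =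
    - cintegral (fun x => h x * (phi x)%:C).

(* An element of H^1(0,1) is represented by its continuous representative on
   [0,1], so that the boundary values f 0 and f 1 are the traces. *)
Definition H1 (f : R -> C) : Prop :=
  [/\ {within `[0, 1], continuous (fun x => Re (f x))},
      {within `[0, 1], continuous (fun x => Im (f x))} &
      exists2 h, L2 h & weak_deriv f h].

Definition H1E (f : R -> C) : Prop := H1 f /\ f 0 = 0.

Definition H2 (f : R -> C) : Prop :=
  H1 f /\ exists2 p, H1 p & weak_deriv f p.

(* Some L^2 weak derivative of f (unique almost everywhere) when f is in H^1. *)
Definition wderiv (f : R -> C) : R -> C :=
  xget (fun=> 0) [set h | L2 h /\ weak_deriv f h].

End Sobolev.

(* Representatives (f, g, eta) of the elements of the state space. *)
Definition state (R : realType) : lmodType R[i] :=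
  ((R -> R[i]) * (R -> R[i]) * R[i])%type.

Section Operator.
Context {R : realType}.
Local Notation C := R[i].
Local Notation mu := (@lebesgue_measure R).
Local Notation I01 := (`]0%R, 1%R[%classic : set R).
Implicit Types (m a alpha : R) (u v w : state R) (lambda : C).

Definition inH : set (state R) := [set u | H1E u.1.1 /\ L2 u.1.2].

(* Equality of the elements of the state space represented by u and v. *)
Definition eqH u v : Prop :=
  [/\ {in `[0, 1], u.1.1 =1 v.1.1},
      u.1.2 = v.1.2 %[ae mu in I01] &
      u.2 = v.2].

Definition normH m a alpha u : R :=
  Num.sqrt
    (\int[mu]_(x in I01) (Normc.normc (wderiv u.1.1 x) ^+ 2 +
                          Normc.normc (u.1.2 x) ^+ 2) +
     (m + alpha * a)^-1 * Normc.normc u.2 ^+ 2).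

(* u is in D(A), g is the H^1_E-representative of its second component and p
   the continuous representative of the derivative of its first component. *)
Definition domA_rep m a u (g p : R -> C) : Prop :=
  [/\ inH u,
      H1E u.1.1 /\ H2 u.1.1,
      H1E g /\ u.1.2 = g %[ae mu in I01],
      H1 p /\ weak_deriv u.1.1 p &
      u.2 = m%:C * g 1 + a%:C * p 1].

Definition domA m a u : Prop := exists g p, domA_rep m a u g p.

(* graphA u v: u is in D(A) and A u = v in the state space. *)
Definition graphA m a alpha u v : Prop :=
  inH v /\ exists g p, domA_rep m a u g p /\
    [/\ {in `[0, 1], v.1.1 =1 g},
        weak_deriv p v.1.2 &
        v.2 = - p 1 - alpha%:C * g 1].

Definition eigenvalueA m a alpha lambda : Prop :=
  exists u, [/\ inH u, ~ eqH u 0 & graphA m a alpha u (lambda *: u)].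

(* u is in the domain of (lambda - A)^k and (lambda - A)^k u = 0. *)
Fixpoint ker_pow m a alpha lambda (k : nat) u : Prop :=
  if k is k'.+1 then
    exists2 w, graphA m a alpha u w & ker_pow m a alpha lambda k' (lambda *: u - w)
  else eqH u 0.

Definition generalized_eigenfunction m a alpha u : Prop :=
  [/\ inH u, ~ eqH u 0 &
      exists lambda k, [/\ eigenvalueA m a alpha lambda, (0 < k)%N &
                           ker_pow m a alpha lambda k u]].

(* (phi_n) is a Riesz basis of the Hilbert space H with norm N: its span is
   dense in H and it is a Riesz sequence (Curtain and Zwart, "An Introduction to
   Infinite-Dimensional Linear Systems Theory", Section 2.3). *)
Definition riesz_basis (V : lmodType C) (H : set V) (N : V -> R)
    (phi : nat -> V) : Prop :=
  [/\ forall n, H (phi n),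
      forall x, H x -> forall eps : R, 0 < eps ->
        exists n (c : nat -> C), N (x - \sum_(i < n) c i *: phi i) < eps &
      exists c1 c2 : R, [/\ 0 < c1, 0 < c2 &
        forall n (c : nat -> C),
          c1 * \sum_(i < n) Normc.normc (c i) ^+ 2
            <= N (\sum_(i < n) c i *: phi i) ^+ 2
            <= c2 * \sum_(i < n) Normc.normc (c i) ^+ 2]].

End Operator.

(* Main.v *)
Require Import Defs.
From HB Require Import structures.
From mathcomp Require Import all_boot all_order all_algebra.
From mathcomp Require Import all_classical all_reals all_analysis.
From mathcomp Require Import measurable_realfun.
From mathcomp Require Import ring lra zify.

Set Implicit Arguments.
Unset Strict Implicit.
Unset Printing Implicit Defensive.

Import Order.TTheory GRing.Theory Num.Theory.
Import numFieldNormedType.Exports.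
Import complex.
Import Normc.

Local Open Scope classical_set_scope.
Local Open Scope ring_scope.
Local Open Scope complex_scope.

(** Why the theorem holds.  The operator [A] has an inverse defined on the whole
    state space and bounded there: solving [A u = v] amounts to integrating [v]
    twice, the boundary condition fixing the constant of integration
    ([graphAP], [graphA_bound]).  If [A u = z u] then, with [f] and [p] the first
    component of [u] and its derivative, [p + z f] and [p - z f] are multiples of
    [exp (z x)] and [exp (- z x)]; hence [u] is proportional to the vector with
    components [sinh (z x) / z] and [sinh (z x)], and the boundary condition is
    the characteristic equation ([eigenvalue_char], [char_fun_graph]).

    For large [z] that equation reads
    [exp (2 z) = (m - a) / (m + a) + O (1 / z)].  As [a] differs from [m], a
    contraction argument gives for all large [n] a root [lam n] at distance
    [O (1 / n)] of [nu n = nu0 + i pi k], where [k] is the [n]-th integer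
    in the enumeration 0, 1, -1, 2, -2 and so on ([eigenvalue_sequence]).

    The vectors built in the same way from the frequencies [nu n], with third
    component 0, form together with (0, 0, 1) a Riesz basis
    ([ref_basis_riesz]).  Indeed in the variables [p + g] and [p - g] the factors
    [exp (nu0 x)] and [exp (- nu0 x)] split off, and what remains is the pair of
    a cosine and a sine series, which are orthogonal and complete in [L^2].

    The eigenvectors at [lam n] are square-summably close to this basis
    ([hyp_state_close]), and it remains to account for finitely many indices
    ([root_vector_basis]).  By Paley and Wiener, replacing all but the first
    [d] basis vectors by eigenvectors gives a Riesz basis again.  In its coordinates the inverse
    of [A] is block triangular, with a [d] by [d] block and the numbers
    [1 / lam n] on the diagonal after it.  For [d] large no [1 / lam n] with [n >= d] is an
    eigenvalue of the block, so the first [d] vectors can be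
    corrected by solving a Sylvester equation until their span is invariant.
    Over the complex numbers that finite-dimensional invariant space is
    spanned by generalized eigenvectors, whether or not the remaining
    eigenvalues are simple.

    Membership in [H^1] is handled through primitives: a continuous function has
    the weak derivative [h] if and only if it is a primitive of [h], by du
    Bois-Reymond's lemma ([weak_derivP]). *)

(** * Vanishing sequences *)

Section Vanishing.
Context {R : realType}.
Implicit Types u v : nat -> R.

(** Only the upper bound is asked for: this serves sequences of nonnegative terms. *)
Definition vanish u :=
  forall e : R, 0 < e -> exists n0, forall n, (n0 <= n)%N -> u n < e.

Lemma vanish_le n1 u v :
  (forall n, (n1 <= n)%N -> u n <= v n) -> vanish v -> vanish u.
Proof.
move=> uv v0 e /v0[n0 n0P]; exists (maxn n0 n1) => n; rewrite geq_max => /andP[n0n n1n].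
exact: le_lt_trans (uv _ n1n) (n0P _ n0n).
Qed.

Lemma vanishD u v : vanish u -> vanish v -> vanish (fun n => u n + v n).
Proof.
move=> u0 v0 e e0; have e2 : 0 < e / 2 by rewrite divr_gt0.
have [n1 n1P] := u0 _ e2; have [n2 n2P] := v0 _ e2.
exists (maxn n1 n2) => n; rewrite geq_max => /andP[n1n n2n].
by have := n1P n n1n; have := n2P n n2n; lra.
Qed.

Lemma vanishZ (k : R) u : 0 <= k -> vanish u -> vanish (fun n => k * u n).
Proof.
move=> k0 u0 e e0; have k1 : 0 < k + 1 by lra.
have [n1 n1P] := u0 _ (divr_gt0 e0 k1); exists n1 => n /n1P.
rewrite ltr_pdivlMr // => h; have [un0|un0] := leP 0 (u n); first nra.
by apply: le_lt_trans e0; rewrite mulr_ge0_le0 // ltW.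
Qed.

Lemma vanish_cst (x : R) : vanish (fun=> x) -> x <= 0.
Proof.
move=> x0; rewrite leNgt; apply/negP => /x0[n0 /(_ n0 (leqnn _))].
by rewrite ltxx.
Qed.

Lemma vanish_sqr u : (forall n, 0 <= u n) -> vanish (fun n => u n ^+ 2) -> vanish u.
Proof.
move=> u0 v0 e e0; have [n0 n0P] := v0 _ (exprn_gt0 2 e0).
by exists n0 => n /n0P; rewrite ltr_pXn2r // nnegrE // ltW.
Qed.

Lemma vanish_inv : vanish (fun n => n.+1%:R^-1 : R).
Proof.
move=> e e0; exists (Num.truncn e^-1) => n le_n.
rewrite invf_plt ?posrE //.
apply: lt_le_trans (truncnS_gt _) _.
by rewrite ler_nat ltnS.
Qed.

Lemma vanish_expr (q : R) : 0 <= q < 1 -> vanish (fun n => q ^+ n).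
Proof.
move=> /andP[q0 q1] e e0.
have /cvgrPdist_lt/(_ _ e0)[n0 _ n0P] := @cvg_expr R q (@eq_ind_r _ _ (fun x => x < 1) q1 _ (ger0_norm q0)).
exists n0 => n /n0P /=; rewrite sub0r normrN ger0_norm //.
exact: exprn_ge0.
Qed.

End Vanishing.

Section ComplexModulus.
Context {R : realType}.
Local Notation C := R[i].
Implicit Types x y z : C.

Lemma normc_ge0 z : 0 <= normc z.
Proof. by case: z => a b; rewrite /normc sqrtr_ge0. Qed.

Lemma normcD_le x y : normc (x + y) <= normc x + normc y.
Proof. exact: le_normcD. Qed.

Lemma normcN' x : normc (- x) = normc x.
Proof. exact: normcN. Qed.

Lemma normcB x y : normc (x - y) = normc (y - x).
Proof. by rewrite -normcN' opprB. Qed.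

Lemma normcB_le x y : normc (x - y) <= normc x + normc y.
Proof. by rewrite -(normcN' y) normcD_le. Qed.

Lemma normcB_ge x y : normc x - normc y <= normc (x - y).
Proof. by rewrite lerBlDr -{1}(subrK y x) normcD_le. Qed.

Lemma normc_eq0 z : (normc z == 0) = (z == 0).
Proof.
apply/eqP/eqP => [/eq0_normc//|->]; exact: normc0.
Qed.

Lemma normc_gt0 z : (0 < normc z) = (z != 0).
Proof. by rewrite lt_def normc_ge0 andbT normc_eq0. Qed.

Lemma normcR (r : R) : normc r%:C = `|r|.
Proof. by rewrite /normc /= expr0n addr0 sqrtr_sqr. Qed.

Lemma sqr_normcE z : normc z ^+ 2 = Re z ^+ 2 + Im z ^+ 2.
Proof. by case: z => a b; rewrite /normc sqr_sqrtr // addr_ge0 ?sqr_ge0. Qed.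

Lemma normc_Re z : `|Re z| <= normc z.
Proof.
rewrite -(ler_pXn2r (_ : 0 < 2)%N) ?nnegrE ?normc_ge0 // sqr_normcE.
by rewrite real_normK ?num_real // lerDl sqr_ge0.
Qed.

Lemma normc_Im z : `|Im z| <= normc z.
Proof.
rewrite -(ler_pXn2r (_ : 0 < 2)%N) ?nnegrE ?normc_ge0 // sqr_normcE.
by rewrite real_normK ?num_real // lerDr sqr_ge0.
Qed.

Lemma normc_le_ReIm z : normc z <= `|Re z| + `|Im z|.
Proof.
rewrite -(ler_pXn2r (_ : 0 < 2)%N) ?nnegrE ?normc_ge0 ?addr_ge0 // sqr_normcE.
rewrite -(real_normK (num_real (Re z))) -(real_normK (num_real (Im z))).
have := normr_ge0 (Re z); have := normr_ge0 (Im z); nra.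
Qed.

Lemma normc_sum_le (I : Type) (r : seq I) (P : pred I) (F : I -> C) :
  normc (\sum_(i <- r | P i) F i) <= \sum_(i <- r | P i) normc (F i).
Proof.
elim/big_ind2 : _ => [|x a y b xa yb|//]; first by rewrite normc0.
by apply: le_trans (normcD_le _ _) _; rewrite lerD.
Qed.

Lemma complex_cauchy_cvg (u : nat -> C) :
  (forall e, 0 < e -> exists n0, forall i j, (n0 <= i)%N -> (n0 <= j)%N ->
     normc (u i - u j) < e) ->
  exists l, vanish (fun n => normc (u n - l)).
Proof.
move=> cu.
have real_lim (f : C -> R) : (forall x y, f (x - y) = f x - f y) ->
    (forall x, `|f x| <= normc x) -> exists l, vanish (fun n => `|f (u n) - l|).
  move=> fB fle.
  have /cauchy_cvgP : cauchy ((f \o u) @ \oo).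
    apply/cauchy_ballP => e e0; have [n0 n0P] := cu _ e0.
    near_simpl; near=> i j; rewrite /ball /= -fB.
    apply: le_lt_trans (fle _) _; apply: n0P.
    - by near: i; exists n0.
    - by near: j; exists n0.
  move=> /cvg_ex[l /cvgrPdist_lt lP]; exists l => e /lP[n0 _ n0P].
  by exists n0 => n /n0P /=; rewrite distrC.
have [] := real_lim (@Re R); [by case=> ? ? [] | exact: normc_Re|].
move=> a aP; have [] := real_lim (@Im R); [by case=> ? ? [] | exact: normc_Im|].
move=> b bP; exists (a +i* b).
apply: (@vanish_le _ 0 _ _ _ (vanishD aP bP)) => n _.
by apply: le_trans (normc_le_ReIm _) _; case: (u n).
Unshelve. all: by end_near.
Qed.

End ComplexModulus.

Lemma sum_CauchySchwarz (R : realType) (n : nat) (a b : nat -> R) :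
  (\sum_(i < n) a i * b i) ^+ 2 <=
  (\sum_(i < n) a i ^+ 2) * (\sum_(i < n) b i ^+ 2).
Proof.
elim: n => [|n IH]; first by rewrite !big_ord0 expr0n mul0r.
rewrite !big_ord_recr /=.
have : 0 <= \sum_(i < n) a i ^+ 2 by apply: sumr_ge0 => *; exact: sqr_ge0.
have : 0 <= \sum_(i < n) b i ^+ 2 by apply: sumr_ge0 => *; exact: sqr_ge0.
move: IH; move: (\sum_(i < n) _ * _) => S; move: (\sum_(i < n) a i ^+ 2) => A.
move: (\sum_(i < n) b i ^+ 2) => B; move: (a n) (b n) => x y SAB B0 A0.
suff : 2 * (S * x * y) <= A * y ^+ 2 + x ^+ 2 * B by nra.
have T0 : 0 <= A * y ^+ 2 + x ^+ 2 * B.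
  by rewrite addr_ge0 // mulr_ge0 // sqr_ge0.
apply: le_trans (ler_norm _) _.
rewrite -(ler_pXn2r (_ : 0 < 2)%N) ?nnegrE // real_normK ?num_real //.
have h : S ^+ 2 * (x * y) ^+ 2 <= A * B * (x * y) ^+ 2.
  by rewrite ler_wpM2r // sqr_ge0.
have := sqr_ge0 (A * y ^+ 2 - x ^+ 2 * B).
move: h; rewrite !exprMn; nra.
Qed.

Lemma ler_term_sum (R : realType) (I : finType) (F : I -> R) i :
  (forall j, 0 <= F j) -> F i <= \sum_j F j.
Proof. by move=> F0; rewrite (bigD1 i) //= lerDl; apply: sumr_ge0. Qed.

(** * Riesz bases in a complete seminormed space *)

Section RieszBases.
Context {R : realType} {V : lmodType R[i]}.
Local Notation C := R[i].
Variables (H : set V) (N : V -> R).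

(** A seminorm only: two functions equal almost everywhere are different
    representatives of one element of the Hilbert space. *)
Record seminormed : Prop := Seminormed {
  semi0 : H 0;
  semiD : forall x y, H x -> H y -> H (x + y);
  semiZ : forall (k : C) x, H x -> H (k *: x);
  seminorm_ge0 : forall x, 0 <= N x;
  seminormD : forall x y, H x -> H y -> N (x + y) <= N x + N y;
  seminormZ : forall (k : C) x, H x -> N (k *: x) = normc k * N x }.

Definition seminorm_complete : Prop :=
  forall u : nat -> V, (forall n, H (u n)) ->
    (forall e, 0 < e -> exists n0, forall i j,
       (n0 <= i)%N -> (n0 <= j)%N -> N (u i - u j) < e) ->
    exists2 x, H x & vanish (fun n => N (u n - x)).

Definition comb (phi : nat -> V) (c : nat -> C) n := \sum_(i < n) c i *: phi i.

Definition riesz_bounds (phi : nat -> V) (c1 c2 : R) : Prop :=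
  [/\ 0 < c1, 0 < c2 & forall n (c : nat -> C),
     c1 * \sum_(i < n) normc (c i) ^+ 2 <= N (comb phi c n) ^+ 2
       <= c2 * \sum_(i < n) normc (c i) ^+ 2].

Lemma comb_widen phi c n m : (n <= m)%N ->
  comb phi c n = comb phi (fun i => if (i < n)%N then c i else 0) m.
Proof.
move=> nm; rewrite /comb (big_ord_widen m (fun i => c i *: phi i)) // big_mkcond.
by apply: eq_bigr => i _; case: ifP => //; rewrite scale0r.
Qed.

Lemma combD phi c c' n :
  comb phi (fun i => c i + c' i) n = comb phi c n + comb phi c' n.
Proof. by rewrite /comb -big_split; apply: eq_bigr => i _; rewrite scalerDl. Qed.

Lemma combZ phi (k : C) c n : comb phi (fun i => k * c i) n = k *: comb phi c n.
Proof. by rewrite /comb scaler_sumr; apply: eq_bigr => i _; rewrite scalerA. Qed.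

Lemma combB phi c c' n :
  comb phi (fun i => c i - c' i) n = comb phi c n - comb phi c' n.
Proof.
rewrite -[- comb _ _ _]scaleN1r -combZ -combD.
by apply: eq_bigr => i _; rewrite mulN1r.
Qed.

Definition in_span phi x := exists n c, x = comb phi c n.

Lemma in_spanD phi x y : in_span phi x -> in_span phi y -> in_span phi (x + y).
Proof.
move=> [n [c ->]] [m [d ->]]; exists (maxn n m); eexists.
rewrite (comb_widen _ _ (leq_maxl n m)) (comb_widen _ _ (leq_maxr n m)).
by rewrite -combD.
Qed.

Lemma in_spanZ phi (k : C) x : in_span phi x -> in_span phi (k *: x).
Proof. by move=> [n [c ->]]; exists n; eexists; rewrite -combZ. Qed.

Lemma in_span0 phi : in_span phi 0.
Proof. by exists 0, (fun=> 0); rewrite /comb big_ord0. Qed.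

Lemma in_span_gen phi i : in_span phi (phi i).
Proof.
exists i.+1, (fun j => (j == i)%:R); rewrite /comb big_ord_recr /= eqxx scale1r.
by rewrite big1 ?add0r // => j _; rewrite (ltn_eqF (ltn_ord j)) scale0r.
Qed.

Lemma in_span_sum phi (I : Type) (r : seq I) (P : pred I) (F : I -> V) :
  (forall i, P i -> in_span phi (F i)) -> in_span phi (\sum_(i <- r | P i) F i).
Proof. by move=> h; apply: big_ind => //; [exact: in_span0|exact: in_spanD]. Qed.

Hypothesis sH : seminormed.

Lemma semiB x y : H x -> H y -> H (x - y).
Proof. by move=> hx hy; rewrite -scaleN1r; apply/semiD/semiZ. Qed.

Lemma semi_sum (I : Type) (r : seq I) (P : pred I) (F : I -> V) :
  (forall i, P i -> H (F i)) -> H (\sum_(i <- r | P i) F i).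
Proof. by move=> h; apply: big_ind => //; [exact: semi0|exact: semiD]. Qed.

Lemma semi_comb phi c n : (forall i, H (phi i)) -> H (comb phi c n).
Proof. by move=> h; apply: semi_sum => i _; apply: semiZ. Qed.

Lemma seminorm0 : N 0 = 0.
Proof. by rewrite -(scale0r 0) seminormZ ?normc0 ?mul0r //; exact: semi0. Qed.

Lemma seminormN x : H x -> N (- x) = N x.
Proof. by move=> hx; rewrite -scaleN1r seminormZ // normcN' normc1 mul1r. Qed.

Lemma seminormBC x y : H x -> H y -> N (x - y) = N (y - x).
Proof. by move=> hx hy; rewrite -[x - y]opprB seminormN //; exact: semiB. Qed.

Lemma seminormB x y : H x -> H y -> N (x - y) <= N x + N y.
Proof.
move=> hx hy; rewrite -(seminormN hy); apply: seminormD => //.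
by rewrite -scaleN1r; apply: semiZ.
Qed.

Lemma seminorm_trans y x z : H x -> H y -> H z -> N (x - z) <= N (x - y) + N (y - z).
Proof.
move=> hx hy hz; rewrite -{1}(subrK y x) -addrA.
by apply: seminormD => //; exact: semiB.
Qed.

Lemma seminormB_ge x y : H x -> H y -> N x <= N y + N (x - y).
Proof.
by move=> hx hy; rewrite -{1}(subrKC y x); apply: seminormD => //; exact: semiB.
Qed.

Lemma seminorm_sum (I : Type) (r : seq I) (P : pred I) (F : I -> V) :
  (forall i, P i -> H (F i)) ->
  N (\sum_(i <- r | P i) F i) <= \sum_(i <- r | P i) N (F i).
Proof.
move=> hF; elim: r => [|i r IH]; first by rewrite !big_nil seminorm0.
rewrite !big_cons; case: ifP => // Pi.
apply: le_trans (seminormD sH (hF _ Pi) (semi_sum _ hF)) _.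
by rewrite lerD2l.
Qed.

(** Cauchy--Schwarz: a combination is small as soon as the vectors are
    square-summably small. *)
Lemma seminorm_comb (x : nat -> V) c n : (forall i, H (x i)) ->
  N (comb x c n) ^+ 2 <=
  (\sum_(i < n) normc (c i) ^+ 2) * (\sum_(i < n) N (x i) ^+ 2).
Proof.
move=> hx; apply: le_trans _ (sum_CauchySchwarz n (fun i => normc (c i)) (fun i => N (x i))).
rewrite ler_pXn2r ?nnegrE ?(seminorm_ge0 sH) //; last first.
  by apply: sumr_ge0 => i _; rewrite mulr_ge0 ?normc_ge0 ?(seminorm_ge0 sH).
have hcx (i : 'I_n) : true -> H (c i *: x i) by move=> _; exact: semiZ.
apply: le_trans (seminorm_sum (index_enum 'I_n) hcx) _.
by apply: ler_sum => i _; rewrite seminormZ.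
Qed.

Lemma riesz_basis_bounds phi : riesz_basis H N phi ->
  exists c1 c2, riesz_bounds phi c1 c2.
Proof. by move=> [_ _ [c1 [c2 []]]]; exists c1, c2. Qed.

Lemma riesz_basis_intro phi c1 c2 : (forall n, H (phi n)) ->
  riesz_bounds phi c1 c2 ->
  (forall x, H x -> forall e, 0 < e -> exists2 y, in_span phi y & N (x - y) < e) ->
  riesz_basis H N phi.
Proof.
move=> hphi [c10 c20 bnd] dns; split => //; last by exists c1, c2.
by move=> x hx e /(dns x hx)[_ [n [c ->]] lt_e]; exists n, c.
Qed.

(** Paley--Wiener.  Replacing the basis vectors changes a combination by at most
    half its norm, which gives the two bounds.  For the density, approximate
    [x] by a combination of the [phi i] and use the same coefficients with the
    [psi i]: the distance to the span drops by the factor 3/4, and this can be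
    iterated. *)
Lemma riesz_basis_perturb (phi psi : nat -> V) c1 c2 :
  riesz_basis H N phi -> riesz_bounds phi c1 c2 -> (forall n, H (psi n)) ->
  (forall n, \sum_(i < n) N (psi i - phi i) ^+ 2 <= c1 / 4) ->
  riesz_basis H N psi.
Proof.
move=> [hphi dphi _] [c10 c20 bphi] hpsi close.
have half c n : N (comb psi c n - comb phi c n) <= N (comb phi c n) / 2.
  have -> : comb psi c n - comb phi c n = comb (fun i => psi i - phi i) c n.
    by rewrite /comb -sumrB; apply: eq_bigr => i _; rewrite scalerBr.
  have hd i : H (psi i - phi i) by exact: semiB.
  rewrite -(ler_pXn2r (_ : 0 < 2)%N) ?nnegrE ?(seminorm_ge0 sH) //; last first.
    by rewrite divr_ge0 ?(seminorm_ge0 sH).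
  apply: le_trans (seminorm_comb c n hd) _.
  have /andP[lo _] := bphi n c.
  have s0 : 0 <= \sum_(i < n) normc (c i) ^+ 2.
    by apply: sumr_ge0 => i _; exact: sqr_ge0.
  apply: le_trans (ler_wpM2l s0 (close n)) _; rewrite expr_div_n; lra.
have hc c n : H (comb phi c n) by exact: semi_comb.
have hc' c n : H (comb psi c n) by exact: semi_comb.
have bpsi : riesz_bounds psi (c1 / 4) (9 / 4 * c2).
  split; [lra|lra|move=> n c; have /andP[lo up] := bphi n c].
  have h := half c n.
  have h1 := seminormB_ge (hc c n) (hc' c n).
  have h2 := seminormB_ge (hc' c n) (hc c n).
  rewrite seminormBC // in h1.
  have p0 := seminorm_ge0 sH (comb phi c n).
  have q0 := seminorm_ge0 sH (comb psi c n).
  apply/andP; split; nra.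
apply: (riesz_basis_intro hpsi bpsi) => x hx.
have step y : H y -> exists2 z, in_span psi z & N (y - z) <= 3 / 4 * N y.
  move=> hy; have [y0|y0] := eqVneq (N y) 0.
    by exists 0; [exact: in_span0 | rewrite subr0 y0 mulr0].
  have Ny : 0 < N y / 6 by rewrite divr_gt0 // lt_def y0 (seminorm_ge0 sH).
  have [n [c lt_c]] := dphi y hy _ Ny.
  exists (comb psi c n); first by exists n, c.
  have := seminorm_trans hy (hc c n) (hc' c n).
  have h := half c n; rewrite seminormBC // in h.
  have := seminormB_ge (hc c n) hy.
  by rewrite (seminormBC (hc c n) hy); move: lt_c; rewrite -/(comb _ _ _); lra.
have iter_step k : exists2 z, in_span psi z & N (x - z) <= (3 / 4) ^+ k * N x.
  elim: k => [|k [z [n [c ->]] le_k]].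
    by exists 0; [exact: in_span0 | rewrite subr0 expr0 mul1r].
  have [w sw le_w] := step _ (semiB hx (hc' c n)).
  exists (comb psi c n + w); first by apply: in_spanD => //; exists n, c.
  by rewrite opprD addrA exprS -mulrA; apply: le_trans le_w _; lra.
move=> e e0.
have /vanish_expr : (0 : R) <= (3 / 4 : R) < 1 by lra.
move=> /(vanishZ (seminorm_ge0 sH x))/(_ _ e0)[k kP].
have [z sz le_z] := iter_step k; exists z => //.
by apply: le_lt_trans le_z _; rewrite mulrC; exact: kP.
Qed.

End RieszBases.

Lemma bounded_sum_cauchy (R : realType) (a : nat -> R) M :
  (forall i, 0 <= a i) -> (forall n, \sum_(i < n) a i <= M) ->
  forall e, 0 < e -> exists n0, forall m n, (n0 <= m)%N -> (m <= n)%N ->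
    \sum_(i < n) a i - \sum_(i < m) a i < e.
Proof.
move=> a0 aM e e0; pose s n := \sum_(i < n) a i.
have s_mono : nondecreasing_seq s.
  by apply/nondecreasing_seqP => n; rewrite /s big_ord_recr lerDl.
have ub : has_ubound (range s) by exists M => _ [n _ <-]; exact: aM.
have cs := nondecreasing_is_cvgn s_mono ub.
have /cvgrPdist_lt/(_ _ e0)[n0 _ n0P] := cs; exists n0 => m n n0m mn.
have := n0P m n0m => /=.
have lem : s m <= limn s by apply: nondecreasing_cvgn_le => //; apply: nondecreasing_is_cvgn.
have len : s n <= limn s by apply: nondecreasing_cvgn_le => //; apply: nondecreasing_is_cvgn.
by rewrite ger0_norm ?subr_ge0 // -/(s n) -/(s m); lra.
Qed.

Section Coefficients.
Context {R : realType} {V : lmodType R[i]}.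
Local Notation C := R[i].
Variables (H : set V) (N : V -> R) (phi : nat -> V) (c1 c2 : R).
Hypotheses (sH : seminormed H N) (basis : riesz_basis H N phi).
Hypotheses (bnd : riesz_bounds N phi c1 c2).
Local Notation S := (comb phi).

Let c1_gt0 : 0 < c1. Proof. by case: bnd. Qed.
Let c2_gt0 : 0 < c2. Proof. by case: bnd. Qed.
Let H_phi n : H (phi n). Proof. by case: basis. Qed.
Let H_comb c n : H (S c n). Proof. refine (semi_comb sH _ _ H_phi). Qed.
Let N_ge0 x : 0 <= N x. Proof. exact: seminorm_ge0 sH _. Qed.
Let lower n (c : nat -> C) : c1 * \sum_(i < n) normc (c i) ^+ 2 <= N (S c n) ^+ 2.
Proof. by case: bnd => _ _ /(_ n c)/andP[]. Qed.
Let upper n (c : nat -> C) : N (S c n) ^+ 2 <= c2 * \sum_(i < n) normc (c i) ^+ 2.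
Proof. by case: bnd => _ _ /(_ n c)/andP[]. Qed.

Definition expansion x c := vanish (fun n => N (x - S c n)).

Lemma expansionD x y c d : H x -> H y ->
  expansion x c -> expansion y d -> expansion (x + y) (fun i => c i + d i).
Proof.
move=> hx hy xc yd; apply: (@vanish_le _ 0 _ _ _ (vanishD xc yd)) => n _.
by rewrite combD opprD addrACA; apply: (seminormD sH) => //; exact: (semiB sH).
Qed.

Lemma expansionZ (k : C) x c : H x ->
  expansion x c -> expansion (k *: x) (fun i => k * c i).
Proof.
move=> hx /(vanishZ (normc_ge0 k)); apply: (@vanish_le _ 0) => n _.
by rewrite combZ -scalerBr (seminormZ sH) //; exact: (semiB sH).
Qed.

Lemma expansion_le x c : H x -> expansion x c ->
  forall n, c1 * \sum_(i < n) normc (c i) ^+ 2 <= N x ^+ 2.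
Proof.
move=> hx xc n; rewrite -subr_le0; apply: vanish_cst => e e0.
have Nx1 : 0 < 2 * N x + 2 by have := N_ge0 x; lra.
have [n0 n0P] := xc _ (divr_gt0 e0 Nx1).
have [n1 n1P] := xc _ ltr01.
pose m := maxn n (maxn n0 n1).
have /n0P lt0 : (n0 <= m)%N by rewrite /m !leq_max leqnn !orbT.
have /n1P lt1 : (n1 <= m)%N by rewrite /m !leq_max leqnn !orbT.
have nm : (n <= m)%N by rewrite leq_maxl.
have mono : \sum_(i < n) normc (c i) ^+ 2 <= \sum_(i < m) normc (c i) ^+ 2.
  rewrite (big_ord_widen m (fun i => normc (c i) ^+ 2)) // big_mkcond.
  by apply: ler_sum => i _; case: ifP => // _; exact: sqr_ge0.
have lo := lower m c.
have := seminormB_ge sH (H_comb c m) hx.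
rewrite (seminormBC sH) // => le1.
have le2 : c1 * \sum_(i < n) normc (c i) ^+ 2 <= N (S c m) ^+ 2.
  by apply: le_trans lo; rewrite ler_pM2l.
move: lt0 lt1; rewrite ltr_pdivlMr //.
have := N_ge0 (x - S c m); have := N_ge0 (S c m); have := N_ge0 x.
move: le1 le2; move: (N (x - _)) (N (S _ _)) (N x) => p q r; move: (c1 * _) => s.
move=> qr sq r0 q0 p0 pe p1; exists 0%N => _ _.
have : q ^+ 2 <= (r + p) ^+ 2 by rewrite ler_pXn2r // nnegrE addr_ge0.
nra.
Qed.

Lemma expansion0 c : expansion 0 c -> forall i, c i = 0.
Proof.
move=> /expansion_le h i; have := h (semi0 sH) i.+1.
rewrite (seminorm0 sH) expr0n /= big_ord_recr /= pmulr_rle0 // => le0.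
apply/eqP; rewrite -normc_eq0 -sqrf_eq0 eq_le sqr_ge0 andbT.
apply: le_trans le0; rewrite lerDr; apply: sumr_ge0 => *; exact: sqr_ge0.
Qed.

Lemma expansion_inj x c d : H x -> expansion x c -> expansion x d -> c =1 d.
Proof.
move=> hx xc /(expansionZ (-1) hx) xd i.
have hN : H (-1 *: x) by exact: (semiZ sH).
have := expansionD hx hN xc xd; rewrite scaleN1r subrr => /expansion0/(_ i)/eqP.
by rewrite mulN1r subr_eq0 => /eqP.
Qed.

Lemma expansion_null x : expansion x (fun=> 0) -> N x = 0.
Proof.
move=> x0; apply/eqP; rewrite eq_le N_ge0 andbT; apply: vanish_cst.
apply: (@vanish_le _ 0 _ _ _ x0) => n _.
by rewrite /comb big1 ?subr0 // => i _; rewrite scale0r.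
Qed.

Lemma expansion_comb c n :
  expansion (S c n) (fun i => if (i < n)%N then c i else 0).
Proof.
move=> e e0; exists n => m nm.
by rewrite -(comb_widen _ _ nm) subrr (seminorm0 sH).
Qed.

(** The coefficients of approximating combinations form a Cauchy sequence in
    l^2; only their entrywise limits are needed. *)
Lemma expansion_ex x : H x -> exists c, expansion x c.
Proof.
move=> hx; have [_ dns _] := basis.
have /choice[nc ncP] : forall k : nat, exists nc : nat * (nat -> C),
    N (x - S nc.2 nc.1) < k.+1%:R^-1.
  by move=> k; have [|n [c]] := dns x hx k.+1%:R^-1; [rewrite invr_gt0|exists (n, c)].
pose c k i := if (i < (nc k).1)%N then (nc k).2 i else 0.
have combE k n : ((nc k).1 <= n)%N -> S (c k) n = S (nc k).2 (nc k).1.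
  by move=> le_n; rewrite -comb_widen.
have near k n : ((nc k).1 <= n)%N -> N (x - S (c k) n) < k.+1%:R^-1.
  by move=> /combE ->.
have dist k l n : c1 * \sum_(i < n) normc (c k i - c l i) ^+ 2
                  <= (k.+1%:R^-1 + l.+1%:R^-1) ^+ 2.
  pose m := maxn n (maxn (nc k).1 (nc l).1).
  have /near nk : ((nc k).1 <= m)%N by rewrite /m !leq_max leqnn !orbT.
  have /near nl : ((nc l).1 <= m)%N by rewrite /m !leq_max leqnn !orbT.
  have := lower m (fun i => c k i - c l i); rewrite combB => lo.
  have tr := seminorm_trans sH (H_comb (c k) m) hx (H_comb (c l) m).
  rewrite (seminormBC sH (H_comb (c k) m) hx) in tr.
  have le1 : N (S (c k) m - S (c l) m) <= k.+1%:R^-1 + l.+1%:R^-1.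
    by apply: le_trans tr _; rewrite lerD // ltW.
  apply: le_trans (_ : _ <= N (S (c k) m - S (c l) m) ^+ 2) _.
    apply: le_trans lo; rewrite ler_pM2l //.
    rewrite (big_ord_widen m (fun i => normc (c k i - c l i) ^+ 2)) ?leq_maxl //.
    rewrite big_mkcond.
    by apply: ler_sum => i _; case: ifP => // _; exact: sqr_ge0.
  by rewrite ler_pXn2r ?nnegrE ?addr_ge0 ?invr_ge0.
have entry k l i : Num.sqrt c1 * normc (c k i - c l i) <= k.+1%:R^-1 + l.+1%:R^-1.
  rewrite -(ler_pXn2r (_ : 0 < 2)%N) ?nnegrE ?mulr_ge0 ?normc_ge0 ?addr_ge0 ?invr_ge0 //.
  apply: le_trans (dist k l i.+1); rewrite exprMn sqr_sqrtr ?(ltW c1_gt0) //.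
  rewrite ler_pM2l // big_ord_recr /= lerDr.
  by apply: sumr_ge0 => *; exact: sqr_ge0.
have s1 : 0 < Num.sqrt c1 by rewrite sqrtr_gt0.
have /choice[d dP] : forall i, exists l, vanish (fun k => normc (c k i - l)).
  move=> i; apply: complex_cauchy_cvg => e e0.
  have e2 : 0 < Num.sqrt c1 * e / 2 by rewrite divr_gt0 // mulr_gt0.
  have [k0 k0P] := @vanish_inv R _ e2; exists k0 => k l /k0P hk /k0P hl.
  rewrite -(ltr_pM2l s1); apply: le_lt_trans (entry k l i) _.
  by move: hk hl; move: k.+1%:R^-1 l.+1%:R^-1 => p q; lra.
have inv0 k : 0 <= k.+1%:R^-1 :> R by rewrite invr_ge0.
(* Let [l] tend to infinity in [dist]. *)
have dist_lim k n : c1 * \sum_(i < n) normc (c k i - d i) ^+ 2 <= (2 * k.+1%:R^-1) ^+ 2.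
  have sum0 : vanish (fun l => \sum_(i < n) normc (c l i - d i)).
    elim: n {-2}n (leqnn n) => [|j IH] [|n] // le_n; try by move=> e e0; exists 0 => ? _; rewrite big_ord0.
    apply: (@vanish_le _ 0 _ _ _ (vanishD (IH n le_n) (dP n))) => l _.
    by rewrite big_ord_recr.
  rewrite -subr_le0; apply: vanish_cst.
  pose b (l : nat) := c1 * \sum_(i < n) normc (c k i - c l i) ^+ 2.
  have bnd_k i l : normc (c k i - d i) ^+ 2 <=
      normc (c k i - c l i) ^+ 2 + normc (c l i - d i) *
      (2 * (2 / Num.sqrt c1 + normc (c l i - d i))).
    have t : normc (c k i - d i) <= normc (c k i - c l i) + normc (c l i - d i).
      by rewrite -[c k i - d i](subrKA (c l i)) normcD_le.
    have e1 : normc (c k i - c l i) <= 2 / Num.sqrt c1.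
      rewrite ler_pdivlMr // mulrC; apply: le_trans (entry _ _ _) _.
      have i1 j : j.+1%:R^-1 <= 1 :> R by rewrite invf_le1 // ler1n.
      by rewrite -[2]/(1 + 1) lerD.
    have := normc_ge0 (c k i - d i); have := normc_ge0 (c k i - c l i).
    have := normc_ge0 (c l i - d i); nra.
  have K0 : 0 <= c1 * (2 * (2 / Num.sqrt c1 + 1)).
    by rewrite mulr_ge0 ?(ltW c1_gt0) // mulr_ge0 // addr_ge0 // divr_ge0 // ltW.
  have [l1 l1P] := sum0 _ ltr01.
  have [l2 l2P] : exists l2, forall l, (l2 <= l)%N -> l.+1%:R^-1 <= k.+1%:R^-1 :> R.
    by exists k => l kl; rewrite lef_pV2 ?posrE // ler_nat.
  apply: (@vanish_le _ (maxn l1 l2) _ _ _ (vanishZ K0 sum0)) => l.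
  rewrite geq_max => /andP[/l1P lt1 /l2P le2].
  have dkl := dist k l n.
  have le3 : (k.+1%:R^-1 + l.+1%:R^-1) ^+ 2 <= (2 * k.+1%:R^-1 : R) ^+ 2.
    by rewrite ler_pXn2r ?nnegrE ?addr_ge0 ?mulr_ge0 //; move: le2; move: k.+1%:R^-1 l.+1%:R^-1 => p q; lra.
  suff : \sum_(i < n) normc (c k i - d i) ^+ 2 <=
      \sum_(i < n) normc (c k i - c l i) ^+ 2 +
      2 * (2 / Num.sqrt c1 + 1) * \sum_(i < n) normc (c l i - d i).
    move=> /(ler_wpM2l (ltW c1_gt0)) le4; have := le_trans dkl le3; move: le4.
    by move: ((2 * k.+1%:R^-1) ^+ 2) (2 / Num.sqrt c1 + 1) => p q; lra.
  rewrite mulr_sumr -big_split /=; apply: ler_sum => i _.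
  apply: le_trans (bnd_k i l) _; rewrite lerD2l mulrC ler_wpM2r ?normc_ge0 //.
  rewrite ler_wpM2l // lerD2l; apply: ltW; apply: le_lt_trans lt1.
  rewrite (bigD1 i) //= lerDl; apply: sumr_ge0 => *; exact: normc_ge0.
exists d.
have K0 : 0 <= 1 + Num.sqrt (c2 / c1) * 2 by rewrite addr_ge0 // mulr_ge0 // sqrtr_ge0.
move=> e e0; have [k kP] := vanishZ K0 (@vanish_inv R) e0.
exists (nc k).1 => n le_n; apply: le_lt_trans (kP k (leqnn k)).
apply: le_trans (seminorm_trans sH hx (H_comb (c k) n) (H_comb d n)) _.
rewrite mulrDl mul1r; apply: lerD; first exact/ltW/near.
rewrite -combB -mulrA -(ler_pXn2r (_ : 0 < 2)%N) ?nnegrE ?mulr_ge0 ?sqrtr_ge0 //.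
apply: le_trans (upper _ _) _; rewrite exprMn sqr_sqrtr; last first.
  by rewrite divr_ge0 // ltW.
rewrite -mulrA ler_pM2l // ler_pdivlMl //; exact: dist_lim.
Qed.

(** By completeness: the upper Riesz bound makes the partial sums a Cauchy sequence. *)
Lemma expansion_synthesis (c : nat -> C) M : seminorm_complete H N ->
  (forall n, \sum_(i < n) normc (c i) ^+ 2 <= M) ->
  exists2 x, H x & expansion x c.
Proof.
move=> cH cM; have c_ge0 i : 0 <= normc (c i) ^+ 2 by exact: sqr_ge0.
have cauchy_c := bounded_sum_cauchy c_ge0 cM.
have [|e e0|x hx xP] := cH (S c) => //.
- have e1 : 0 < e ^+ 2 / c2 by rewrite divr_gt0 // exprn_gt0.
  have [n0 n0P] := cauchy_c _ e1.
  have le_case i j : (n0 <= i)%N -> (i <= j)%N -> N (S c j - S c i) < e.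
    move=> n0i ij; rewrite (comb_widen _ _ ij) -combB.
    rewrite -(ltr_pXn2r (_ : 0 < 2)%N) ?nnegrE ?(ltW e0) //.
    apply: le_lt_trans (upper _ _) _; rewrite mulrC -ltr_pdivlMr //.
    apply: le_lt_trans (n0P i j n0i ij).
    rewrite (big_ord_widen j (fun i => normc (c i) ^+ 2) ij) [X in _ - X]big_mkcond.
    rewrite -sumrB; apply: ler_sum => k _; case: ifP => _; last by rewrite !subr0.
    by rewrite !subrr normc0 expr0n.
  exists n0 => i j n0i n0j; have [ij|/ltnW ji] := leqP i j; last exact: le_case.
  by rewrite (seminormBC sH) //; exact: le_case.
- by exists x => //; apply: (@vanish_le _ 0 _ _ _ xP) => n _; rewrite (seminormBC sH).
Qed.

Definition coef x : nat -> C := xget (fun=> 0) [set c | expansion x c].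

Lemma coefP x : H x -> expansion x (coef x).
Proof. by move=> /expansion_ex[c xc]; rewrite /coef; case: xgetP => [d _ //|/(_ c)]. Qed.

Lemma coef_eq x c : H x -> expansion x c -> coef x =1 c.
Proof. by move=> hx; apply: expansion_inj => //; exact: coefP. Qed.

Lemma coefD x y i : H x -> H y -> coef (x + y) i = coef x i + coef y i.
Proof.
move=> hx hy; have h := expansionD hx hy (coefP hx) (coefP hy).
exact: coef_eq (semiD sH hx hy) h i.
Qed.

Lemma coefZ k x i : H x -> coef (k *: x) i = k * coef x i.
Proof.
move=> hx; exact: coef_eq (semiZ sH k hx) (expansionZ k hx (coefP hx)) i.
Qed.

Lemma coef0 i : coef 0 i = 0.
Proof. by rewrite -(scale0r 0) coefZ ?mul0r //; exact: semi0 sH. Qed.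

Lemma coefB x y i : H x -> H y -> coef (x - y) i = coef x i - coef y i.
Proof.
by move=> hx hy; rewrite -scaleN1r coefD // ?coefZ ?mulN1r //; exact: (semiZ sH).
Qed.

Lemma coef_sum (I : Type) (r : seq I) (P : pred I) (F : I -> V) i :
  (forall j, P j -> H (F j)) ->
  coef (\sum_(j <- r | P j) F j) i = \sum_(j <- r | P j) coef (F j) i.
Proof.
move=> hF; elim: r => [|j r IH]; first by rewrite !big_nil coef0.
rewrite !big_cons; case: ifP => // Pj.
by rewrite coefD ?IH //; [exact: hF | exact: (semi_sum sH)].
Qed.

Lemma coef_phi n i : coef (phi n) i = (i == n)%:R.
Proof.
pose d j : C := (j == n)%:R.
have dE : S d n.+1 = phi n.
  rewrite /comb big_ord_recr /= /d eqxx scale1r.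
  by rewrite big1 ?add0r // => j _; rewrite (ltn_eqF (ltn_ord j)) scale0r.
have h : expansion (phi n) (fun j => if (j < n.+1)%N then d j else 0).
  by rewrite -dE; exact: expansion_comb.
rewrite (coef_eq (H_phi n) h); case: ifP => //; rewrite /d ltnS.
by case: eqP => // ->; rewrite leqnn.
Qed.

Lemma coef_le x n : H x -> c1 * \sum_(i < n) normc (coef x i) ^+ 2 <= N x ^+ 2.
Proof. by move=> hx; apply: expansion_le => //; exact: coefP. Qed.

Lemma coef_bound x i : H x -> normc (coef x i) <= (Num.sqrt c1)^-1 * N x.
Proof.
move=> hx; rewrite ler_pdivlMl ?sqrtr_gt0 //.
rewrite -(ler_pXn2r (_ : 0 < 2)%N) ?nnegrE ?mulr_ge0 ?normc_ge0 ?sqrtr_ge0 //.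
rewrite exprMn sqr_sqrtr ?(ltW c1_gt0) //; apply: le_trans (coef_le i.+1 hx).
rewrite ler_pM2l // big_ord_recr /= lerDr; apply: sumr_ge0 => *; exact: sqr_ge0.
Qed.

Lemma coef_null x : H x -> (forall i, coef x i = 0) -> N x = 0.
Proof.
move=> hx c0; apply: expansion_null; have := coefP hx.
by rewrite (_ : coef x = fun=> 0) //; apply/funext.
Qed.

Lemma coef_synthesis (c : nat -> C) M : seminorm_complete H N ->
  (forall n, \sum_(i < n) normc (c i) ^+ 2 <= M) ->
  exists2 x, H x & forall i, coef x i = c i.
Proof.
move=> cH /(expansion_synthesis cH)[x hx xc]; exists x => // i.
exact: (coef_eq hx xc).
Qed.

End Coefficients.

Section ChangeHead.
Context {R : realType} {V : lmodType R[i]}.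
Local Notation C := R[i].
Variables (H : set V) (N : V -> R) (phi : nat -> V) (c1 c2 : R).
Hypotheses (sH : seminormed H N) (basis : riesz_basis H N phi).
Hypotheses (bnd : riesz_bounds N phi c1 c2).
Variables (d : nat) (chi : 'I_d -> V).
Hypothesis H_chi : forall i, H (chi i).
Local Notation coef := (coef N phi).
Hypothesis unit_chi : (\matrix_(i, j) coef (chi i) j) \in unitmx.

Definition change_head n := oapp chi (phi n) (insub n).

Lemma change_head_lt (i : 'I_d) : change_head i = chi i.
Proof. by rewrite /change_head valK. Qed.

Lemma change_head_ge n : (d <= n)%N -> change_head n = phi n.
Proof. by move=> dn; rewrite /change_head insubF // ltnNge dn. Qed.

Let H_phi n : H (phi n). Proof. by case: basis. Qed.
Let N_ge0 x : 0 <= N x. Proof. exact: seminorm_ge0 sH _. Qed.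
Let c1_gt0 : 0 < c1. Proof. by case: bnd. Qed.
Let c2_gt0 : 0 < c2. Proof. by case: bnd. Qed.
Let Z := \matrix_(i < d, j < d) coef (chi i) j.
Let head (c : nat -> C) := \sum_(i < d) c i *: chi i.
Let tailc (c : nat -> C) i := if (i < d)%N then 0 else c i.

Let H_head c : H (head c).
Proof. by apply: (semi_sum sH) => i _; exact: (semiZ sH). Qed.

Let H_comb c n : H (comb phi c n).
Proof. refine (semi_comb sH _ _ H_phi). Qed.

Lemma H_change_head n : H (change_head n).
Proof. by rewrite /change_head; case: insub => /=. Qed.

Let comb_split c n : (d <= n)%N -> comb change_head c n = head c + comb phi (tailc c) n.
Proof.
move=> dn; rewrite /comb (bigID (fun i : 'I_n => (i < d)%N)) /=; congr (_ + _).
  rewrite -(big_ord_widen n (fun i => c i *: change_head i) dn).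
  by apply: eq_bigr => i _; rewrite change_head_lt.
rewrite big_mkcond; apply: eq_bigr => i _; rewrite /tailc.
by case: ltnP => /= [_|di]; rewrite ?scale0r // change_head_ge.
Qed.

Let sum_split (c : nat -> C) n : (d <= n)%N ->
  \sum_(i < n) normc (c i) ^+ 2 =
  \sum_(i < d) normc (c i) ^+ 2 + \sum_(i < n) normc (tailc c i) ^+ 2.
Proof.
move=> dn; rewrite (bigID (fun i : 'I_n => (i < d)%N)) /=; congr (_ + _).
  by rewrite -(big_ord_widen n (fun i => normc (c i) ^+ 2) dn).
rewrite big_mkcond; apply: eq_bigr => i _; rewrite /tailc.
by case: ltnP => // _; rewrite normc0 expr0n.
Qed.

Let coef_head c (j : 'I_d) : coef (head c) j = \sum_(i < d) c i * Z i j.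
Proof.
rewrite (coef_sum sH basis bnd); last by move=> i _; exact: (semiZ sH).
by apply: eq_bigr => i _; rewrite (coefZ sH basis bnd) // mxE.
Qed.

Let coef_tail c n (j : 'I_d) : coef (comb phi (tailc c) n) j = 0.
Proof.
rewrite (coef_sum sH basis bnd); last by move=> i _; exact: (semiZ sH).
rewrite big1 // => i _; rewrite (coefZ sH basis bnd) // (coef_phi sH basis bnd) /tailc.
case: ifP => [_|]; first by rewrite mul0r.
by case: eqP => [<-|_ _]; rewrite ?ltn_ord ?mulr0.
Qed.

(** The first coefficients of a combination are recovered, through the inverse
    matrix, from finitely many bounded functionals; removing the head then leaves
    a combination of the old basis. *)
Lemma riesz_basis_change_head : riesz_basis H N change_head.
Proof.
pose K := \sum_(i < d) \sum_(j < d) normc (invmx Z j i) * (Num.sqrt c1)^-1.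
have K0 : 0 <= K.
  by do 2![apply: sumr_ge0 => ? _]; rewrite mulr_ge0 ?normc_ge0 ?invr_ge0 ?sqrtr_ge0.
have head_le (c : nat -> C) n (i : 'I_d) : (d <= n)%N -> normc (c i) <= K * N (comb change_head c n).
  move=> dn; set x := comb _ _ _.
  have hx : H x by rewrite /x comb_split //; exact: (semiD sH).
  have cE : c i = \sum_(j < d) coef x j * invmx Z j i.
    have e : (\row_j coef x j) = (\row_j c (nat_of_ord j)) *m Z.
      apply/rowP => j; rewrite !mxE /x comb_split // (coefD sH basis bnd) //.
      by rewrite coef_tail addr0 coef_head; apply: eq_bigr => k _; rewrite !mxE.
    move/(congr1 (mulmx^~ (invmx Z))): e; rewrite /= mulmxK // => /rowP/(_ i).
    by rewrite !mxE => <-; apply: eq_bigr => j _; rewrite !mxE.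
  rewrite cE; apply: le_trans (normc_sum_le _ _ _) _.
  apply: le_trans (_ : _ <= (\sum_(j < d) normc (invmx Z j i) * (Num.sqrt c1)^-1) * N x) _.
    rewrite mulr_suml; apply: ler_sum => j _; rewrite normcM mulrC -mulrA.
    rewrite ler_wpM2l ?normc_ge0 //; exact: coef_bound sH basis bnd _ _ hx.
  rewrite ler_wpM2r //; apply: (ler_term_sum (F := fun i : 'I_d => \sum_(j < d) _)) => k.
  by apply: sumr_ge0 => ? _; rewrite mulr_ge0 ?normc_ge0 ?invr_ge0 ?sqrtr_ge0.
pose X := \sum_(i < d) N (chi i) ^+ 2.
have X0 : 0 <= X by apply: sumr_ge0 => *; exact: sqr_ge0.
have N_head (c : nat -> C) : N (head c) ^+ 2 <= (\sum_(i < d) normc (c i) ^+ 2) * X.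
  have := seminorm_comb sH c d H_change_head; rewrite comb_split //.
  have -> : comb phi (tailc c) d = 0.
    by rewrite /comb big1 // => i _; rewrite /tailc ltn_ord scale0r.
  by rewrite addr0 /X; under [X in _ <= _ * X]eq_bigr do rewrite change_head_lt.
pose D := d%:R * K ^+ 2; have D0 : 0 <= D by rewrite mulr_ge0 ?ler0n ?sqr_ge0.
pose E := D + 2 * (1 + D * X) / c1.
have E1 : 0 < 1 + E.
  by rewrite addrC ltr_wpDl // addr_ge0 // divr_ge0 ?(ltW c1_gt0) // mulr_ge0 // addr_ge0 // mulr_ge0.
have DX0 : 0 <= D * X by exact: mulr_ge0.
have bnd_ge n (c : nat -> C) : (d <= n)%N ->
    (1 + E)^-1 * \sum_(i < n) normc (c i) ^+ 2 <= N (comb change_head c n) ^+ 2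
    <= (2 * (X + c2)) * \sum_(i < n) normc (c i) ^+ 2.
  move=> dn; have [_ _ /(_ n (tailc c))/andP[lo up]] := bnd.
  have hle i := head_le c n i dn; move: hle.
  rewrite sum_split // comb_split // => hle.
  set x := head c + _ in hle *.
  have hx : H x by exact: (semiD sH).
  have s1 : \sum_(i < d) normc (c i) ^+ 2 <= D * N x ^+ 2.
    apply: le_trans (_ : _ <= \sum_(i < d) (K * N x) ^+ 2) _.
      by apply: ler_sum => i _; rewrite ler_pXn2r ?nnegrE ?normc_ge0 ?mulr_ge0.
    by rewrite sumr_const card_ord -[_ *+ d]mulr_natl exprMn mulrA.
  have s1_0 : 0 <= \sum_(i < d) normc (c i) ^+ 2 by apply: sumr_ge0 => *; exact: sqr_ge0.
  have s2_0 : 0 <= \sum_(i < n) normc (tailc c i) ^+ 2 by apply: sumr_ge0 => *; exact: sqr_ge0.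
  have Nx := seminormD sH (H_head c) (H_comb (tailc c) n).
  have Nt : N (comb phi (tailc c) n) <= N x + N (head c).
    have -> : comb phi (tailc c) n = x - head c by rewrite /x addrC addKr.
    exact: (seminormB sH).
  have Nh := N_head c.
  have Nh' : N (head c) ^+ 2 <= D * X * N x ^+ 2.
    by apply: le_trans Nh _; rewrite mulrAC ler_wpM2r.
  have h0 := N_ge0 (head c); have t0 := N_ge0 (comb phi (tailc c) n); have x0 := N_ge0 x.
  move: lo up s1 s1_0 s2_0 Nx Nt Nh Nh' h0 t0 x0.
  move: (\sum_(i < d) _) (\sum_(i < n) _) (N x) (N (head c)) (N (comb _ _ _)).
  move=> s1 s2 r p q lo up s1D s1_0 s2_0 rpq qrp pX pr p0 q0 r0.
  have q2 : q ^+ 2 <= 2 * (1 + D * X) * r ^+ 2.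
    have : q ^+ 2 <= (r + p) ^+ 2 by rewrite ler_pXn2r // nnegrE addr_ge0.
    have := sqr_ge0 (r - p); nra.
  apply/andP; split.
    rewrite ler_pdivrMl // mulrDl mul1r /E mulrDl.
    have s2r : s2 <= 2 * (1 + D * X) / c1 * r ^+ 2.
      by rewrite mulrAC ler_pdivlMr // mulrC; apply: le_trans lo q2.
    have := sqr_ge0 r; lra.
  have : r ^+ 2 <= (p + q) ^+ 2 by rewrite ler_pXn2r // nnegrE addr_ge0.
  have := sqr_ge0 (p - q).
  have : 0 <= X * s2 by exact: mulr_ge0.
  have : 0 <= c2 * s1 by rewrite mulr_ge0 // ltW.
  nra.
have bnd_psi : riesz_bounds N change_head (1 + E)^-1 (2 * (X + c2)).
  split; [by rewrite invr_gt0|by rewrite mulr_gt0 // ltr_wpDl|move=> n c].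
  have := bnd_ge (maxn d n) (fun i => if (i < n)%N then c i else 0) (leq_maxl _ _).
  rewrite -comb_widen ?leq_maxr //.
  suff -> : \sum_(i < maxn d n) normc (if (i < n)%N then c i else 0) ^+ 2 =
            \sum_(i < n) normc (c i) ^+ 2 by [].
  rewrite (big_ord_widen (maxn d n) (fun i => normc (c i) ^+ 2)) ?leq_maxr //.
  rewrite [RHS]big_mkcond; apply: eq_bigr => i _.
  by case: ifP => //; rewrite normc0 expr0n.
apply: (riesz_basis_intro H_change_head bnd_psi) => x hx e e0.
pose z := (\row_j coef x j) *m invmx Z.
pose y := x - \sum_(i < d) z 0 i *: chi i.
have hz : H (\sum_(i < d) z 0 i *: chi i).
  by apply: (semi_sum sH) => i _; exact: (semiZ sH).
have hy : H y by exact: (semiB sH).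
have y0 (j : 'I_d) : coef y j = 0.
  rewrite (coefB sH basis bnd) // (coef_sum sH basis bnd); last by move=> i _; exact: (semiZ sH).
  have : (z *m Z) 0 j = coef x j by rewrite mulmxKV // mxE.
  rewrite mxE => <-; apply/eqP; rewrite subr_eq0; apply/eqP.
  by apply: eq_bigr => i _; rewrite (coefZ sH basis bnd) // [Z _ _]mxE.
have [n0 n0P] := coefP sH basis bnd hy e0.
exists (\sum_(i < d) z 0 i *: chi i + comb phi (coef y) n0).
  apply: in_spanD.
    apply: in_span_sum => i _; apply: in_spanZ.
    by rewrite -change_head_lt; exact: in_span_gen.
  exists n0, (coef y); apply: eq_bigr => i _.
  case: (ltnP i d) => [id|di]; last by rewrite change_head_ge.
  by rewrite (y0 (Ordinal id)) !scale0r.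
by rewrite opprD addrA; exact: n0P.
Qed.

End ChangeHead.

(** Over an algebraically closed field the generalized eigenvectors span, so a
    basis can be extracted from them. *)
Lemma root_vectors_unitmx (F : closedFieldType) d (B : 'M[F]_d) :
  exists2 Z : 'M[F]_d, Z \in unitmx &
    forall i, exists a k, iter k (fun z => z *m (a%:M - B)) (row i Z) = 0.
Proof.
case: d B => [|d] B; first by exists 1%:M; [exact: unitmx1 | case].
have [r rE] := closed_field_poly_normal (char_poly B).
have {}rE : char_poly B = \prod_(z <- r) ('X - z%:P).
  by rewrite rE (monicP (char_poly_monic B)) scale1r.
pose u := undup r; pose a_ (i : 'I_(size u)) := u`_i.
pose K_ (i : 'I_(size u)) := kermxpoly B (('X - (a_ i)%:P) ^+ count_mem (a_ i) r).
have full : (\mxcol_i K_ i :=: 1%:M)%MS.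
  apply: eqmx_trans (eqmx_col _) _.
  have gen : (\sum_i <<K_ i>> :=: \sum_i K_ i)%MS.
    by apply: eqmx_sums => i _; exact: genmxE.
  apply: eqmx_trans gen _.
  have co : {in predT &, forall i j : 'I_(size u), j != i ->
      coprimep (('X - (a_ i)%:P) ^+ count_mem (a_ i) r)
               (('X - (a_ j)%:P) ^+ count_mem (a_ j) r)}.
    move=> i j _ _ ji; apply/coprimep_expl/coprimep_expr/coprimep_XsubC2.
    by rewrite subr_eq0 nth_uniq // undup_uniq.
  apply: eqmx_trans (eqmx_sym (kermxpoly_prod B co)) _.
  apply: kermxpoly_min; apply: dvdp_trans (mxminpoly_dvd_char B) _.
  rewrite rE -prodr_undup_exp_count -/u (big_nth 0) big_mkord; exact: dvdpp.
have rf : row_full (\mxcol_i K_ i) by rewrite -sub1mx full.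
exists (rowsub (fullrankfun rf) (\mxcol_i K_ i)); first exact: fullrowsub_unit.
move=> i; rewrite row_rowsub row_mxcol; set j := tagnat.sig1 _; set l := tagnat.sig2 _.
exists (a_ j), (count_mem (a_ j) r); set k := count_mem _ _ in l *.
have : row l (K_ j) *m horner_mx B (('X - (a_ j)%:P) ^+ k) = 0.
  by apply/sub_kermxP; exact: row_sub.
move: (row l (K_ j)) => z.
rewrite rmorphXn rmorphB /= horner_mx_X horner_mx_C => zk.
have iterE n (y : 'rV_d.+1) :
    iter n (fun z => z *m ((a_ j)%:M - B)) y = y *m ((a_ j)%:M - B) ^+ n.
  elim: n => [|n IH]; first by rewrite expr0 mulmx1.
  by rewrite iterS IH exprSr mulmxA.
rewrite iterE -(opprB B) exprNn -signr_odd.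
by case: odd; rewrite ?mulN1r ?mul1r ?mulmxN zk ?oppr0.
Qed.

(** * Riesz bases of root vectors *)

Section RootVectorBasis.
Context {R : realType} {V : lmodType R[i]}.
Local Notation C := R[i].
Variables (H : set V) (N : V -> R) (G : V -> V -> Prop) (K : R).

(** [G u v] is to be read as: [u] is in the domain of an operator [A] and
    [A u = v].  The clauses say that [A] is linear and densely defined, and that
    it has a bounded inverse defined everywhere. *)
Record boundedly_invertible : Prop := BoundedlyInvertible {
  inv_dom : forall u v, G u v -> H u /\ H v;
  inv_lin : forall k u v u' v', G u v -> G u' v' -> G (k *: u + u') (k *: v + v');
  inv_bound0 : 0 <= K;
  inv_bound : forall u v, G u v -> N u <= K * N v;
  inv_surj : forall v, H v -> exists u, G u v;
  inv_dense : forall x, H x -> forall e, 0 < e -> exists u v, G u v /\ N (x - u) < e;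
  inv_null : forall u v u', G u v -> H u' -> N (u - u') = 0 -> G u' v }.

Hypotheses (sH : seminormed H N) (cH : seminorm_complete H N).
Hypothesis GP : boundedly_invertible.

Let N_ge0 x : 0 <= N x. Proof. exact: seminorm_ge0 sH _. Qed.

Lemma inv00 : G 0 0.
Proof.
have [u Gu] := inv_surj GP (semi0 sH).
by have := inv_lin GP (-1) Gu Gu; rewrite !scaleN1r addNr oppr0 addr0.
Qed.

Lemma invZ k u v : G u v -> G (k *: u) (k *: v).
Proof. by move=> Gu; have := inv_lin GP k Gu inv00; rewrite !addr0. Qed.

Lemma invD u v u' v' : G u v -> G u' v' -> G (u + u') (v + v').
Proof. by move=> Gu; have := inv_lin GP 1 Gu => /[apply]; rewrite !scale1r. Qed.

Lemma invB u v u' v' : G u v -> G u' v' -> G (u - u') (v - v').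
Proof. by move=> Gu /(invZ (-1)); rewrite !scaleN1r; exact: invD. Qed.

Lemma inv_sum (I : Type) (r : seq I) (P : pred I) (F F' : I -> V) :
  (forall i, G (F i) (F' i)) -> G (\sum_(i <- r | P i) F i) (\sum_(i <- r | P i) F' i).
Proof. by move=> FP; elim/big_ind2 : _ => // *; [exact: inv00|exact: invD]. Qed.

Section EigenvectorTail.
Variables (b : nat -> V) (c1 c2 : R) (d0 : nat) (lam : nat -> C).
Hypotheses (basis : riesz_basis H N b) (bnd : riesz_bounds N b c1 c2).
Hypothesis eigen : forall n, (d0 <= n)%N -> G (b n) (lam n *: b n).
Hypothesis lam_inj : forall m n, (d0 <= m)%N -> (d0 <= n)%N -> lam m = lam n -> m = n.
Hypothesis lam_neq0 : forall n, (d0 <= n)%N -> lam n != 0.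
Hypothesis lam_oo : forall M, exists n1, forall n, (n1 <= n)%N -> M <= normc (lam n).
Local Notation coef := (coef N b).

Let H_b n : H (b n). Proof. by case: basis. Qed.
Let c1_gt0 : 0 < c1. Proof. by case: bnd. Qed.
Let mu n := (lam n)^-1.

Let Tb_ex : exists Tb : nat -> V, forall j, G (Tb j) (b j).
Proof.
have /choice[Tb TbP] : forall j, exists u, G u (b j).
  by move=> j; exact: inv_surj GP _ (H_b j).
by exists Tb.
Qed.
Let Tb := projT1 (cid Tb_ex).
Let Tb_G j : G (Tb j) (b j). Proof. exact: projT2 (cid Tb_ex) j. Qed.
Let H_Tb j : H (Tb j). Proof. by case: (inv_dom GP (Tb_G j)). Qed.
Let t j i := coef (Tb j) i.

Let coef_inv0 u i : G u 0 -> coef u i = 0.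
Proof.
move=> Gu; have [hu _] := inv_dom GP Gu.
have := inv_bound GP Gu; rewrite (seminorm0 sH) mulr0 => Nu.
have := coef_bound sH basis bnd i hu.
have -> : N u = 0 by apply/eqP; rewrite eq_le Nu N_ge0.
rewrite mulr0 => le0; apply/eqP; rewrite -normc_eq0 eq_le le0; exact: normc_ge0.
Qed.

Let t_tail j i : (d0 <= j)%N -> t j i = (i == j)%:R * mu j.
Proof.
move=> dj; have := invB (Tb_G j) (invZ (mu j) (eigen dj)).
rewrite scalerA mulVf ?lam_neq0 // scale1r subrr => /(coef_inv0 i).
rewrite (coefB sH basis bnd) //; last exact: (semiZ sH).
rewrite (coefZ sH basis bnd) // (coef_phi sH basis bnd) => /eqP.
by rewrite subr_eq0 mulrC => /eqP.
Qed.

(** In coordinates the inverse operator is block triangular: a [d] by [d]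
    block, diagonal entries [mu i] beyond it, and a coupling block. *)
Let coef_inv u x d i : (d0 <= d)%N -> G u x ->
  coef u i = \sum_(j < d) coef x j * t j i + (if (d <= i)%N then mu i * coef x i else 0).
Proof.
move=> d0d Gu; have [hu hx] := inv_dom GP Gu; set rhs := RHS.
pose un n := comb Tb (coef x) n.
have Gun n : G (un n) (comb b (coef x) n) by apply: inv_sum => j; exact: invZ.
have coef_un n : (maxn d i.+1 <= n)%N -> coef (un n) i = rhs.
  rewrite geq_max => /andP[dn ltin].
  rewrite (coef_sum sH basis bnd); last by move=> j _; exact: (semiZ sH).
  under eq_bigr do rewrite (coefZ sH basis bnd) //.
  rewrite (bigID (fun j : 'I_n => (j < d)%N)) /=; congr (_ + _).
    by rewrite -(big_ord_widen n (fun j => coef x j * t j i) dn).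
  case: leqP => di.
    rewrite (bigD1 (Ordinal ltin)) -?leqNgt //= big1 ?addr0.
      by rewrite -/(t i i) t_tail ?(leq_trans d0d) // eqxx mul1r mulrC.
    move=> j /andP[]; rewrite -leqNgt => dj /negPf ji.
    rewrite -/(t j i) t_tail ?(leq_trans d0d) //.
    have -> : (i == j) = false by rewrite eq_sym; exact: ji.
    by rewrite mul0r mulr0.
  rewrite big1 // => j; rewrite -leqNgt => dj.
  rewrite -/(t j i) t_tail ?(leq_trans d0d) //.
  by rewrite (ltn_eqF (leq_trans di dj)) mul0r mulr0.
suff : normc (coef u i - rhs) <= 0.
  by move=> le0; apply/eqP; rewrite -subr_eq0 -normc_eq0 eq_le le0 normc_ge0.
apply: vanish_cst.
have xc := coefP sH basis bnd hx.
have k0 : 0 <= (Num.sqrt c1)^-1 * K.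
  by rewrite mulr_ge0 ?invr_ge0 ?sqrtr_ge0 //; exact: inv_bound0 GP.
apply: (@vanish_le _ (maxn d i.+1) _ _ _ (vanishZ k0 xc)) => n le_n.
have [hun _] := inv_dom GP (Gun n).
rewrite -(coef_un n le_n) -(coefB sH basis bnd) //.
apply: le_trans (coef_bound sH basis bnd i (semiB sH hu hun)) _.
rewrite -mulrA ler_wpM2l ?invr_ge0 ?sqrtr_ge0 //.
by apply: (inv_bound GP); exact: invB.
Qed.

Let M d := \matrix_(j < d, i < d) t j i.

(** A vector in the kernel of the head block would give a bounded functional
    vanishing on the range of the inverse, that is, on a dense subspace. *)
Let M_unit d : (d0 <= d)%N -> M d \in unitmx.
Proof.
move=> d0d; rewrite -unitmx_tr unitmxE unitfE; apply/negP => /eqP/eqP/det0P[v v0 vM].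
have vt (j : 'I_d) : \sum_(i < d) t j i * v 0 i = 0.
  move/rowP/(_ j): vM; rewrite !mxE => e; rewrite -[RHS]e.
  by apply: eq_bigr => i _; rewrite !mxE mulrC.
have ann u x : G u x -> \sum_(i < d) coef u i * v 0 i = 0.
  move=> Gu; transitivity (\sum_(i < d) \sum_(j < d) coef x j * (t j i * v 0 i)).
    apply: eq_bigr => i _; rewrite (coef_inv i d0d Gu) leqNgt ltn_ord addr0.
    by rewrite mulr_suml; apply: eq_bigr => j _; rewrite mulrA.
  by rewrite exchange_big big1 // => j _; rewrite -mulr_sumr vt mulr0.
case/negP: v0; apply/eqP/rowP => j; rewrite [RHS]mxE.
pose S := \sum_(i < d) normc (v 0 i).
have S0 : 0 <= S by apply: sumr_ge0 => *; exact: normc_ge0.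
suff : normc (v 0 j) <= 0.
  by move=> le0; apply/eqP; rewrite -normc_eq0 eq_le le0 normc_ge0.
rewrite leNgt; apply/negP => vj0.
have k0 : 0 <= (Num.sqrt c1)^-1 * S by rewrite mulr_ge0 ?invr_ge0 ?sqrtr_ge0.
have e0 : 0 < normc (v 0 j) / ((Num.sqrt c1)^-1 * S + 1).
  by rewrite divr_gt0 // ltr_wpDl.
have [u [x [Gu]]] := inv_dense GP (H_b j) e0.
have [hu _] := inv_dom GP Gu.
rewrite ltr_pdivlMr ?ltr_wpDl //; apply/negP; rewrite -leNgt.
have vjE : v 0 j = \sum_(i < d) coef (b j - u) i * v 0 i.
  transitivity (\sum_(i < d) coef (b j) i * v 0 i - \sum_(i < d) coef u i * v 0 i).
    rewrite (ann _ _ Gu) subr0 (bigD1 j) //= (coef_phi sH basis bnd) eqxx mul1r.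
    rewrite big1 ?addr0 // => i ij; rewrite (coef_phi sH basis bnd).
    have -> : (nat_of_ord i == j) = false by apply: negbTE.
    by rewrite mul0r.
  by rewrite -sumrB; apply: eq_bigr => i _; rewrite (coefB sH basis bnd) // mulrBl.
rewrite {1}vjE; apply: le_trans (normc_sum_le _ _ _) _.
apply: le_trans (_ : _ <= N (b j - u) * ((Num.sqrt c1)^-1 * S)) _; last first.
  by rewrite ler_wpM2l // lerDl.
rewrite mulrA [N _ * _]mulrC /S mulr_sumr; apply: ler_sum => i _.
rewrite normcM ler_wpM2r ?normc_ge0 //.
by apply: (coef_bound sH basis bnd); exact: (semiB sH).
Qed.

Let mu_avoid (s : seq C) : exists n1, forall n, (n1 <= n)%N -> (d0 <= n)%N -> mu n \notin s.
Proof.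
elim: s => [|a s [n1 n1P]]; first by exists 0.
have [n2 n2P] := lam_oo ((normc a)^-1 + 1).
exists (maxn n1 n2) => n; rewrite geq_max => /andP[n1n n2n] d0n.
rewrite inE negb_or n1P // andbT; apply/eqP => aE.
have := n2P n n2n; rewrite -aE /mu normcV invrK; lra.
Qed.

(** The spectrum of [M d] is that of [M d0] together with the [mu i] for
    [d0 <= i < d], and the [mu n] are distinct and tend to zero: so only the finitely
    many eigenvalues of [M d0] have to be avoided. *)
Let resonance_free : exists2 d, (d0 <= d)%N &
  forall n, (d <= n)%N -> M d - (mu n)%:M \in unitmx.
Proof.
have [r rE] := closed_field_poly_normal (char_poly (M d0)).
have [n1 n1P] := mu_avoid r.
exists (maxn d0 n1); first by rewrite leq_maxl.
set d := maxn d0 n1 => n dn.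
have d0d : (d0 <= d)%N by rewrite leq_maxl.
have d0n : (d0 <= n)%N by rewrite (leq_trans _ dn).
have mu_r : mu n \notin r by rewrite n1P // (leq_trans _ dn) // leq_maxr.
rewrite unitmxE unitfE; apply/negP => /eqP/eqP/det0P[z z0].
rewrite mulmxBr mul_mx_scalar => /eqP; rewrite subr_eq0 => /eqP zM.
have zi (i : 'I_d) : \sum_(j < d) z 0 j * t j i = mu n * z 0 i.
  move/rowP/(_ i): zM; rewrite !mxE => <-.
  by apply: eq_bigr => j _; rewrite mxE.
have wid (i : 'I_d0) : (i < d)%N by apply: leq_trans d0d.
pose hz := \row_(i < d0) z 0 (widen_ord d0d i).
have sum_head (i : 'I_d) : \sum_(j < d) z 0 j * t j i =
    \sum_(j < d0) hz 0 j * t j i + (if (d0 <= i)%N then z 0 i * mu i else 0).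
  rewrite (bigID (fun j : 'I_d => (j < d0)%N)) /=; congr (_ + _).
    under [RHS]eq_bigr do rewrite mxE.
    by rewrite (big_ord_narrow d0d).
  case: leqP => di.
    rewrite (bigD1 i) -?leqNgt //= big1 ?addr0.
      by rewrite t_tail // eqxx mul1r.
    move=> j /andP[]; rewrite -leqNgt => dj /negPf ji.
    rewrite t_tail //.
    have -> : (nat_of_ord i == j) = false by rewrite eq_sym; exact: ji.
    by rewrite mul0r mulr0.
  rewrite big1 // => j; rewrite -leqNgt => dj.
  by rewrite t_tail // (ltn_eqF (leq_trans di dj)) mul0r mulr0.
have hz0 : hz = 0.
  apply/eqP; apply/negP => /negP hz0.
  have : eigenvalue (M d0) (mu n).
    apply/eigenvalueP; exists hz => //; apply/rowP => i.
    have := zi (widen_ord d0d i); rewrite sum_head /= leqNgt ltn_ord addr0 => e.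
    by rewrite !mxE -e; apply: eq_bigr => j _; rewrite !mxE.
  rewrite eigenvalue_root_char rE (monicP (char_poly_monic _)) scale1r.
  by rewrite root_prod_XsubC (negbTE mu_r).
case/negP: z0; apply/eqP/rowP => i; rewrite [RHS]mxE.
case: (ltnP i d0) => di.
  move/rowP/(_ (Ordinal di)): hz0; rewrite !mxE => <-.
  by congr (z 0 _); exact: val_inj.
have := zi i; rewrite sum_head di hz0 big1 ?add0r => [/eqP|j _]; last by rewrite mxE mul0r.
rewrite mulrC -subr_eq0 -mulrBl mulf_eq0 subr_eq0 => /orP[/eqP/invr_inj lam_eq|/eqP //].
have := lam_inj di d0n lam_eq => e.
by have := leq_trans (ltn_ord i) dn; rewrite -e ltnn.
Qed.

Let d := projT1 (cid2 resonance_free).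
Let d0d : (d0 <= d)%N. Proof. by rewrite /d; case: cid2. Qed.
Let res_free n : (d <= n)%N -> M d - (mu n)%:M \in unitmx.
Proof. by rewrite /d; case: cid2 => /= d' _; apply. Qed.

(** The tail [Y n] of the coordinates solves the Sylvester equation that makes
    the span of the corrected head vectors invariant. *)
Let L n := \col_(j < d) t j n.
Let Y n := invmx (M d - (mu n)%:M) *m L n.

Let Y_eq n : (d <= n)%N -> M d *m Y n = L n + mu n *: Y n.
Proof.
move=> dn; have := mulKVmx (res_free dn) (L n); rewrite -/(Y n) mulmxBl.
by rewrite mul_scalar_mx => <-; rewrite subrK.
Qed.

Let wcoef (j : 'I_d) i := if (i < d)%N then (i == j :> nat)%:R else Y i j 0.

(** For large [n] the equation [Y = M^-1 (L n + mu n Y)] bounds [Y n] by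
    [L n], whose entries are coordinates of fixed vectors. *)
Let wcoef_l2 (j : 'I_d) : exists E, forall n, \sum_(i < n) normc (wcoef j i) ^+ 2 <= E.
Proof.
pose kap := \sum_(i < d) \sum_(k < d) normc (invmx (M d) i k).
have kap0 : 0 <= kap by do 2![apply: sumr_ge0 => ? _]; exact: normc_ge0.
have [n2 n2P] := lam_oo (2 * kap + 1).
pose n1 := maxn d n2.
pose nY n := \sum_(i < d) normc (Y n i 0).
pose nL n := \sum_(k < d) normc (t k n).
have Y_le n : (n1 <= n)%N -> nY n <= 2 * kap * nL n.
  rewrite geq_max => /andP[dn n2n].
  have YE : Y n = invmx (M d) *m (L n + mu n *: Y n).
    by rewrite -Y_eq // mulKmx // M_unit.
  have lam_ge := n2P n n2n.
  have nY0 : 0 <= nY n by apply: sumr_ge0 => *; exact: normc_ge0.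
  have nL0 : 0 <= nL n by apply: sumr_ge0 => *; exact: normc_ge0.
  have le1 : nY n <= kap * (nL n + normc (mu n) * nY n).
    rewrite {1}/nY YE /kap mulr_suml; apply: ler_sum => i _; rewrite mxE.
    apply: le_trans (normc_sum_le _ _ _) _; rewrite mulr_suml; apply: ler_sum => k _.
    have -> : (L n + mu n *: Y n) k 0 = t k n + mu n * Y n k 0.
      by rewrite mxE; congr (_ + _); rewrite mxE.
    rewrite normcM ler_wpM2l ?normc_ge0 //.
    apply: le_trans (normcD_le _ _) _; rewrite normcM; apply: lerD.
      by apply: (ler_term_sum (F := fun k : 'I_d => normc (t k n))) => ?; exact: normc_ge0.
    rewrite ler_wpM2l ?normc_ge0 //.
    by apply: (ler_term_sum (F := fun k : 'I_d => normc (Y n k 0))) => ?; exact: normc_ge0.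
  have : kap * normc (mu n) <= 1 / 2.
    rewrite /mu normcV ler_pdivrMr; last by lra.
    by lra.
  have := normc_ge0 (mu n); move: le1 nY0 nL0; nra.
pose e n := (2 * kap) ^+ 2 * (d%:R * \sum_(k < d) normc (t k n) ^+ 2).
have e_ge0 n : 0 <= e n.
  by rewrite mulr_ge0 ?sqr_ge0 // mulr_ge0 ?ler0n // sumr_ge0 // => *; exact: sqr_ge0.
have w_le i : (n1 <= i)%N -> normc (wcoef j i) ^+ 2 <= e i.
  move=> n1i; have di : (d <= i)%N by rewrite (leq_trans _ n1i) // leq_maxl.
  rewrite /wcoef ltnNge di /=.
  apply: le_trans (_ : _ <= (2 * kap * nL i) ^+ 2) _.
    rewrite ler_pXn2r ?nnegrE ?normc_ge0 //; last first.
      by rewrite !mulr_ge0 // sumr_ge0 // => k _; exact: normc_ge0.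
    apply: le_trans (Y_le _ n1i).
    by apply: (ler_term_sum (F := fun k : 'I_d => normc (Y i k 0))) => ?; exact: normc_ge0.
  rewrite exprMn ler_wpM2l ?sqr_ge0 //.
  have := sum_CauchySchwarz d (fun=> 1) (fun k => normc (t k i)).
  rewrite expr1n sumr_const card_ord.
  by under eq_bigr do rewrite mul1r.
pose E0 := \sum_(i < n1) normc (wcoef j i) ^+ 2.
pose E1 := (2 * kap) ^+ 2 * (d%:R * \sum_(k < d) (N (Tb k) ^+ 2 / c1)).
exists (E0 + E1) => n.
apply: le_trans (_ : _ <= E0 + \sum_(i < n) e i) _; last first.
  rewrite lerD2l /e -mulr_sumr ler_wpM2l ?sqr_ge0 // -mulr_sumr ler_wpM2l ?ler0n //.
  rewrite exchange_big; apply: ler_sum => k _.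
  by rewrite ler_pdivlMr // mulrC; exact: (coef_le sH basis bnd).
have [nn1|n1n] := leqP n n1.
  apply: le_trans (_ : _ <= E0) _; last by rewrite lerDl sumr_ge0.
  rewrite /E0 (big_ord_widen n1 (fun i => normc (wcoef j i) ^+ 2)) // big_mkcond.
  by apply: ler_sum => i _; case: ifP => // _; exact: sqr_ge0.
rewrite (bigID (fun i : 'I_n => (i < n1)%N)) /=; apply: lerD.
  by rewrite -(big_ord_widen n (fun i => normc (wcoef j i) ^+ 2)) // ltnW.
rewrite big_mkcond; apply: ler_sum => i _; case: ltnP => [_|/w_le //]; exact: e_ge0.
Qed.

Let w_ex : exists w : 'I_d -> V, forall j, H (w j) /\ forall i, coef (w j) i = wcoef j i.
Proof.
have /choice[x xP] : forall j, exists x, H x /\ forall i, coef x i = wcoef j i.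
  move=> j; have [E EP] := wcoef_l2 j.
  by have [x hx xc] := coef_synthesis sH basis bnd cH EP; exists x.
by exists x.
Qed.
Let w := projT1 (cid w_ex).
Let H_w j : H (w j). Proof. by case: (projT2 (cid w_ex) j). Qed.
Let coef_w j i : coef (w j) i = wcoef j i.
Proof. by case: (projT2 (cid w_ex) j). Qed.

Let wz (z : 'rV[C]_d) := \sum_j z 0 j *: w j.
Let H_wz z : H (wz z).
Proof. by apply: (semi_sum sH) => j _; exact: (semiZ sH). Qed.

Let coef_wz z i : coef (wz z) i = \sum_j z 0 j * wcoef j i.
Proof.
rewrite (coef_sum sH basis bnd); last by move=> j _; exact: (semiZ sH).
by apply: eq_bigr => j _; rewrite (coefZ sH basis bnd) // coef_w.
Qed.

Let coef_wz_head z (i : 'I_d) : coef (wz z) i = z 0 i.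
Proof.
rewrite coef_wz (bigD1 i) //= /wcoef ltn_ord eqxx mulr1 big1 ?addr0 // => j ji.
have -> : (nat_of_ord i == j) = false by rewrite eq_sym; exact: negbTE.
by rewrite mulr0.
Qed.

Let coef_wz_tail z i : (d <= i)%N -> coef (wz z) i = (z *m Y i) 0 0.
Proof.
by move=> di; rewrite coef_wz mxE; apply: eq_bigr => j _; rewrite /wcoef ltnNge di.
Qed.

Let wz_lin k z z' : wz (k *: z + z') = k *: wz z + wz z'.
Proof.
rewrite /wz scaler_sumr -big_split; apply: eq_bigr => j _.
by rewrite !mxE scalerDl scalerA.
Qed.

(** The operator maps the span of the corrected head vectors to itself, with
    the matrix [invmx (M d)]: compare coordinates. *)
Let wz_G z : G (wz z) (wz (z *m invmx (M d))).
Proof.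
set z' := z *m _; have eqz : z' *m M d = z by rewrite mulmxKV // M_unit.
clearbody z'; have [u Gu] := inv_surj GP (H_wz z'); have [hu _] := inv_dom GP Gu.
apply: (inv_null GP Gu (H_wz z)).
apply: (coef_null sH basis bnd) => [|i]; first exact: (semiB sH).
rewrite (coefB sH basis bnd) //; apply/eqP; rewrite subr_eq0; apply/eqP.
rewrite (coef_inv i d0d Gu).
under eq_bigr do rewrite coef_wz_head.
case: leqP => di.
  rewrite !coef_wz_tail // -eqz -mulmxA Y_eq // mulmxDr -scalemxAr.
  by rewrite !mxE; congr (_ + _); apply: eq_bigr => j _; rewrite !mxE.
rewrite addr0 (coef_wz_head z (Ordinal di)) -eqz mxE.
by apply: eq_bigr => j _; rewrite mxE.
Qed.

Lemma root_vector_basis_tail : exists phi, riesz_basis H N phi /\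
  forall n, exists (a : C) k (x : nat -> V),
    [/\ x 0%N = phi n, x k = 0 & forall i, G (x i) (a *: x i - x i.+1)].
Proof.
have [Z Zu ZP] := root_vectors_unitmx (invmx (M d)).
pose chi i := wz (row i Z).
have ZE : \matrix_(i, j) coef (chi i) j = Z.
  by apply/matrixP => i j; rewrite mxE coef_wz_head mxE.
have chiu : \matrix_(i, j) coef (chi i) j \in unitmx by rewrite ZE.
exists (change_head b chi); split.
  by apply: (riesz_basis_change_head sH basis bnd) => // i; exact: H_wz.
have wz0 : wz 0 = 0 by rewrite /wz big1 // => j _; rewrite mxE scale0r.
move=> n; have [nd|dn] := ltnP n d.
  have [a [k zk]] := ZP (Ordinal nd).
  pose f (z : 'rV_d) := z *m (a%:M - invmx (M d)).
  exists a, k, (fun l => wz (iter l f (row (Ordinal nd) Z))); split.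
  - by rewrite -[n in RHS]/(nat_of_ord (Ordinal nd)) change_head_lt.
  - by rewrite zk wz0.
  - move=> l; set z := iter l _ _; rewrite -[iter l.+1 _ _]/(f z).
    have -> : a *: wz z - wz (f z) = wz (z *m invmx (M d)).
      have wzZ : wz (a *: z) = a *: wz z.
        by have := wz_lin a z 0; rewrite wz0 !addr0.
      rewrite -wzZ -scaleN1r addrC -wz_lin scaleN1r /f mulmxBr mul_mx_scalar.
      by rewrite opprB subrK.
    exact: wz_G.
exists (lam n), 1%N, (fun l => if l is 0 then b n else 0); split => //.
- by rewrite change_head_ge.
- case=> [|l]; rewrite subr0; last by rewrite scaler0; exact: inv00.
  by apply: eigen; apply: leq_trans dn.
Qed.

End EigenvectorTail.

Let sum_inv_sqr (k n : nat) : (0 < k)%N -> (k <= n)%N ->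
  \sum_(i < n | (k <= i)%N) (i.+1%:R ^+ 2)^-1 <= k%:R^-1 - n%:R^-1 :> R.
Proof.
move=> k0; elim: n => [|n IH]; first by rewrite leqn0 => /eqP ke; move: k0; rewrite ke.
rewrite leq_eqVlt => /orP[/eqP <-|kn].
  by rewrite subrr big1 // => i; rewrite leqNgt ltn_ord.
rewrite big_mkcond big_ord_recr -big_mkcond /= -ltnS kn.
have n0 : (0 < n)%N by apply: leq_trans k0 _.
apply: le_trans (lerD (IH kn) (lexx _)) _.
have n0R : 0 < n%:R :> R by rewrite ltr0n.
rewrite -natr1; move: (n%:R : R) n0R => x x0.
have e : x^-1 - (x + 1)^-1 = (x * (x + 1))^-1.
  by field; apply/andP; split; apply: lt0r_neq0 => //; lra.
have : ((x + 1) ^+ 2)^-1 <= (x * (x + 1))^-1 by rewrite lef_pV2 ?posrE; nra.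
by rewrite -e; move: k%:R^-1 x^-1 (x + 1)^-1 ((x + 1) ^+ 2)^-1 => p q r t; lra.
Qed.

(** An operator with bounded inverse whose eigenvectors are, from some index on,
    square-summably close to a Riesz basis, with distinct eigenvalues tending
    to infinity.  The missing finitely many directions are spanned by root
    vectors, whatever the multiplicities of the remaining eigenvalues. *)
Theorem root_vector_basis (phi psi : nat -> V) (lam : nat -> C) n0 (D : R) :
  riesz_basis H N phi ->
  (forall n, (n0 <= n)%N -> G (psi n) (lam n *: psi n)) ->
  (forall m n, (n0 <= m)%N -> (n0 <= n)%N -> lam m = lam n -> m = n) ->
  (forall M, exists n1, forall n, (n1 <= n)%N -> M <= normc (lam n)) ->
  (forall n, (n0 <= n)%N -> N (psi n - phi n) ^+ 2 <= D / n.+1%:R ^+ 2) ->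
  exists phi', riesz_basis H N phi' /\
  forall n, exists (a : C) k (x : nat -> V),
    [/\ x 0%N = phi' n, x k = 0 & forall i, G (x i) (a *: x i - x i.+1)].
Proof.
move=> basis eig linj loo close; have [c1 [c2 bnd]] := riesz_basis_bounds basis.
have [c10 _ _] := bnd; have [Hphi _ _] := basis.
have [n1 n1P] := loo 1.
have D1 : 0 < 1 + `|D| by rewrite ltr_wpDr.
have e0 : 0 < c1 / 4 / (1 + `|D|) by rewrite !divr_gt0.
have [n2 n2P] := @vanish_inv R _ e0.
pose d0 := (maxn (maxn n0 n1) n2).+1.
have d0n0 n : (d0 <= n)%N -> (n0 <= n)%N.
  by move/ltnW; rewrite !geq_max => /andP[/andP[]].
have d0n1 n : (d0 <= n)%N -> (n1 <= n)%N.
  by move/ltnW; rewrite !geq_max => /andP[/andP[]].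
pose b n := if (n < d0)%N then phi n else psi n.
have Hb n : H (b n).
  by rewrite /b; case: ltnP => // /d0n0/eig/(inv_dom GP)[].
have bb : riesz_basis H N b.
  apply: (riesz_basis_perturb sH basis bnd Hb) => n.
  have term (i : 'I_n) : N (b i - phi i) ^+ 2 <=
      if (d0 <= i)%N then (1 + `|D|) * (i.+1%:R ^+ 2)^-1 else 0.
    rewrite /b; case: ltnP => [_|d0i].
      by rewrite subrr (seminorm0 sH) expr0n.
    apply: le_trans (close _ (d0n0 _ d0i)) _; rewrite ler_wpM2r ?invr_ge0 ?sqr_ge0 //.
    by apply: le_trans (ler_norm _) _; rewrite lerDr.
  apply: le_trans (ler_sum _ (fun i _ => term i)) _.
  rewrite -big_mkcond -mulr_sumr.
  have : \sum_(i < n | (d0 <= i)%N) (i.+1%:R ^+ 2)^-1 <= d0%:R^-1 :> R.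
    have [d0n|nd0] := leqP d0 n.
      apply: le_trans (sum_inv_sqr _ d0n) _ => //.
      by rewrite lerBlDr lerDl invr_ge0.
    rewrite big1 ?invr_ge0 // => i; rewrite leqNgt.
    by rewrite (ltn_trans (ltn_ord i) nd0).
  have : d0%:R^-1 < c1 / 4 / (1 + `|D|) by apply: n2P; rewrite leq_maxr.
  rewrite ltr_pdivlMr // => lt1 le2.
  apply: le_trans (_ : _ <= (1 + `|D|) * d0%:R^-1) _; first by rewrite ler_wpM2l // ltW.
  by rewrite mulrC ltW.
have [k1 [k2 bndb]] := riesz_basis_bounds bb.
apply: (@root_vector_basis_tail b k1 k2 d0 lam bb bndb) => //.
- by move=> n d0n; rewrite /b ltnNge d0n; apply: eig; exact: d0n0.
- by move=> m n /d0n0 m0 /d0n0 n0'; exact: linj.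
- move=> n /d0n1/n1P le1; rewrite -normc_gt0; exact: lt_le_trans le1.
Qed.

End RootVectorBasis.

(** * The complex exponential *)

Section RealBounds.
Context {R : realType}.
Implicit Types x y : R.

Let mvt0 (f df : R -> R) y : 0 <= y -> (forall x, is_derive x 1 f (df x)) ->
  exists2 c, 0 <= c <= y & f y - f 0 = df c * y.
Proof.
move=> y0 fd; have cf : {within `[0, y], continuous f}.
  apply: continuous_subspaceT => x; apply: differentiable_continuous.
  by apply/derivable1_diffP; have [] := fd x.
have [c] := MVT_segment y0 (fun x _ => fd x) cf.
by rewrite in_itv /= subr0; exists c.
Qed.

Lemma sin_abs_le y : `|sin y| <= `|y|.
Proof.
wlog y0 : y / 0 <= y.
  move=> h; have [/h//|/ltW y0] := leP 0 y.
  by rewrite -normrN -sinN -[`|y|]normrN; apply: h; rewrite oppr_ge0.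
have [c _] := mvt0 y0 (@is_derive_sin R); rewrite sin0 subr0 => ->.
by rewrite normrM ler_piMl // cos_max.
Qed.

Lemma cos_abs_le y : `|cos y - 1| <= y ^+ 2.
Proof.
wlog y0 : y / 0 <= y.
  move=> h; have [/h//|/ltW y0] := leP 0 y.
  by rewrite -cosN -sqrrN; apply: h; rewrite oppr_ge0.
have [c /andP[c0 cy]] := mvt0 y0 (@is_derive_cos R); rewrite cos0 => ->.
rewrite normrM normrN expr2 (ger0_norm y0) ler_wpM2r //.
by apply: le_trans (sin_abs_le _) _; rewrite ger0_norm.
Qed.

Lemma sin_sub_le y : `|y| <= 1 -> `|sin y - y| <= y ^+ 2.
Proof.
wlog y0 : y / 0 <= y.
  move=> h y1; have [/h|/ltW y0] := leP 0 y; first exact.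
  have -> : sin y - y = - (sin (- y) - - y) by rewrite sinN; ring.
  by rewrite normrN -sqrrN; apply: h; rewrite ?oppr_ge0 ?normrN.
move=> y1; have [c /andP[c0 cy]] := mvt0 y0 (@is_derive_sin R); rewrite sin0 subr0 => ->.
rewrite -{2}[y]mul1r -mulrBl normrM expr2 (ger0_norm y0) ler_wpM2r //.
apply: le_trans (cos_abs_le _) _.
rewrite ger0_norm // in y1; have c1 := le_trans cy y1; nra.
Qed.

Lemma expR_sub_le x : `|x| <= 1 / 2 -> `|expR x - 1 - x| <= 2 * x ^+ 2.
Proof.
rewrite ler_norml => /andP[x1 x2].
have h0 := expR_ge1Dx x; have h1 := expR_ge1Dx (- x).
have h2 : expR x * expR (- x) = 1 := expRxMexpNx_1 x.
have h3 : expR x * (1 - x) <= 1 by rewrite -[leRHS]h2 ler_pM2l ?expR_gt0.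
rewrite ger0_norm; last by lra.
nra.
Qed.

End RealBounds.

Section ComplexExponential.
Context {R : realType}.
Local Notation C := R[i].
Implicit Types z w : C.

Lemma ReD z w : Re (z + w) = Re z + Re w. Proof. by case: z; case: w. Qed.
Lemma ImD z w : Im (z + w) = Im z + Im w. Proof. by case: z; case: w. Qed.
Lemma ReN z : Re (- z) = - Re z. Proof. by case: z. Qed.
Lemma ImN z : Im (- z) = - Im z. Proof. by case: z. Qed.
Lemma ReM z w : Re (z * w) = Re z * Re w - Im z * Im w.
Proof. by case: z; case: w. Qed.
Lemma ImM z w : Im (z * w) = Re z * Im w + Im z * Re w.
Proof. by case: z => a b; case: w. Qed.

Lemma Re2 z : Re (2 * z) = 2 * Re z.
Proof. by rewrite mulr_natl mulr2n ReD mulr_natl mulr2n. Qed.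
Lemma Im2 z : Im (2 * z) = 2 * Im z.
Proof. by rewrite mulr_natl mulr2n ImD mulr_natl mulr2n. Qed.

Lemma complex_ext z w : Re z = Re w -> Im z = Im w -> z = w.
Proof. by case: z => a b; case: w => c d /= -> ->. Qed.

Lemma cexpD z w : cexp (z + w) = cexp z * cexp w.
Proof.
apply: complex_ext; rewrite ?ReM ?ImM /= ReD ImD expRD ?cosD ?sinD; ring.
Qed.

Lemma cexp0 : cexp (0 : C) = 1.
Proof. by apply: complex_ext => /=; rewrite expR0 ?cos0 ?sin0 mul1r. Qed.

Lemma cexp_neq0 z : cexp z != 0.
Proof.
apply/eqP => e; have := cexpD z (- z); rewrite e mul0r subrr cexp0 => /eqP.
by rewrite oner_eq0.
Qed.

Lemma cexpN z : cexp (- z) = (cexp z)^-1.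
Proof.
apply: (mulfI (cexp_neq0 z)); rewrite -cexpD subrr cexp0 divff //.
exact: cexp_neq0.
Qed.

Lemma normc_cexp z : normc (cexp z) = expR (Re z).
Proof.
apply/eqP; rewrite -(eqrXn2 (_ : 0 < 2)%N) ?normc_ge0 ?expR_ge0 // sqr_normcE /=.
by rewrite !exprMn -mulrDr cos2Dsin2 mulr1.
Qed.

Lemma cexp_sub_le z : normc z <= 1 / 2 -> normc (cexp z - 1 - z) <= 5 * normc z ^+ 2.
Proof.
move=> z1; have zr := le_trans (normc_Re z) z1; have zi := le_trans (normc_Im z) z1.
apply: le_trans (normc_le_ReIm _) _.
rewrite !ReD !ImD !ReN !ImN /= oppr0 addr0 sqr_normcE.
have hx := expR_sub_le zr; have hc := cos_abs_le (Im z).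
have hs : `|sin (Im z) - Im z| <= Im z ^+ 2 by apply: sin_sub_le; lra.
have hs' := sin_abs_le (Im z).
move: (Re z) (Im z) zr zi hx hc hs hs' => x y zr zi hx hc hs hs'.
have ex : expR x <= 2 + 1 / 2.
  by move: hx zr; rewrite !ler_norml => /andP[_ ?] /andP[? ?]; nra.
have e0 := expR_ge0 x.
have ex1 : `|expR x - 1| <= 2 * `|x|.
  have -> : expR x - 1 = (expR x - 1 - x) + x by ring.
  apply: le_trans (ler_normD _ _) _.
  have := normr_ge0 x; rewrite -(real_normK (num_real x)) in hx; nra.
have re : `|expR x * cos y - 1 - x| <= 2 * x ^+ 2 + (2 + 1 / 2) * y ^+ 2.
  have -> : expR x * cos y - 1 - x = (expR x - 1 - x) + expR x * (cos y - 1) by ring.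
  apply: le_trans (ler_normD _ _) _; apply: lerD => //.
  by rewrite normrM (ger0_norm e0); apply: ler_pM.
have im : `|expR x * sin y - y| <= x ^+ 2 + (y ^+ 2 + y ^+ 2 ).
  have -> : expR x * sin y - y = (expR x - 1) * sin y + (sin y - y) by ring.
  apply: le_trans (ler_normD _ _) _; rewrite addrA; apply: lerD => //.
  rewrite normrM -[x ^+ 2](real_normK (num_real x)) -[y ^+ 2](real_normK (num_real y)).
  have := normr_ge0 x; have := normr_ge0 y.
  have : `|expR x - 1| * `|sin y| <= (2 * `|x|) * `|y| by apply: ler_pM.
  have := sqr_ge0 (`|x| - `|y|); nra.
have := sqr_ge0 x; have := sqr_ge0 y; move: re im; lra.
Qed.

Lemma cexp_sub1_le z : normc z <= 1 / 2 -> normc (cexp z - 1) <= 4 * normc z.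
Proof.
move=> z1; have -> : cexp z - 1 = (cexp z - 1 - z) + z by rewrite subrK.
apply: le_trans (normcD_le _ _) _; have := cexp_sub_le z1; have := normc_ge0 z; nra.
Qed.

(** Banach's theorem on the closed disc of radius [delta]. *)
Lemma contraction_fixpoint (Phi : C -> C) (delta : R) : 0 <= delta ->
  (forall z, normc z <= delta -> normc (Phi z) <= delta) ->
  (forall z w, normc z <= delta -> normc w <= delta ->
     normc (Phi z - Phi w) <= normc (z - w) / 2) ->
  exists2 z, normc z <= delta & Phi z = z.
Proof.
move=> d0 stab lip; pose u n := iter n Phi 0.
have u_le n : normc (u n) <= delta.
  by elim: n => [|n IH]; [rewrite (_ : u 0%N = 0) // normc0 | exact: stab].
have geo k n : normc (u (n + k)%N - u n) <= (1 / 2) ^+ n * (2 * delta).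
  elim: n => [|n IH]; first by rewrite expr0 mul1r; apply: le_trans (normcB_le _ _) _;
    have := u_le (0 + k)%N; have := u_le 0%N; lra.
  apply: le_trans (lip _ _ (u_le _) (u_le _)) _.
  by rewrite exprS; move: IH; rewrite -/(u _) -/(u _); move: (_ ^+ n) => q; lra.
have [l ul] : exists l, vanish (fun n => normc (u n - l)).
  apply: complex_cauchy_cvg => e e0.
  have k0 : 0 <= 4 * delta by lra.
  have h2 : (0 : R) <= (1 / 2 : R) < 1 by lra.
  have [n0 n0P] := vanishZ k0 (vanish_expr h2) e0.
  exists n0 => i j n0i n0j.
  have := geo (i - n0)%N n0; have := geo (j - n0)%N n0; rewrite !subnKC //.
  have := n0P n0 (leqnn _); have := normcD_le (u i - u n0) (u n0 - u j).
  by rewrite subrKA (normcB (u n0)); lra.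
have l_le : normc l <= delta.
  rewrite -subr_le0; apply: vanish_cst.
  apply: (@vanish_le _ 0 _ _ _ ul) => n _.
  have := normcB_ge l (l - u n); rewrite subKr normcB; have := u_le n; lra.
exists l => //; apply/eqP; rewrite -subr_eq0 -normc_eq0 eq_le normc_ge0 andbT.
apply: vanish_cst.
have ul1 : vanish (fun n => normc (u n.+1 - l)).
  by move=> e /ul[n0 n0P]; exists n0 => n n0n; apply: n0P; exact: leqW.
apply: (@vanish_le _ 0 _ _ _ (vanishD ul ul1)) => n _.
rewrite -(subrKA (u n.+1)); apply: le_trans (normcD_le _ _) _; rewrite lerD2r.
apply: le_trans (lip _ _ l_le (u_le n)) _; rewrite normcB.
by have := normc_ge0 (u n - l); lra.
Qed.

End ComplexExponential.

(** * Asymptotics of the eigenvalues *)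

Section CharacteristicEquation.
Context {R : realType}.
Local Notation C := R[i].
Variables m a alpha : R.

Definition char_fun (z : C) : C :=
  cexp (2 * z) * (1 + alpha%:C + (a + m)%:C * z) + (1 - alpha%:C) + (a - m)%:C * z.

Hypotheses (hm : 0 < m) (ha : 0 < a) (ham : a != m).

Let ratio : R := (m - a) / (m + a).
Let am_neq0 : (m - a)%:C != 0 :> C.
Proof. by rewrite -normc_eq0 normcR normr_eq0 subr_eq0 eq_sym. Qed.

Let char_fun_shift (nu z : C) : cexp (2 * nu) = ratio%:C -> nu + z != 0 ->
  char_fun (nu + z) = (m - a)%:C * (nu + z) *
    (cexp (2 * z) - 1 +
     ((ratio * (1 + alpha))%:C * cexp (2 * z) + (1 - alpha)%:C) / ((m - a)%:C * (nu + z))).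
Proof.
move=> enu nz; set D := _ * (nu + z); set X := _ + (1 - alpha)%:C.
have -> : D * (cexp (2 * z) - 1 + X / D) = D * (cexp (2 * z) - 1) + X.
  by rewrite mulrDr; congr (_ + _); rewrite mulrC divfK // mulf_neq0.
rewrite {}/D {}/X.
rewrite /char_fun [2 * (nu + z)]mulrDr cexpD enu.
have -> : ratio%:C = (m - a)%:C * ((m + a)%:C)^-1 :> C by rewrite /ratio rmorphM fmorphV.
have -> : (ratio * (1 + alpha))%:C = (m - a)%:C * ((m + a)%:C)^-1 * (1 + alpha%:C) :> C.
  by rewrite /ratio !rmorphM fmorphV; congr (_ * _); rewrite rmorphD rmorph1.
have pa : m%:C + a%:C != 0 :> C.
  by rewrite -rmorphD -normc_eq0 normcR normr_eq0 lt0r_neq0 // addr_gt0.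
rewrite !rmorphB !rmorphD /= rmorph1.
by field.
Qed.

(** Near a solution [nu] of [exp (2 nu) = (m - a) / (m + a)] the equation reads
    [exp (2 z) = 1 + O(1 / nu)], a contraction on a disc of radius [O(1 / nu)]. *)
Lemma char_fun_root_near : exists2 A, 0 < A & exists2 K, 0 < K &
  forall nu : C, K <= normc nu -> cexp (2 * nu) = ratio%:C ->
  exists2 z, normc z <= A / normc nu & char_fun (nu + z) = 0.
Proof.
pose b := `|ratio * (1 + alpha)|; pose g := `|m - a|.
pose B := 3 * b + `|1 - alpha| + 1.
have b0 : 0 <= b by exact: normr_ge0.
have B1 : 0 < B by rewrite /B; have := normr_ge0 (1 - alpha); lra.
have g0 : 0 < g by rewrite normr_gt0 subr_eq0 eq_sym.
pose A := 2 * B / g; pose E := (48 * b + 4 * B) / g.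
have A0 : 0 < A by rewrite divr_gt0 // mulr_gt0.
have E0 : 0 < E by rewrite divr_gt0 //; lra.
exists A => //; exists (1 + 400 * A + 2 * E); first by lra.
move=> nu nuK enu; set n := normc nu in nuK *.
have n1 : 1 <= n by lra.
have n0 : 0 < n by lra.
pose delta := A / n.
have d0 : 0 <= delta by rewrite divr_ge0 // ltW.
have d1 : 400 * delta <= 1 by rewrite /delta mulrA ler_pdivrMr //; lra.
have E1 : E / n <= 1 / 2 by rewrite ler_pdivrMr //; lra.
pose q z : C := cexp (2 * z) - 1 - 2 * z.
pose num z : C := (ratio * (1 + alpha))%:C * cexp (2 * z) + (1 - alpha)%:C.
pose den z : C := (m - a)%:C * (nu + z).
have norm2 z : normc (2 * z : C) = 2 * normc z.
  by rewrite normcM -(rmorph_nat (@real_complex R)) normcR ger0_norm.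
have den_ge z : normc z <= delta -> g * n / 2 <= normc (den z).
  move=> zd; rewrite /den normcM normcR -/g -mulrA ler_pM2l //.
  have := normcB_ge nu (- z); rewrite opprK normcN' -/n; lra.
have den_gt0 z : normc z <= delta -> 0 < normc (den z).
  by move=> /den_ge; apply: lt_le_trans; rewrite divr_gt0 // mulr_gt0.
have nuz z : normc z <= delta -> nu + z != 0.
  by move=> /den_gt0; rewrite normc_gt0 mulf_eq0 negb_or => /andP[].
have exp_le z : normc z <= delta -> normc (cexp (2 * z)) <= 3.
  move=> zd; rewrite -[cexp _](subrK 1); apply: le_trans (normcD_le _ _) _.
  have : normc (2 * z) <= 1 / 2 by rewrite norm2; lra.
  by move=> /cexp_sub1_le; rewrite norm2 normc1; lra.
have num_le z : normc z <= delta -> normc (num z) <= B.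
  move=> zd; apply: le_trans (normcD_le _ _) _; rewrite normcM !normcR -/b.
  by have := exp_le z zd; rewrite /B; nra.
have s_le z : normc z <= delta -> normc (num z / den z) <= delta.
  move=> zd; rewrite normcM normcV ler_pdivrMr ?den_gt0 //.
  apply: le_trans (num_le z zd) _.
  apply: le_trans (_ : _ <= delta * (g * n / 2)) _; last by rewrite ler_wpM2l // den_ge.
  by rewrite /delta /A le_eqVlt; apply/orP; left; apply/eqP; field; lra.
have q_le z : normc z <= delta -> normc (q z) <= 20 * delta ^+ 2.
  move=> zd; have : normc (2 * z) <= 1 / 2 by rewrite norm2; lra.
  by move=> /cexp_sub_le; rewrite norm2 -/(q z); have := normc_ge0 z; nra.
have exp_lip z w : normc z <= delta -> normc w <= delta ->
    normc (cexp (2 * z) - cexp (2 * w)) <= 24 * normc (z - w).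
  move=> zd wd; have -> : 2 * z = 2 * w + 2 * (z - w) by ring.
  rewrite cexpD -[X in _ - X]mulr1 -mulrBr normcM.
  have h : normc (2 * (z - w)) <= 1 / 2 by rewrite norm2; have := normcB_le z w; lra.
  have := cexp_sub1_le h; rewrite norm2; have := exp_le w wd.
  have := normc_ge0 (cexp (2 * w)); have := normc_ge0 (cexp (2 * (z - w)) - 1).
  by have := normc_ge0 (z - w); nra.
have q_lip z w : normc z <= delta -> normc w <= delta ->
    normc (q z - q w) <= 200 * delta * normc (z - w).
  move=> zd wd.
  have -> : q z - q w = cexp (2 * w) * (cexp (2 * (z - w)) - 1 - 2 * (z - w))
                        + (cexp (2 * w) - 1) * (2 * (z - w)).
    rewrite /q; have -> : cexp (2 * z) = cexp (2 * w) * cexp (2 * (z - w)).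
      by rewrite -cexpD; congr cexp; ring.
    by ring.
  apply: le_trans (normcD_le _ _) _.
  rewrite normcM [normc (_ * (2 * _))]normcM norm2.
  have dzw := normcB_le z w.
  have h : normc (2 * (z - w)) <= 1 / 2 by rewrite norm2; lra.
  have hw : normc (2 * w) <= 1 / 2 by rewrite norm2; lra.
  have := cexp_sub_le h; have := cexp_sub1_le hw; rewrite !norm2.
  have := exp_le w wd; have := normc_ge0 (cexp (2 * w)); have := normc_ge0 (z - w).
  have := normc_ge0 (cexp (2 * (z - w)) - 1 - 2 * (z - w)).
  move: dzw zd wd; move: (normc (z - w)) (normc z) (normc w) (normc (cexp (2 * w))).
  move: (normc (_ - _ - _)) (normc (cexp _ - 1)) => t s x y v p xy yd vd t0 x0 p0 p3 s8 tx.
  have h1 : p * t <= 3 * (5 * (2 * x) ^+ 2) by nra.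
  have h2 : s * (2 * x) <= 4 * (2 * delta) * (2 * x) by nra.
  nra.
have s_lip z w : normc z <= delta -> normc w <= delta ->
    normc (num z / den z - num w / den w) <= 1 / 2 * normc (z - w).
  move=> zd wd.
  have dz0 := den_gt0 z zd; have dw0 := den_gt0 w wd.
  have dz1 : den z != 0 by rewrite -normc_gt0.
  have dw1 : den w != 0 by rewrite -normc_gt0.
  have -> : num z / den z - num w / den w =
      (num z - num w) / den z + num w * (den w - den z) / (den z * den w).
    by field; apply/andP.
  have numB : normc (num z - num w) <= b * (24 * normc (z - w)).
    have -> : num z - num w =
        (ratio * (1 + alpha))%:C * (cexp (2 * z) - cexp (2 * w)) by rewrite /num; ring.
    by rewrite normcM normcR ler_wpM2l //; exact: exp_lip.
  have denB : normc (den w - den z) = g * normc (z - w).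
    by rewrite -mulrBr normcM normcR normcB; congr (_ * normc _); ring.
  have gn : 0 < g * n / 2 by rewrite divr_gt0 // mulr_gt0.
  have zw0 := normc_ge0 (z - w).
  apply: le_trans (normcD_le _ _) _.
  apply: le_trans (_ : _ <= E / n * normc (z - w)) _; last by rewrite ler_wpM2r.
  set t := normc (z - w) in zw0 numB denB *.
  have -> : E / n * t = b * (24 * t) / (g * n / 2) + B * (g * t) * n / ((g * n / 2) * (g * n / 2)).
    by rewrite /E; field; rewrite !lt0r_neq0.
  have inv_le z' : normc z' <= delta -> (normc (den z'))^-1 <= (g * n / 2)^-1.
    by move=> z'd; rewrite lef_pV2 ?posrE ?den_gt0 // den_ge.
  apply: lerD.
    rewrite normcM normcV; apply: ler_pM; rewrite ?invr_ge0 ?normc_ge0 //.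
    exact: inv_le.
  rewrite normcM normcV normcM denB normcM.
  apply: ler_pM; rewrite ?invr_ge0 ?mulr_ge0 ?normc_ge0 ?(ltW g0) //.
    rewrite -[leLHS]mulr1; apply: ler_pM; rewrite ?mulr_ge0 ?normc_ge0 ?(ltW g0) //.
    by rewrite ler_wpM2r ?mulr_ge0 ?(ltW g0) // num_le.
  by rewrite !invfM; apply: ler_pM; rewrite ?invr_ge0 ?normc_ge0 // -!invfM inv_le.
pose Phi z : C := - (q z + num z / den z) / 2.
have norm_half z : normc (z / 2 : C) = normc z / 2.
  by rewrite normcM normcV -(rmorph_nat (@real_complex R)) normcR ger0_norm.
have [z zd Phiz] : exists2 z, normc z <= delta & Phi z = z.
  apply: contraction_fixpoint => // [z zd|z w zd wd]; rewrite /Phi.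
    rewrite norm_half normcN'; have := normcD_le (q z) (num z / den z).
    by have := s_le z zd; have := q_le z zd; nra.
  rewrite -mulrBl norm_half ler_pM2r // -normcN'.
  have -> : - (- (q z + num z / den z) - - (q w + num w / den w)) =
    (q z - q w) + (num z / den z - num w / den w) by ring.
  apply: le_trans (normcD_le _ _) _.
  by have := q_lip z w zd wd; have := s_lip z w zd wd; have := normc_ge0 (z - w); nra.
exists z => //; rewrite char_fun_shift ?nuz // -/(num z) -/(den z).
have two0 : 2 != 0 :> C by rewrite pnatr_eq0.
have : q z + num z / den z = - (2 * z).
  have half_opp (x y : C) : - x / 2 = y -> x = - (2 * y) by move=> <-; field.
  exact: half_opp Phiz.
rewrite /q addrAC => /eqP; rewrite -subr_eq0 opprK subrK => /eqP ->.
by rewrite mulr0.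
Qed.
End CharacteristicEquation.

(** * An enumeration of the integers *)

(** [0, 1, -1, 2, -2] and so on, so that consecutive partial sums are symmetric. *)
Definition zenum (n : nat) : int := if odd n then (uphalf n)%:Z else - (uphalf n)%:Z.

Lemma zenum_inj : injective zenum.
Proof. move=> m n; rewrite /zenum; case: ifP; case: ifP; lia. Qed.

Lemma zenum_abs n : `|zenum n|%N = uphalf n.
Proof. by rewrite /zenum; case: ifP; lia. Qed.

Section IntegerMultiplesOfPi.
Context {R : realType}.

Lemma sin_pi_int (k : int) : sin (pi * k%:~R : R) = 0.
Proof.
have sin_pi_nat (n : nat) : sin (pi * n%:R : R) = 0.
  elim: n => [|n IH]; first by rewrite mulr0 sin0.
  by rewrite -natr1 mulrDr mulr1 sinDpi IH oppr0.
case: k => n; first exact: sin_pi_nat.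
by rewrite NegzE mulrNz mulrN sinN sin_pi_nat oppr0.
Qed.

Lemma cos_2pi_int (k : int) : cos (2 * (pi * k%:~R) : R) = 1.
Proof.
by rewrite mulr_natl cos_mulr2n cos2sin2 sin_pi_int expr0n subr0 mulr2n addrK.
Qed.

Lemma sin_2pi_int (k : int) : sin (2 * (pi * k%:~R) : R) = 0.
Proof. by rewrite mulr_natl sin_mulr2n sin_pi_int mulr0 mul0rn. Qed.

Definition zfreq n : R := pi * (zenum n)%:~R.

Lemma zfreq_abs n : `|zfreq n| = pi * (uphalf n)%:R.
Proof.
by rewrite normrM (ger0_norm (pi_ge0 R)) -intr_norm -abszE zenum_abs.
Qed.

Lemma zfreq_sep m n : m != n -> pi <= `|zfreq m - zfreq n|.
Proof.
move=> mn; rewrite /zfreq -mulrBr -intrB normrM (ger0_norm (pi_ge0 R)).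
rewrite ler_peMr ?pi_ge0 // -intr_norm -[1]/(1%:~R) ler_int -gtz0_ge1 normr_gt0 subr_eq0.
by rewrite (inj_eq zenum_inj).
Qed.

End IntegerMultiplesOfPi.

Section EigenvalueSequence.
Context {R : realType}.
Local Notation C := R[i].
Variables m a alpha : R.
Hypotheses (hm : 0 < m) (ha : 0 < a) (ham : a != m).

Let ratio : R := (m - a) / (m + a).

(** A solution of [exp (2 nu0) = (m - a) / (m + a)]; the other ones are its
    translates by integer multiples of [pi i]. *)
Definition nu0 : C := (ln `|ratio| / 2) +i* (if ratio < 0 then pi / 2 else 0).
Definition nu n : C := nu0 + (0 +i* zfreq n).

Let ratio_neq0 : ratio != 0.
Proof. by rewrite mulf_neq0 ?invr_eq0 ?(lt0r_neq0 (addr_gt0 hm ha)) // subr_eq0 eq_sym. Qed.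

Lemma cexp_nu n : cexp (2 * nu n) = ratio%:C.
Proof.
rewrite /nu mulrDr cexpD.
have -> : cexp (2 * (0 +i* zfreq n : C)) = 1.
  rewrite /cexp Re2 Im2 /= mulr0 expR0 !mul1r.
  by apply: complex_ext; [exact: cos_2pi_int | exact: sin_2pi_int].
have half2 (x : R) : 2 * (x / 2) = x by rewrite mulrC divfK.
rewrite mulr1 /cexp Re2 Im2; apply: complex_ext; rewrite /=.
- rewrite half2 lnK ?posrE ?normr_gt0 //.
  case: ifP => [r0|/negbT]; last by rewrite -leNgt => r0; rewrite mulr0 cos0 mulr1 ger0_norm.
  by rewrite half2 cospi mulrN1 ltr0_norm // opprK.
- case: ifP => _; last by rewrite mulr0 sin0 mulr0.
  by rewrite !half2 sinpi mulr0.
Qed.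

Lemma Re_nu n : Re (nu n) = Re nu0. Proof. by rewrite /= addr0. Qed.

Lemma normc_nu_ge n : (n%:R - 1 : R) <= normc (nu n).
Proof.
apply: le_trans (normc_Im _); rewrite /=.
set t := if _ then _ else _.
have t1 : `|t| <= pi / 2.
  by rewrite /t; case: ifP => _; rewrite ?normr0 ?ger0_norm ?divr_ge0 ?pi_ge0.
have le_f : pi * (uphalf n)%:R <= `|t + zfreq n| + `|t|.
  have e : zfreq n = (t + zfreq n) - t by ring.
  by rewrite -zfreq_abs {1}e; exact: ler_normB.
have : n%:R <= 2 * (uphalf n)%:R :> R by rewrite -natrM ler_nat; lia.
have := @pi_ge2 R; have := ler0n R (uphalf n); have := ler0n R n.
move=> n_ge0 u_ge0 pi2 n_le; have q0 := normr_ge0 (t + zfreq n); have [n0E|n_gt0] := posnP n.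
  by apply: le_trans _ q0; rewrite {1}n0E; lra.
have : 1 <= (uphalf n)%:R :> R by rewrite ler1n uphalf_gt0.
by move: t1 le_f q0; move: (`|t|) (`|t + _|) => p q; nra.
Qed.

Lemma nu_sep p q : p != q -> 2 <= normc (nu p - nu q).
Proof.
move=> pq; apply: le_trans (normc_Im _); rewrite /=.
rewrite opprD addrACA subrr add0r.
by apply: le_trans (zfreq_sep pq); exact: pi_ge2.
Qed.

Lemma eigenvalue_sequence : exists n0 (A : R) (lam : nat -> C),
  [/\ forall n, (n0 <= n)%N ->
        char_fun m a alpha (lam n) = 0 /\ normc (lam n - nu n) <= A / n.+2%:R,
      forall p q, (n0 <= p)%N -> (n0 <= q)%N -> lam p = lam q -> p = q,
      forall M, exists n1, forall n, (n1 <= n)%N -> M <= normc (lam n) &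
      forall n, (n0 <= n)%N -> normc (lam n - nu n) <= 1 / 2 ].
Proof.
have [A A0 [K K0 root]] := char_fun_root_near alpha hm ha ham.
have eventually_ge (M : R) : exists n1, forall n, (n1 <= n)%N -> M <= n%:R.
  exists (Num.truncn M).+1 => n le_n.
  by apply: ltW; apply: lt_le_trans (truncnS_gt _) _; rewrite ler_nat.
have [n1 n1P] := eventually_ge (K + 1); have [n2 n2P] := eventually_ge (4 * A).
pose n0 := maxn 4 (maxn n1 n2).
have big n : (n0 <= n)%N -> [/\ 4 <= n%:R :> R, K + 1 <= n%:R & 4 * A <= n%:R].
  by rewrite !geq_max => /and3P[n4 /n1P ? /n2P ?]; split; rewrite // ler_nat.
have /choice[lam lamP] : forall n, exists z : C, (n0 <= n)%N ->
    char_fun m a alpha z = 0 /\ normc (z - nu n) <= 2 * A / n.+2%:R.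
  move=> n; case: (leqP n0 n) => [n0n|]; last by exists 0.
  have [n4 nK nA] := big n n0n; have nn := normc_nu_ge n.
  have [|z zn z0] := root (nu n) _ (cexp_nu n); first by lra.
  exists (nu n + z) => _; split => //; rewrite addrC addKr.
  apply: le_trans zn _; rewrite ler_pdivrMr; last by lra.
  rewrite -[n.+2]/(2 + n)%N natrD mulrAC ler_pdivlMr; last by have := ler0n R n; lra.
  by nra.
have close n : (n0 <= n)%N -> normc (lam n - nu n) <= 1 / 2.
  move=> n0n; have [_] := lamP n n0n; have [n4 nK nA] := big n n0n.
  move=> h; apply: le_trans h _; rewrite -[n.+2]/(2 + n)%N natrD ler_pdivrMr; first by lra.
  by lra.
exists n0, (2 * A), lam; split => //.
- move=> p q np nq lpq; apply/eqP; apply/negP => /negP /nu_sep.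
  have -> : nu p - nu q = (lam q - nu q) - (lam p - nu p) by rewrite lpq; ring.
  by have := normcB_le (lam q - nu q) (lam p - nu p);
     have := close p np; have := close q nq; lra.
- move=> M; have [n3 n3P] := eventually_ge (M + 2).
  exists (maxn n0 n3) => n; rewrite geq_max => /andP[n0n /n3P nM].
  have := normcB_ge (nu n) (nu n - lam n); rewrite subKr normcB.
  by have := close n n0n; have := normc_nu_ge n; rewrite normcB; lra.
Qed.

End EigenvalueSequence.

(** * Real square-integrable functions on the unit interval *)

Section UnitInterval.
Context {R : realType}.
Local Notation mu := (@lebesgue_measure R).
Local Notation I01 := (`]0%R, 1%R[%classic : set R).
Implicit Types (f g h : R -> R) (x : R).

Definition intble f : Prop := mu.-integrable I01 (EFin \o f).
Definition int01 f : R := \int[mu]_(x in I01) f x.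
Definition sqint f : Prop := measurable_fun I01 f /\ intble (fun x => f x ^+ 2).

Lemma measurable_I01 : measurable (I01 : set (measurableTypeR R)). Proof. exact: measurable_itv. Qed.
Local Hint Resolve measurable_I01 : core.

Lemma mu_I01 : mu I01 = 1%E.
Proof. by rewrite lebesgue_measure_itv /= lte_fin ltr01 sube0. Qed.

Lemma ae_imp (P Q : R -> Prop) : (forall x, P x -> Q x) ->
  (\forall x \ae mu, P x) -> \forall x \ae mu, Q x.
Proof.
by move=> PQ; apply: (@filterS _ _ (ae_filter_ringOfSetsType mu)) => x; exact: PQ.
Qed.

Lemma ae_imp2 (P Q S : R -> Prop) : (forall x, P x -> Q x -> S x) ->
  (\forall x \ae mu, P x) -> (\forall x \ae mu, Q x) -> \forall x \ae mu, S x.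
Proof.
by move=> PQ; apply: (@filterS2 _ _ (ae_filter_ringOfSetsType mu)) => x; exact: PQ.
Qed.

Lemma intble_measurable f : intble f -> measurable_fun I01 f.
Proof. by move=> /(measurable_int mu)/measurable_EFinP. Qed.

Lemma intbleD f g : intble f -> intble g -> intble (fun x => f x + g x).
Proof.
move=> hf hg; have := integrableD measurable_I01 hf hg.
by apply: eq_integrable => // x _ /=; rewrite EFinD.
Qed.

Lemma intbleZ (k : R) f : intble f -> intble (fun x => k * f x).
Proof.
move=> hf; have := integrableZl measurable_I01 k hf.
by apply: eq_integrable => // x _ /=; rewrite EFinM.
Qed.

Lemma intbleB f g : intble f -> intble g -> intble (fun x => f x - g x).
Proof.
move=> hf /(intbleZ (-1)) hg; have := intbleD hf hg.
by apply: eq_integrable => // x _ /=; rewrite mulN1r.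
Qed.

Lemma intble_le f g : measurable_fun I01 f -> intble g ->
  (forall x, I01 x -> `|f x| <= g x) -> intble f.
Proof.
move=> mf hg fg; apply: (le_integrable measurable_I01 _ _ hg); first exact/measurable_EFinP.
move=> x Ix /=; rewrite lee_fin; apply: le_trans (fg x Ix) (ler_norm _).
Qed.

Lemma intble_abs f : intble f -> intble (fun x => `|f x|).
Proof. by move=> hf; exact: (integrable_norm hf). Qed.

Lemma intble_cst (k : R) : intble (fun=> k).
Proof.
apply: measurable_bounded_integrable => //; first by rewrite [X in (X < _)%E]mu_I01 ltry.
by exists `|k|; split => // M kM x _; exact: ltW.
Qed.

Lemma intble_ext f g : {in I01, f =1 g} -> intble f -> intble g.
Proof. by move=> fg; apply: eq_integrable => // x xI /=; rewrite fg. Qed.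

Lemma int01_ext f g : {in I01, f =1 g} -> int01 f = int01 g.
Proof. by move=> fg; rewrite /int01; apply: eq_Rintegral => x xI; exact: fg. Qed.

Lemma int01D f g : intble f -> intble g -> int01 (fun x => f x + g x) = int01 f + int01 g.
Proof. exact: RintegralD. Qed.

Lemma int01Z (k : R) f : intble f -> int01 (fun x => k * f x) = k * int01 f.
Proof. exact: RintegralZl. Qed.

Lemma int01B f g : intble f -> intble g -> int01 (fun x => f x - g x) = int01 f - int01 g.
Proof. exact: RintegralB. Qed.

Lemma int01_cst (k : R) : int01 (fun=> k) = k.
Proof. by rewrite /int01 Rintegral_cst // [X in fine X]mu_I01 mulr1. Qed.

Lemma int01_le f g : intble f -> intble g -> (forall x, I01 x -> f x <= g x) ->
  int01 f <= int01 g.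
Proof. by move=> hf hg fg; apply: le_Rintegral. Qed.

Lemma int01_ge0 f : (forall x, I01 x -> 0 <= f x) -> 0 <= int01 f.
Proof. by move=> f0; rewrite /int01; apply: Rintegral_ge0. Qed.

Lemma int01_abs f : intble f -> `|int01 f| <= int01 (fun x => `|f x|).
Proof. by move=> hf; rewrite /int01; apply: le_normr_Rintegral. Qed.

Lemma int01_sum (I : Type) (r : seq I) (F : I -> R -> R) :
  (forall i, intble (F i)) ->
  intble (fun x => \sum_(i <- r) F i x) /\
  int01 (fun x => \sum_(i <- r) F i x) = \sum_(i <- r) int01 (F i).
Proof.
move=> hF; elim: r => [|i r [IH1 IH2]].
  rewrite big_nil; split.
    by apply: (intble_ext _ (intble_cst 0)) => x _; rewrite big_nil.
  by rewrite -[RHS](int01_cst 0); apply: int01_ext => x _; rewrite big_nil.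
split; first by apply: (intble_ext _ (intbleD (hF i) IH1)) => x _; rewrite big_cons.
rewrite big_cons -IH2 -int01D //; apply: int01_ext => x _; by rewrite big_cons.
Qed.

Lemma int01_ae f g : measurable_fun I01 f -> measurable_fun I01 g ->
  f = g %[ae mu in I01] -> int01 f = int01 g.
Proof.
move=> mf mg fg; congr fine; apply: ae_eq_integral => //; try exact/measurable_EFinP.
by apply: ae_imp fg => x fg Ix; rewrite /= fg.
Qed.

Lemma int01_ge0_eq0 f : intble f -> (forall x, I01 x -> 0 <= f x) -> int01 f <= 0 ->
  f = (fun=> 0) %[ae mu in I01].
Proof.
move=> hf f0 le0; have mf := intble_measurable hf.
have fin := integrable_fin_num measurable_I01 hf.
have : (\int[mu]_(x in I01) `|(f x)%:E| = 0)%E.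
  under eq_integral => x /set_mem Ix do rewrite gee0_abs ?lee_fin ?f0 //.
  rewrite -(fineK fin); congr EFin; apply/eqP; rewrite eq_le le0.
  by apply: int01_ge0.
have mf' : measurable_fun I01 (EFin \o f) by exact/measurable_EFinP.
move=> /(ae_eq_integral_abs mu measurable_I01 mf').1.
by apply: ae_imp => x h' Ix; have [] := h' Ix.
Qed.

Lemma sqint_measurable f : sqint f -> measurable_fun I01 f. Proof. by case. Qed.

Lemma sqint_mul f g : sqint f -> sqint g -> intble (fun x => f x * g x).
Proof.
move=> [mf hf] [mg hg]; apply: intble_le (intbleD hf hg) _.
  exact: measurable_funM.
move=> x _; rewrite normrM -[f x ^+ 2]real_normK ?num_real // -[g x ^+ 2]real_normK ?num_real //.
by have := sqr_ge0 (`|f x| - `|g x|); have := sqr_ge0 (`|f x|); have := sqr_ge0 (`|g x|); nra.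
Qed.

Lemma sqint_bounded f (M : R) : measurable_fun I01 f ->
  (forall x, I01 x -> `|f x| <= M) -> sqint f.
Proof.
move=> mf fM; split => //; apply: intble_le (intble_cst (M ^+ 2)) _.
  exact: measurable_funX.
move=> x Ix; have := fM x Ix; rewrite normrX => fx.
by rewrite ler_pXn2r // ?nnegrE // (le_trans _ fx).
Qed.

Lemma sqint_cst (k : R) : sqint (fun=> k).
Proof. by apply: (@sqint_bounded _ `|k|). Qed.

Lemma sqint_intble f : sqint f -> intble f.
Proof.
move=> hf; apply: intble_ext (sqint_mul hf (sqint_cst 1)) => x _; exact: mulr1.
Qed.

Lemma sqintD f g : sqint f -> sqint g -> sqint (fun x => f x + g x).
Proof.
move=> hf hg; split; first by apply: measurable_funD; [case: hf|case: hg].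
have := intbleD (intbleD (proj2 hf) (proj2 hg)) (intbleZ 2 (sqint_mul hf hg)).
by apply: intble_ext => x _; ring.
Qed.

Lemma sqintZ (k : R) f : sqint f -> sqint (fun x => k * f x).
Proof.
move=> hf; split; first by apply: measurable_funM => //; case: hf.
by have := intbleZ (k ^+ 2) (proj2 hf); apply: intble_ext => x _; ring.
Qed.

Lemma sqintB f g : sqint f -> sqint g -> sqint (fun x => f x - g x).
Proof.
move=> hf /(sqintZ (-1)) hg; have [m i] := sqintD hf hg; split.
  by apply: eq_measurable_fun m => x _; rewrite mulN1r.
by apply: intble_ext i => x _; rewrite mulN1r.
Qed.

Lemma sqint_mulb f g (M : R) : sqint f -> measurable_fun I01 g ->
  (forall x, I01 x -> `|g x| <= M) -> sqint (fun x => f x * g x).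
Proof.
move=> [mf hf] mg gM; split; first exact: measurable_funM.
apply: intble_le (intbleZ (M ^+ 2) hf) _.
  by apply: measurable_funX; exact: measurable_funM.
move=> x Ix; rewrite normrX normrM exprMn mulrC -[X in _ <= _ * X]real_normK ?num_real //.
by rewrite ler_wpM2r ?sqr_ge0 // ler_pXn2r ?nnegrE ?gM // (le_trans _ (gM x Ix)).
Qed.

Lemma continuous_I01 f : {within `[0, 1], continuous f} ->
  measurable_fun I01 f /\ exists2 M, 0 <= M & forall x, x \in `[0, 1] -> `|f x| <= M.
Proof.
move=> cf; split.
  have : measurable_fun (`[0, 1]%classic : set R) f.
    by apply: subspace_continuous_measurable_fun => //; exact: measurable_itv.
  apply: measurable_funS; first exact: measurable_itv.
  by move=> x; exact: subset_itv_oo_cc.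
have [M [_ hM]] := compact_bounded (continuous_compact cf (@segment_compact R 0 1)).
exists (`|M| + 1); first by rewrite addr_ge0.
move=> x xI; apply: (hM (`|M| + 1)); first by rewrite (le_lt_trans (ler_norm M)) // ltrDl.
by exists x.
Qed.

Lemma continuous_sqint f : {within `[0, 1], continuous f} -> sqint f.
Proof.
move=> /continuous_I01[mf [M _ fM]]; apply: (sqint_bounded mf) => x Ix.
by apply: fM; exact: subset_itv_oo_cc.
Qed.

Lemma int01_CauchySchwarz1 f : sqint f -> int01 (fun x => `|f x|) ^+ 2 <= int01 (fun x => f x ^+ 2).
Proof.
move=> hf; set s := int01 _; have ha := intble_abs (sqint_intble hf).
have h : int01 (fun x => 2 * s * `|f x|) <= int01 (fun x => f x ^+ 2 + s ^+ 2).
  apply: int01_le; [exact: intbleZ|apply: intbleD; [by case: hf|exact: intble_cst]|].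
  move=> x _; rewrite -[f x ^+ 2]real_normK ?num_real //.
  by have := sqr_ge0 (`|f x| - s); lra.
move: h; rewrite int01Z // int01D ?int01_cst //; [|by case: hf|exact: intble_cst].
rewrite -/s; lra.
Qed.

End UnitInterval.
#[global] Hint Resolve measurable_I01 : core.

Section Completeness.
Context {R : realType}.
Local Notation mu := (@lebesgue_measure R).
Local Notation I01 := (`]0%R, 1%R[%classic : set R).

Lemma int01E (f : R -> R) : intble f ->
  (\int[mu]_(x in I01) (f x)%:E = (int01 f)%:E)%E.
Proof. by move=> hf; rewrite /int01 /Rintegral fineK //; exact: integrable_fin_num. Qed.

Lemma sum_half_le n : \sum_(i < n) (1 / 2 : R) ^+ i <= 2.
Proof.
have -> : \sum_(i < n) (1 / 2 : R) ^+ i = 2 - 2 * (1 / 2) ^+ n.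
  elim: n => [|n IH]; first by rewrite big_ord0 expr0; lra.
  by rewrite big_ord_recr /= IH exprS; move: (_ ^+ n) => q; lra.
have h : 0 <= (1 / 2 : R) ^+ n by exact: exprn_ge0.
lra.
Qed.

(** A sequence whose consecutive differences are summable in the mean converges
    almost everywhere. *)
Lemma ae_cvg_summable (v : nat -> R -> R) : (forall k, sqint (v k)) ->
  (forall k, int01 (fun x => `|v k.+1 x - v k x|) <= (1 / 2) ^+ k) ->
  {ae mu, forall x, I01 x -> cvgn (fun k => v k x)}.
Proof.
move=> hv dv; pose d k x := `|v k.+1 x - v k x|.
have d_int k : intble (d k) by apply/intble_abs/sqint_intble; exact: sqintB.
have d_meas k : measurable_fun I01 (fun x => (d k x)%:E).
  by apply/measurable_EFinP; exact: intble_measurable.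
have d0 k x : I01 x -> (0 <= (d k x)%:E)%E by move=> _; rewrite lee_fin normr_ge0.
pose G x := (\sum_(k <oo) (d k x)%:E)%E.
have G_int : (\int[mu]_(x in I01) G x <= 2%:E)%E.
  rewrite (integral_nneseries mu measurable_I01 d_meas d0).
  apply: lime_le; first by apply: is_cvg_nneseries => k _ _; apply: integral_ge0 => x; exact: d0.
  apply: nearW => n; rewrite big_mkord.
  under eq_bigr do rewrite (int01E (d_int _)).
  rewrite sumEFin lee_fin; apply: le_trans (sum_half_le n).
  by apply: ler_sum => i _; exact: dv.
have G0 x : I01 x -> (0 <= G x)%E by move=> Ix; apply: nneseries_ge0 => k _ _; exact: d0.
have G_meas : measurable_fun I01 G.
  by apply: ge0_emeasurable_sum => // k x Ix _; exact: d0.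
have : mu.-integrable I01 G.
  apply/integrableP; split => //.
  apply: le_lt_trans (ltry 2); apply: le_trans G_int.
  rewrite le_eqVlt; apply/orP; left; apply/eqP; apply: eq_integral => x /set_mem Ix.
  by rewrite gee0_abs // G0.
move=> /(integrable_ae measurable_I01); apply: ae_imp => x fin Ix.
have := fin Ix => /fineK GE.
have d_le n : \sum_(i < n) d i x <= fine (G x).
  rewrite -lee_fin GE -sumEFin -(big_mkord predT (fun i => (d i x)%:E)).
  by apply: nneseries_lim_ge => k _ _; exact: d0.
have cs : cvgn (series (fun k => v k.+1 x - v k x)).
  apply: normed_cvg; apply: nondecreasing_is_cvgn.
    by apply/nondecreasing_seqP => n; rewrite /= !seriesEord /= big_ord_recr /= lerDl.
  by exists (fine (G x)) => _ [n _ <-]; rewrite /= seriesEord; exact: d_le.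
have -> : (fun k => v k x) = (fun k => series (fun k => v k.+1 x - v k x) k + v 0%N x).
  apply/funext => k; rewrite seriesEnat /= telescope_sumr //.
  by rewrite subrK.
by apply: is_cvgD => //; exact: is_cvg_cst.
Qed.

(** Riesz--Fischer: a rapidly converging subsequence has an almost everywhere
    limit, and Fatou's lemma shows that it is the limit in the mean square. *)
Lemma sqint_complete (u : nat -> R -> R) : (forall n, sqint (u n)) ->
  (forall e, 0 < e -> exists n0, forall i j, (n0 <= i)%N -> (n0 <= j)%N ->
     int01 (fun x => (u i x - u j x) ^+ 2) < e) ->
  exists2 f, sqint f & vanish (fun n => int01 (fun x => (u n x - f x) ^+ 2)).
Proof.
move=> hu cu.
have /choice[n_ n_P] : forall k : nat, exists n0, forall i j,
    (n0 <= i)%N -> (n0 <= j)%N -> int01 (fun x => (u i x - u j x) ^+ 2) < ((1 / 2) ^+ k) ^+ 2.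
  by move=> k; apply: cu; rewrite !exprn_gt0.
pose N k := maxn k (\max_(l < k.+1) n_ l).
have N_ge l k : (l <= k)%N -> (n_ l <= N k)%N.
  move=> lk; rewrite /N leq_max; apply/orP; right.
  exact: (leq_bigmax (F := fun l : 'I_k.+1 => n_ l) (Ordinal (lk : (l < k.+1)%N))).
pose v k := u (N k).
have hv k : sqint (v k) by exact: hu.
have dv k : int01 (fun x => `|v k.+1 x - v k x|) <= (1 / 2) ^+ k.
  rewrite -(ler_pXn2r (_ : 0 < 2)%N) ?nnegrE ?exprn_ge0 //; last first.
    by apply: int01_ge0.
  apply: le_trans (int01_CauchySchwarz1 (sqintB (hv _) (hv _))) _.
  by apply/ltW/n_P; apply: N_ge.
have ae_cvg := ae_cvg_summable hv dv.
pose f x := fine (limn_esup (fun k => (v k x)%:E)).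
have f_meas : measurable_fun I01 f.
  apply: measurableT_comp => //; apply: measurable_fun_limn_esup => k.
  by apply/measurable_EFinP; case: (hv k).
have f_lim : {ae mu, forall x, I01 x -> (fun k => v k x) @ \oo --> f x}.
  apply: ae_imp ae_cvg => x + Ix => /(_ Ix) cvx.
  have cE : (fun k => (v k x)%:E) @ \oo --> (limn (fun k => v k x))%:E.
    by apply: cvg_EFin; [exact: nearW | exact: cvx].
  by rewrite /f is_cvg_limn_esupE; [rewrite (cvg_lim _ cE) | apply/cvg_ex; eexists; exact: cE].
have key e n : 0 < e -> (forall j, (n <= j)%N -> int01 (fun x => (u n x - u j x) ^+ 2) <= e) ->
    intble (fun x => (u n x - f x) ^+ 2) /\ int01 (fun x => (u n x - f x) ^+ 2) <= e.
  move=> e0 ne.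
  have meas : measurable_fun I01 (fun x => (u n x - f x) ^+ 2).
    by apply: measurable_funX; apply: measurable_funB => //; case: (hu n).
  have measE : measurable_fun I01 (fun x => ((u n x - f x) ^+ 2)%:E) by exact/measurable_EFinP.
  pose F k x := ((u n x - v k x) ^+ 2)%:E.
  have F_int k : intble (fun x => (u n x - v k x) ^+ 2).
    by have [] := sqintB (hu n) (hv k).
  have F_meas k : measurable_fun I01 (F k).
    by apply/measurable_EFinP; exact: intble_measurable.
  have F0 k x : I01 x -> (0 <= F k x)%E by move=> _; rewrite lee_fin sqr_ge0.
  have le_e : (\int[mu]_(x in I01) ((u n x - f x) ^+ 2)%:E <= e%:E)%E.
    have -> : (\int[mu]_(x in I01) ((u n x - f x) ^+ 2)%:E =
        \int[mu]_(x in I01) limn_einf (F^~ x))%E.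
      apply: ae_eq_integral => //.
        have -> : (fun x => limn_einf (F^~ x)) = (fun x => (- limn_esup (fun k => - F k x))%E) by [].
        apply: measurableT_comp; first exact: oppe_measurable.
        apply: measurable_fun_limn_esup => k.
        by apply: measurableT_comp; [exact: oppe_measurable | exact: F_meas].
      apply: ae_imp f_lim => x + Ix => /(_ Ix) vx.
      have cF : F^~ x @ \oo --> ((u n x - f x) ^+ 2)%:E.
        apply: cvg_EFin; first exact: nearW.
        have c1 : (fun k => u n x - v k x) @ \oo --> u n x - f x.
          by apply: cvgB => //; exact: cvg_cst.
        rewrite expr2; apply: cvg_trans (cvgM c1 c1).
        by apply: near_eq_cvg; apply: nearW => k /=; rewrite /F /= expr2.
      by rewrite is_cvg_limn_einfE ?(cvg_lim _ cF) //; apply/cvg_ex; eexists; exact: cF.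
    apply: le_trans (fatou mu measurable_I01 F_meas F0) _.
    rewrite limn_einf_lim; apply: lime_le; first exact: is_cvg_einfs.
    apply: nearW => k.
    apply: (@le_trans _ _ (\int[mu]_(x in I01) F (maxn k n) x)%E).
      apply: ereal_inf_lbound; exists (maxn k n) => //=.
      exact: leq_maxl.
    rewrite (int01E (F_int _)) lee_fin; apply: ne.
    by rewrite /N !leq_max leqnn !orbT.
  have fint : intble (fun x => (u n x - f x) ^+ 2).
    apply/integrableP; split => //.
    apply: le_lt_trans (ltry e); apply: le_trans le_e.
    rewrite le_eqVlt; apply/orP; left; apply/eqP; apply: eq_integral => x _ /=.
    by rewrite ger0_norm // sqr_ge0.
  by split => //; rewrite -lee_fin -int01E.
have f_sq : sqint f.
  have [n0 n0P] := cu 1 ltr01.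
  have [int_n _] := key 1 n0 ltr01 (fun j le_j => ltW (n0P n0 j (leqnn _) le_j)).
  have hd : sqint (fun x => u n0 x - f x).
    by split => //; apply: measurable_funB => //; case: (hu n0).
  have [m i] := sqintB (hu n0) hd; split => //.
  by apply: intble_ext i => x _; rewrite subKr.
exists f => // e e0; have e2 : 0 < e / 2 by rewrite divr_gt0.
have [n0 n0P] := cu _ e2; exists n0 => n n0n.
have [_ le_e] := key _ n e2 (fun j le_j => ltW (n0P n j n0n (leq_trans n0n le_j))).
by apply: le_lt_trans le_e _; lra.
Qed.

End Completeness.

Section Primitives.
Context {R : realType}.
Local Notation mu := (@lebesgue_measure R).
Local Notation I01 := (`]0%R, 1%R[%classic : set R).
Local Notation J01 := (`[0%R, 1%R]%classic : set R).
Implicit Types (f g h : R -> R) (x : R).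

Lemma measurable_J01 (f : R -> R) : measurable_fun I01 f -> measurable_fun J01 f.
Proof. by move=> mf; apply/measurable_fun_itv_bndo_bndcP/measurable_fun_itv_obnd_cbndP. Qed.

Lemma intble_J01 h : intble h -> mu.-integrable J01 (EFin \o h).
Proof.
move=> hh; have /integrableP[mE fin] := hh.
apply/integrableP; split.
  by apply/measurable_EFinP; apply: measurable_J01; exact: intble_measurable.
have := @integral_itv_bndoo R 0 1 (fun x => `|(h x)%:E|)%E true false.
rewrite /= => -> //; apply/measurable_EFinP; apply: measurableT_comp => //.
exact: intble_measurable.
Qed.

Lemma int01_J01 h : intble h -> int01 h = \int[mu]_(x in J01) h x.
Proof.
move=> hh; rewrite /int01 /Rintegral; congr fine; symmetry.
apply: (@integral_itv_bndoo R 0 1 (EFin \o h) true false).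
by have /integrableP[] := hh.
Qed.

Definition prim h x : R := \int[mu]_(t in `[0, x]) h t.

Lemma intble_cut h x : intble h -> intble (fun t => h t * (t <= x)%R%:R).
Proof.
move=> hh; have mh := intble_measurable hh.
apply: intble_le (intble_abs hh) _.
  apply: measurable_funM => //.
  have -> : (fun t : R => (t <= x)%R%:R) = \1_(`]-oo, x]%classic) :> (R -> R).
    by apply/funext => t; rewrite indicE mem_setE in_itv.
  exact: (measurable_indic (measurable_itv _)).
by move=> t _; rewrite normrM; case: (t <= x); rewrite ?normr1 ?mulr1 // normr0 mulr0.
Qed.

Lemma primE h x : intble h -> 0 <= x <= 1 -> prim h x = int01 (fun t => h t * (t <= x)%R%:R).
Proof.
move=> hh /andP[x0 x1]; rewrite int01_J01; last exact: intble_cut.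
rewrite /prim.
have -> : (`[0, x]%classic : set R) = J01 `&` `]-oo, x]%classic.
  apply/seteqP; split => t /=; rewrite !in_itv /=.
    by move=> /andP[-> tx]; rewrite tx (le_trans tx x1).
  by move=> [/andP[-> _] ->].
rewrite Rintegral_mkcondr; apply: eq_Rintegral => t _.
by rewrite patchE mem_setE in_itv /=; case: (t <= x); rewrite ?mulr1 ?mulr0.
Qed.

Lemma prim0 h : prim h 0 = 0.
Proof. by rewrite /prim set_itv1 Rintegral_set1. Qed.

Lemma prim1 h : intble h -> prim h 1 = int01 h.
Proof. by move=> hh; rewrite int01_J01. Qed.

Lemma primD f g x : intble f -> intble g -> 0 <= x <= 1 ->
  prim (fun t => f t + g t) x = prim f x + prim g x.
Proof.
move=> hf hg x01; rewrite !primE //; last exact: intbleD.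
by rewrite -int01D; [apply: int01_ext => t _; rewrite mulrDl|exact: intble_cut..].
Qed.

Lemma primZ k f x : intble f -> 0 <= x <= 1 -> prim (fun t => k * f t) x = k * prim f x.
Proof.
move=> hf x01; rewrite !primE //; last exact: intbleZ.
by rewrite -int01Z; [apply: int01_ext => t _; rewrite mulrA|exact: intble_cut].
Qed.

Lemma primB f g x : intble f -> intble g -> 0 <= x <= 1 ->
  prim (fun t => f t - g t) x = prim f x - prim g x.
Proof.
move=> hf hg x01; rewrite !primE //; last exact: intbleB.
by rewrite -int01B; [apply: int01_ext => t _; rewrite mulrBl|exact: intble_cut..].
Qed.

Lemma prim_abs_le h x : intble h -> 0 <= x <= 1 -> `|prim h x| <= int01 (fun t => `|h t|).
Proof.
move=> hh x01; rewrite primE //; apply: le_trans (int01_abs (intble_cut x hh)) _.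
apply: int01_le; [exact/intble_abs/intble_cut|exact: intble_abs|] => t _.
by rewrite normrM; case: (t <= x); rewrite ?normr1 ?mulr1 // normr0 mulr0.
Qed.

Lemma prim_sqr_le h x : sqint h -> 0 <= x <= 1 -> prim h x ^+ 2 <= int01 (fun t => h t ^+ 2).
Proof.
move=> hh x01; apply: le_trans (int01_CauchySchwarz1 hh).
rewrite -real_normK ?num_real // ler_pXn2r ?nnegrE //.
  by apply: prim_abs_le => //; exact: sqint_intble.
by apply: int01_ge0.
Qed.

Lemma prim_ae f g x : intble f -> intble g -> f = g %[ae mu in I01] -> 0 <= x <= 1 ->
  prim f x = prim g x.
Proof.
move=> hf hg fg x01; rewrite !primE //; apply: int01_ae.
- by apply: intble_measurable; exact: intble_cut.
- by apply: intble_measurable; exact: intble_cut.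
- by apply: ae_imp fg => t fg It; rewrite fg.
Qed.

Lemma prim_continuous h : intble h -> {within `[0, 1], continuous (prim h)}.
Proof. by move=> hh; apply: parameterized_integral_continuous => //; exact: intble_J01. Qed.

Lemma prim_derive h x : intble h -> 0 < x < 1 -> {for x, continuous h} ->
  is_derive x 1 (prim h) (h x).
Proof.
move=> hh /andP[x0 x1] ch.
have [d dE] := continuous_FTC1_closed x1 (intble_J01 hh) x0 ch.
have e : 'D_1 (prim h) x = h x by rewrite -derive1E.
exact: DeriveDef d e.
Qed.

(** By Lebesgue differentiation: almost every point is a limit of averages of [h]. *)
Lemma prim_eq0 h : intble h -> (forall x, 0 <= x <= 1 -> prim h x = 0) ->
  h = (fun=> 0) %[ae mu in I01].
Proof.
move=> hh p0; pose f := h \_ I01.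
have fT : mu.-integrable setT (EFin \o f).
  have := (integrable_mkcond (mu := mu) (EFin \o h) measurable_I01).1 hh.
  by rewrite restrict_EFin.
have fI y : mu.-integrable [set` Interval (BLeft 0) (BRight y)] (EFin \o f).
  by apply: integrableS fT => //; exact: measurable_itv.
have := FTC1 fI (integrable_locally measurable_I01 hh).
apply: ae_imp => x + Ix; move: (Ix); rewrite /= in_itv /= => /andP[x0 x1].
have lt0x : (0%:E < x%:E)%E by rewrite lte_fin.
move=> /(_ lt0x)[_].
have -> : f x = h x by rewrite /f patchE mem_set.
move=> <-; rewrite derive1E.
have z : \forall y \near x, \int[mu]_(t in `[0, y]) f t = (cst 0 : R -> R) y.
  have : \forall y \near x, y \in `]0, 1[.
    by apply: near_in_itvoo; rewrite in_itv /= x0.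
  apply: filterS => y; rewrite in_itv /= => /andP[y0 y1].
  rewrite -[RHS](p0 y); last by rewrite !ltW.
  transitivity (\int[mu]_(t in `]0, y]) f t).
    rewrite Rintegral_itv_obnd_cbnd //; apply: integrableS fT => //; exact: measurable_itv.
  transitivity (\int[mu]_(t in `]0, y]) h t).
    apply: eq_Rintegral => t; rewrite mem_setE in_itv /= => /andP[t0 ty].
    by rewrite /f patchE mem_set //= in_itv /= t0 (le_lt_trans ty).
  rewrite /prim Rintegral_itv_obnd_cbnd //.
  apply: integrableS (intble_J01 hh); [exact: measurable_itv|exact: measurable_itv|].
  by move=> t /=; rewrite !in_itv /= => /andP[t0 ty]; rewrite (ltW t0) (le_trans ty (ltW y1)).
by rewrite (near_eq_derive _ z) derive_cst.
Qed.

End Primitives.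

(** * Weak derivatives *)

Section RealWeakDerivative.
Context {R : realType}.
Local Notation mu := (@lebesgue_measure R).
Local Notation I01 := (`]0%R, 1%R[%classic : set R).
Implicit Types (f g h phi : R -> R) (x : R).

Definition rweak f h : Prop :=
  forall phi, test_fun phi ->
    int01 (fun x => f x * derive1 phi x) = - int01 (fun x => h x * phi x).

Lemma test_fun_out phi x : test_fun phi -> x \notin `]0, 1[ -> phi x = 0.
Proof.
move=> [_ _ supp] xI; apply/eqP; apply/negPn/negP => px.
by move/negP: xI; apply; apply: supp; exact: subset_closure.
Qed.

Lemma test_fun_continuous phi : test_fun phi -> continuous phi.
Proof.
move=> [d _ _] x; apply: differentiable_continuous; exact/derivable1_diffP.
Qed.

Lemma test_fun_sqint phi : test_fun phi -> sqint phi /\ sqint (derive1 phi).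
Proof.
move=> tphi; split; apply/continuous_sqint/continuous_subspaceT.
  exact: test_fun_continuous.
by case: tphi.
Qed.

Lemma test_fun_bounded phi : test_fun phi -> exists2 M, 0 <= M &
  forall x, x \in `[0, 1] -> `|phi x| <= M /\ `|derive1 phi x| <= M.
Proof.
move=> tphi; have cphi := test_fun_continuous tphi; have [_ cd _] := tphi.
have [_ [M M0 phiM]] := continuous_I01 (continuous_subspaceT cphi).
have [_ [M' M0' phiM']] := continuous_I01 (continuous_subspaceT cd).
exists (M + M') => [|x xI]; first exact: addr_ge0.
by split; [apply: le_trans (phiM x xI) _|apply: le_trans (phiM' x xI) _]; rewrite ?lerDl ?lerDr.
Qed.

Lemma intble_test f phi : intble f -> test_fun phi ->
  intble (fun x => f x * phi x) /\ intble (fun x => f x * derive1 phi x).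
Proof.
move=> hf tphi; have [M M0 phiM] := test_fun_bounded tphi.
have [[mphi _] [mdphi _]] := test_fun_sqint tphi.
have mf := intble_measurable hf.
split; apply: intble_le (intbleZ M (intble_abs hf)) _; try exact: measurable_funM.
  move=> x Ix; rewrite normrM mulrC ler_wpM2r //.
  by have [] := phiM x (subset_itv_oo_cc Ix).
move=> x Ix; rewrite normrM mulrC ler_wpM2r //.
by have [] := phiM x (subset_itv_oo_cc Ix).
Qed.

Let parts_continuous g phi : continuous g -> test_fun phi ->
  int01 (fun x => prim g x * derive1 phi x) = - int01 (fun x => g x * phi x).
Proof.
move=> cg tphi; have cphi := test_fun_continuous tphi.
have [dphi cdphi _] := tphi.
have hg : intble g by apply/sqint_intble/continuous_sqint/continuous_subspaceT.
have cP := prim_continuous hg.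
have [_ P0 P1] := (continuous_within_itvP _ (@ltr01 R)).1 cP.
have F_d : derivable_oo_LRcontinuous (prim g) 0 1.
  split => // x; rewrite in_itv /= => x01.
  by have [] := prim_derive hg x01 (cg x).
have G_d : derivable_oo_LRcontinuous phi 0 1.
  split => [x _||]; first exact: dphi.
    by apply: cvg_at_right_filter; exact: cphi.
  by apply: cvg_at_left_filter; exact: cphi.
have F_e : {in `]0, 1[, derive1 (prim g) =1 g}.
  move=> x; rewrite in_itv /= => x01; rewrite derive1E.
  by have [] := prim_derive hg x01 (cg x).
have := Rintegration_by_parts ltr01 (continuous_subspaceT cg) F_d F_e
  (continuous_subspaceT cdphi) G_d (fun x _ => erefl _).
have phi0 : phi 0 = 0 by apply: (test_fun_out tphi); rewrite in_itv /= ltxx ?andbF.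
have phi1 : phi 1 = 0 by apply: (test_fun_out tphi); rewrite in_itv /= ltxx ?andbF.
rewrite phi0 phi1 !mulr0 subrr sub0r => e.
have [i1 i2] := intble_test hg tphi.
have i3 : intble (fun x => prim g x * derive1 phi x).
  by apply: sqint_mul; [exact: continuous_sqint|case: (test_fun_sqint tphi)].
by rewrite (int01_J01 i3) (int01_J01 i1).
Qed.

(** For continuous [h] this is integration by parts; continuous functions are
    dense in the mean, and both sides depend continuously on [h]. *)
Lemma prim_rweak h : intble h -> rweak (prim h) h.
Proof.
move=> hh phi tphi; have [M M0 phiM] := test_fun_bounded tphi.
have [g_ [cg _ gh]] := approximation_continuous_integrable measurable_I01
  (eq_ind_r (fun z => (z < +oo)%E) (ltry 1) mu_I01) hh.
have hg n : intble (g_ n) by apply/sqint_intble/continuous_sqint/continuous_subspaceT.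
have hd n : intble (fun x => h x - g_ n x) by exact: intbleB.
have cvg0 : vanish (fun n => int01 (fun x => `|h x - g_ n x|)).
  move=> e e0; have := gh => /fine_cvgP[_ /cvgrPdist_lt/(_ e e0)[n0 _ n0P]].
  exists n0 => n /n0P /=; rewrite sub0r normrN; apply: le_lt_trans.
  exact: ler_norm.
have x01 x : I01 x -> 0 <= x <= 1.
  by rewrite /= in_itv /= => /andP[x0 x1]; rewrite !ltW.
suff : `|int01 (fun x => prim h x * derive1 phi x) + int01 (fun x => h x * phi x)| <= 0.
  by rewrite normr_le0 addr_eq0 => /eqP.
apply: vanish_cst.
have M2 : 0 <= 2 * M by rewrite mulr_ge0.
apply: (@vanish_le _ 0 _ _ _ (vanishZ M2 cvg0)) => n _.
have [t1 t2] := intble_test hh tphi; have [t3 t4] := intble_test (hg n) tphi.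
have [t5 t6] := intble_test (hd n) tphi.
have [_ s2] := test_fun_sqint tphi.
have p1 : intble (fun x => prim h x * derive1 phi x).
  by apply: sqint_mul => //; apply/continuous_sqint/prim_continuous.
have p2 : intble (fun x => prim (g_ n) x * derive1 phi x).
  by apply: sqint_mul => //; apply/continuous_sqint/prim_continuous.
have p3 : intble (fun x => prim (fun t => h t - g_ n t) x * derive1 phi x).
  by apply: sqint_mul => //; apply/continuous_sqint/prim_continuous.
have -> : int01 (fun x => prim h x * derive1 phi x) + int01 (fun x => h x * phi x) =
    int01 (fun x => prim (fun t => h t - g_ n t) x * derive1 phi x) +
    int01 (fun x => (h x - g_ n x) * phi x).
  have -> : int01 (fun x => prim (fun t => h t - g_ n t) x * derive1 phi x) =
      int01 (fun x => prim h x * derive1 phi x) - int01 (fun x => prim (g_ n) x * derive1 phi x).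
    rewrite -int01B //; apply: int01_ext => x /set_mem/x01 x01'.
    by rewrite primB // mulrBl.
  have -> : int01 (fun x => (h x - g_ n x) * phi x) =
      int01 (fun x => h x * phi x) - int01 (fun x => g_ n x * phi x).
    by rewrite -int01B //; apply: int01_ext => x _; rewrite mulrBl.
  by rewrite (parts_continuous (cg n) tphi); ring.
set I := int01 (fun x => `|h x - g_ n x|).
apply: le_trans (ler_normD _ _) _; rewrite mulr2n mulrDl !mul1r mulrDl; apply: lerD.
  apply: le_trans (int01_abs p3) _; rewrite -[leRHS]int01_cst.
  apply: int01_le; [exact: intble_abs|exact: intble_cst|] => x Ix.
  rewrite normrM mulrC; apply: ler_pM => //; last by apply: prim_abs_le => //; exact: x01.
  by have [] := phiM x (subset_itv_oo_cc Ix).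
apply: le_trans (int01_abs t5) _; rewrite /I -int01Z; last exact: intble_abs.
apply: int01_le; [exact: intble_abs|by apply: intbleZ; exact: intble_abs|] => x Ix.
rewrite normrM mulrC ler_wpM2r //.
by have [] := phiM x (subset_itv_oo_cc Ix).
Qed.

End RealWeakDerivative.

Section DuBoisReymond.
Context {R : realType}.
Local Notation mu := (@lebesgue_measure R).
Local Notation I01 := (`]0%R, 1%R[%classic : set R).
Implicit Types (c t x y e : R).

Definition pos_part t : R := (t + `|t|) / 2.

Let pos_part_cont c : continuous (fun t => pos_part (t - c)).
Proof.
have cs t : (fun s => s - c) @ t --> t - c by apply: cvgB; [exact: cvg_id|exact: cvg_cst].
move=> t; apply: cvgM; last exact: cvg_cst.
by apply: cvgD; [exact: cs|apply: cvg_norm; exact: cs].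
Qed.

Let pos_part_sqr_derive c t :
  is_derive t 1 (fun s => pos_part (s - c) ^+ 2) (2 * pos_part (t - c)).
Proof.
have key s h : `|pos_part (s + h) ^+ 2 - pos_part s ^+ 2 - 2 * pos_part s * h| <= h ^+ 2.
  rewrite /pos_part ler_norml.
  by case: (ger0P (s + h)) => h1; case: (ger0P s) => h2; apply/andP; split; nra.
have lim : (fun h => h^-1 *: (((fun s => pos_part (s - c) ^+ 2) \o shift t) (h *: 1)
    - pos_part (t - c) ^+ 2)) @ 0^' --> 2 * pos_part (t - c).
  apply/cvgrPdist_le => e e0; near=> h.
  have h0 : h != 0 by near: h; exact: nbhs_dnbhs_neq.
  have he : `|h| <= e by near: h; exact: dnbhs0_le.
  rewrite /= [h *: 1]mulr1 [h^-1 *: _]/(h^-1 * _).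
  have -> : h + t - c = (t - c) + h by ring.
  have -> : 2 * pos_part (t - c) - h^-1 * (pos_part (t - c + h) ^+ 2 - pos_part (t - c) ^+ 2) =
     - (h^-1 * (pos_part (t - c + h) ^+ 2 - pos_part (t - c) ^+ 2 - 2 * pos_part (t - c) * h)).
    by field.
  rewrite normrN normrM normfV; apply: le_trans he.
  rewrite ler_pdivrMl ?normr_gt0 // -expr2 real_normK ?num_real //; exact: key.
apply: DeriveDef; last by rewrite /derive; apply: cvg_lim.
by rewrite /derivable; apply/cvg_ex; exists (2 * pos_part (t - c)).
Unshelve. all: by end_near.
Qed.

(** A continuously differentiable step from [0] to [2 e ^ 2], increasing on
    [x, x + 2 e] only. *)
Definition step x e t : R :=
  pos_part (t - x) ^+ 2 - 2 * pos_part (t - (x + e)) ^+ 2 + pos_part (t - (x + 2 * e)) ^+ 2.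

Definition dstep x e t : R :=
  2 * pos_part (t - x) - 2 * (2 * pos_part (t - (x + e))) + 2 * pos_part (t - (x + 2 * e)).

Let step_derive x e t : is_derive t 1 (step x e) (dstep x e t).
Proof.
have h1 := pos_part_sqr_derive x t; have h2 := pos_part_sqr_derive (x + e) t.
have h3 := pos_part_sqr_derive (x + 2 * e) t.
have h2' := is_deriveZ 2 h2.
exact: (is_deriveD (is_deriveB h1 h2') h3).
Qed.

Let dstep_cont x e : continuous (dstep x e).
Proof.
move=> t; apply: cvgD; last by apply: cvgM; [exact: cvg_cst|exact: pos_part_cont].
apply: cvgB; first by apply: cvgM; [exact: cvg_cst|exact: pos_part_cont].
by apply: cvgM; [exact: cvg_cst|apply: cvgM; [exact: cvg_cst|exact: pos_part_cont]].
Qed.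

Let dstep_ge0 x e t : 0 <= e -> 0 <= dstep x e t.
Proof.
move=> e0; rewrite /dstep /pos_part.
by case: (ger0P (t - x)); case: (ger0P (t - (x + e))); case: (ger0P (t - (x + 2 * e))); lra.
Qed.

Let dstep_out x e t : 0 <= e -> ~~ (x <= t <= x + 2 * e) -> dstep x e t = 0.
Proof.
move=> e0; rewrite negb_and -!ltNge /dstep /pos_part.
by case: (ger0P (t - x)); case: (ger0P (t - (x + e))); case: (ger0P (t - (x + 2 * e)));
  move=> h1 h2 h3 /orP[h4|h4]; lra.
Qed.

Let step_left x e t : 0 <= e -> t <= x -> step x e t = 0.
Proof.
move=> e0 tx; rewrite /step /pos_part.
have -> : `|t - x| = - (t - x) by rewrite ler0_norm //; lra.
have -> : `|t - (x + e)| = - (t - (x + e)) by rewrite ler0_norm //; lra.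
have -> : `|t - (x + 2 * e)| = - (t - (x + 2 * e)) by rewrite ler0_norm //; lra.
by ring.
Qed.

Let step_right x e t : 0 <= e -> x + 2 * e <= t -> step x e t = 2 * e ^+ 2.
Proof.
move=> e0 tx; rewrite /step /pos_part.
have -> : `|t - x| = t - x by rewrite ger0_norm //; lra.
have -> : `|t - (x + e)| = t - (x + e) by rewrite ger0_norm //; lra.
have -> : `|t - (x + 2 * e)| = t - (x + 2 * e) by rewrite ger0_norm //; lra.
by field.
Qed.

Let dstep_int x e : 0 < x -> 0 <= e -> x + 2 * e < 1 -> int01 (dstep x e) = 2 * e ^+ 2.
Proof.
move=> x0 e0 xe.
have hi : intble (dstep x e) by apply/sqint_intble/continuous_sqint/continuous_subspaceT.
have sc : continuous (step x e).
  move=> t; apply: differentiable_continuous; apply/derivable1_diffP.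
  by have [] := step_derive x e t.
have sd : derivable_oo_LRcontinuous (step x e) 0 1.
  split => [t _||]; first by have [] := step_derive x e t.
    by apply: cvg_at_right_filter; exact: sc.
  by apply: cvg_at_left_filter; exact: sc.
rewrite int01_J01 // /Rintegral (continuous_FTC2 ltr01 _ sd).
- by rewrite (step_left e0 (ltW x0)) (step_right e0 (ltW xe)) /= subr0.
- exact: continuous_subspaceT.
- by move=> t _; rewrite derive1E; have [] := step_derive x e t.
Qed.

Lemma test_fun_step x y e : 0 < x -> 0 < y -> 0 <= e -> x + 2 * e < 1 -> y + 2 * e < 1 ->
  test_fun (fun t => step x e t - step y e t) /\
  derive1 (fun t => step x e t - step y e t) = (fun t => dstep x e t - dstep y e t).
Proof.
move=> x0 y0 e0 xe ye.
have dE t : is_derive t 1 (fun t => step x e t - step y e t) (dstep x e t - dstep y e t).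
  exact: (is_deriveB (step_derive x e t) (step_derive y e t)).
have dfun : derive1 (fun t => step x e t - step y e t) = (fun t => dstep x e t - dstep y e t).
  by apply/funext => t; rewrite derive1E; have [] := dE t.
split => //; split.
- by move=> t; have [] := dE t.
- by rewrite dfun => t; apply: cvgB; exact: dstep_cont.
- pose lo := Num.min x y; pose hi := Num.max (x + 2 * e) (y + 2 * e).
  have sub : [set t | step x e t - step y e t != 0] `<=` `[lo, hi]%classic.
    move=> t /=; apply: contraNT; rewrite in_itv /= negb_and -!ltNge.
    rewrite lt_min gt_max => /orP[/andP[tx ty]|/andP[tx ty]].
      by rewrite !step_left ?subrr ?eqxx // ltW.
    by rewrite !step_right ?subrr ?eqxx // ltW.
  apply: subset_trans (closure_subset sub) _.
  rewrite -(closure_id _).1; last exact: interval_closed.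
  move=> t /=; rewrite !in_itv /= => /andP[t1 t2].
  rewrite (lt_le_trans _ t1) ?lt_min ?x0 //=.
  by rewrite (le_lt_trans t2) // gt_max xe.
Qed.

(** Tested against the difference of two equal steps, [q] has the same weighted
    averages on any two windows; the windows shrink to two points. *)
Lemma du_Bois_Reymond (q : R -> R) : {within `[0, 1], continuous q} ->
  (forall phi, test_fun phi -> int01 (fun x => q x * derive1 phi x) = 0) ->
  forall x, 0 <= x <= 1 -> q x = q 0.
Proof.
move=> cq q0; have [cin c0 c1] := (continuous_within_itvP _ (@ltr01 R)).1 cq.
have hq := continuous_sqint cq.
have le_q x y : 0 < x < 1 -> 0 < y < 1 -> q x <= q y.
  move=> /andP[x0 x1] /andP[y0 y1]; rewrite leNgt; apply/negP => lt_q.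
  pose b1 := (2 * q x + q y) / 3; pose b2 := (q x + 2 * q y) / 3.
  have : \forall t \near x, b1 <= q t.
    have b1x : b1 < q x by rewrite /b1; lra.
    have cx : q @ x --> q x by apply: cin; rewrite in_itv /= x0.
    by move/cvgr_ge: cx => /(_ _ b1x).
  move=> /nbhs_ballP[r1 /= r10 r1P].
  have : \forall t \near y, q t <= b2.
    have b2y : q y < b2 by rewrite /b2; lra.
    have cy : q @ y --> q y by apply: cin; rewrite in_itv /= y0.
    by move/cvgr_le: cy => /(_ _ b2y).
  move=> /nbhs_ballP[r2 /= r20 r2P].
  pose e := Num.min (Num.min r1 r2) (Num.min (1 - x) (1 - y)) / 4.
  have e0 : 0 < e by rewrite divr_gt0 // !lt_min r10 r20 !subr_gt0 x1.
  have e_le z : Num.min (Num.min r1 r2) (Num.min (1 - x) (1 - y)) <= z -> 4 * e <= z.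
    by rewrite /e mulrC divfK.
  have er1 : 4 * e <= r1 by apply: e_le; rewrite !ge_min lexx.
  have er2 : 4 * e <= r2 by apply: e_le; rewrite !ge_min lexx orbT.
  have ex : 4 * e <= 1 - x by apply: e_le; rewrite !ge_min lexx !orbT.
  have ey : 4 * e <= 1 - y by apply: e_le; rewrite !ge_min lexx !orbT.
  have xe : x + 2 * e < 1 by lra.
  have ye : y + 2 * e < 1 by lra.
  have [tphi dphi] := test_fun_step x0 y0 (ltW e0) xe ye.
  have := q0 _ tphi; rewrite dphi.
  have dsq z : sqint (dstep z e) by apply/continuous_sqint/continuous_subspaceT.
  have i1 z : intble (fun t => q t * dstep z e t) by apply: sqint_mul.
  have -> : int01 (fun t => q t * (dstep x e t - dstep y e t)) =
      int01 (fun t => q t * dstep x e t) - int01 (fun t => q t * dstep y e t).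
    by rewrite -int01B //; apply: int01_ext => t _; rewrite mulrBr.
  have lo : b1 * (2 * e ^+ 2) <= int01 (fun t => q t * dstep x e t).
    rewrite -(dstep_int x0 (ltW e0) xe) -int01Z; last exact: sqint_intble.
    apply: int01_le => //; first by apply: intbleZ; exact: sqint_intble.
    move=> t _; have [/andP[xt tx]|/(dstep_out (ltW e0)) ->] := boolP (x <= t <= x + 2 * e);
      last by rewrite !mulr0.
    apply: ler_wpM2r; first by apply: dstep_ge0; exact: ltW.
    apply: r1P; rewrite /ball /= distrC ger0_norm ?subr_ge0 //; lra.
  have up : int01 (fun t => q t * dstep y e t) <= b2 * (2 * e ^+ 2).
    rewrite -(dstep_int y0 (ltW e0) ye) -int01Z; last exact: sqint_intble.
    apply: int01_le => //; first by apply: intbleZ; exact: sqint_intble.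
    move=> t _; have [/andP[yt ty]|/(dstep_out (ltW e0)) ->] := boolP (y <= t <= y + 2 * e);
      last by rewrite !mulr0.
    apply: ler_wpM2r; first by apply: dstep_ge0; exact: ltW.
    apply: r2P; rewrite /ball /= distrC ger0_norm ?subr_ge0 //; lra.
  have : b2 * (2 * e ^+ 2) < b1 * (2 * e ^+ 2).
    have b12 : b2 < b1 by rewrite /b1 /b2; lra.
    by rewrite ltr_pM2r // mulr_gt0 // exprn_gt0.
  lra.
pose c := q (1 / 2).
have half01 : (0 : R) < (1 / 2 : R) < 1 by lra.
have qc x : 0 < x < 1 -> q x = c by move=> x01; apply/eqP; rewrite eq_le !le_q.
have Fr : ProperFilter (0 : R)^'+ by exact: at_right_proper_filter.
have q_0 : q 0 = c.
  apply: (@cvg_unique _ (@Rhausdorff R) _ (fmap_proper_filter q Fr) _ _ c0) => /=.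
  have cc : cst c @ (0 : R)^'+ --> c by exact: (@cvg_cst _ _ _ _ Fr).
  apply: cvg_trans cc => /=.
  apply: (@near_eq_cvg _ _ _ Fr); near=> t; apply/esym/qc; apply/andP; split; near: t.
    exact: nbhs_right_gt.
  exact: nbhs_right_lt.
have Fl : ProperFilter (1 : R)^'- by exact: at_left_proper_filter.
have q_1 : q 1 = c.
  apply: (@cvg_unique _ (@Rhausdorff R) _ (fmap_proper_filter q Fl) _ _ c1) => /=.
  have cc : cst c @ (1 : R)^'- --> c by exact: (@cvg_cst _ _ _ _ Fl).
  apply: cvg_trans cc => /=.
  apply: (@near_eq_cvg _ _ _ Fl); near=> t; apply/esym/qc; apply/andP; split; near: t.
    exact: nbhs_left_gt.
  exact: nbhs_left_lt.
move=> x /andP[]; rewrite le_eqVlt => /orP[/eqP <- //|x0].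
rewrite le_eqVlt => /orP[/eqP ->|x1]; first by rewrite q_0.
by rewrite q_0 qc // x0.
Unshelve. all: by end_near.
Qed.

(** The difference between [f] and the primitive has weak derivative zero. *)
Lemma rweakP (f h : R -> R) : {within `[0, 1], continuous f} -> intble h ->
  rweak f h <-> (forall x, 0 <= x <= 1 -> f x = f 0 + prim h x).
Proof.
move=> cf hh; have hf := continuous_sqint cf; have cp := prim_continuous hh.
have sp := continuous_sqint cp.
split => [wf x x01|fE phi tphi].
  have cq : {within `[0, 1], continuous (fun x => f x - prim h x)}.
    by move=> t; apply: cvgB; [exact: cf|exact: cp].
  have q0 phi : test_fun phi -> int01 (fun x => (f x - prim h x) * derive1 phi x) = 0.
    move=> tphi; have [_ s2] := test_fun_sqint tphi.
    transitivity (int01 (fun x => f x * derive1 phi x) - int01 (fun x => prim h x * derive1 phi x)).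
      rewrite -int01B; [|exact: sqint_mul|exact: sqint_mul].
      by apply: int01_ext => t _; rewrite mulrBl.
    by rewrite wf // prim_rweak // subrr.
  have := du_Bois_Reymond cq q0 x01; rewrite prim0 subr0 => <-.
  by rewrite subrK.
have [dphi cd _] := tphi; have [s1 s2] := test_fun_sqint tphi.
rewrite -prim_rweak //.
have -> : int01 (fun x => f x * derive1 phi x) =
    f 0 * int01 (derive1 phi) + int01 (fun x => prim h x * derive1 phi x).
  rewrite -int01Z; last exact: sqint_intble.
  rewrite -int01D; [|by apply: intbleZ; exact: sqint_intble|exact: sqint_mul].
  apply: int01_ext => x /set_mem; rewrite /= in_itv /= => /andP[x0 x1].
  by rewrite fE ?mulrDl // !ltW.
suff -> : int01 (derive1 phi) = 0 by rewrite mulr0 add0r.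
have cphi := test_fun_continuous tphi.
rewrite int01_J01; last exact: sqint_intble.
rewrite /Rintegral (continuous_FTC2 (f := derive1 phi) (F := phi) ltr01).
- by rewrite !(test_fun_out tphi) ?in_itv /= ?ltxx ?andbF // subrr.
- exact: continuous_subspaceT.
- split => [x _||]; first exact: dphi.
    by apply: cvg_at_right_filter; exact: cphi.
  by apply: cvg_at_left_filter; exact: cphi.
- by [].
Qed.

End DuBoisReymond.

(** * Trigonometric expansions *)

Section OrthogonalExpansion.
Context {R : realType}.
Local Notation mu := (@lebesgue_measure R).
Local Notation I01 := (`]0%R, 1%R[%classic : set R).
Variables (e : nat -> R -> R) (w : nat -> R).
Hypotheses (e_sq : forall j, sqint (e j)) (w_gt0 : forall j, 0 < w j).
Hypothesis ortho : forall i j, int01 (fun x => e i x * e j x) = if i == j then w i else 0.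
Hypothesis total : forall h, sqint h -> (forall j, int01 (fun x => h x * e j x) = 0) ->
  h = (fun=> 0) %[ae mu in I01].

Definition fsum (c : nat -> R) n x : R := \sum_(j < n) c j * e j x.

Lemma fsum_sqint c n : sqint (fsum c n).
Proof.
elim: n => [|n IH].
  have [m i] := sqint_cst (0 : R).
  by split; [apply: eq_measurable_fun m|apply: intble_ext i] => x _; rewrite /fsum big_ord0.
have [m i] := sqintD IH (sqintZ (c n) (e_sq n)).
by split; [apply: eq_measurable_fun m|apply: intble_ext i] => x _; rewrite /fsum big_ord_recr.
Qed.

Let fsum_e c n k : int01 (fun x => fsum c n x * e k x) = if (k < n)%N then c k * w k else 0.
Proof.
elim: n => [|n IH].
  by rewrite -[RHS]int01_cst; apply: int01_ext => x _; rewrite /fsum big_ord0 mul0r.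
transitivity (int01 (fun x => fsum c n x * e k x) + c n * int01 (fun x => e n x * e k x)).
  rewrite -int01Z; last exact: sqint_mul.
  rewrite -int01D; [|by apply: sqint_mul => //; exact: fsum_sqint|by apply: intbleZ; exact: sqint_mul].
  by apply: int01_ext => x _; rewrite /fsum big_ord_recr /= mulrDl mulrA.
rewrite IH ortho ltnS; have [kn|nk|->] := ltngtP k n.
- by rewrite mulr0 addr0.
- by rewrite mulr0 addr0.
- by rewrite add0r.
Qed.

Let fsum_norm c n : int01 (fun x => fsum c n x ^+ 2) = \sum_(j < n) c j ^+ 2 * w j.
Proof.
elim: n => [|n IH].
  by rewrite big_ord0 -[RHS]int01_cst; apply: int01_ext => x _; rewrite /fsum big_ord0 expr0n.
rewrite big_ord_recr /= -IH.
have s := fsum_sqint c n.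
transitivity (int01 (fun x => fsum c n x ^+ 2) +
   (2 * c n * int01 (fun x => fsum c n x * e n x) + c n ^+ 2 * int01 (fun x => e n x * e n x))).
  have i1 : intble (fun x => fsum c n x * e n x) by exact: sqint_mul.
  have i2 : intble (fun x => e n x * e n x) by exact: sqint_mul.
  have [_ i3] := s; have i4 := intbleZ (2 * c n) i1; have i5 := intbleZ (c n ^+ 2) i2.
  rewrite -(int01Z (2 * c n) i1) -(int01Z (c n ^+ 2) i2) -(int01D i4 i5).
  rewrite -(int01D i3 (intbleD i4 i5)).
  by apply: int01_ext => x _; rewrite /fsum big_ord_recr /=; ring.
by rewrite fsum_e ltnn ortho eqxx mulr0 add0r.
Qed.

(** By Bessel's inequality the partial sums converge; the limit differs from [f]
    by a function orthogonal to every [e j], which vanishes by totality. *)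
Lemma orthogonal_expansion f : sqint f ->
  exists p, vanish (fun n => int01 (fun x => (f x - fsum p n x) ^+ 2)).
Proof.
move=> hf; pose p j := int01 (fun x => f x * e j x) / w j.
have fe n : int01 (fun x => f x * e n x) = p n * w n.
  by rewrite /p divfK // lt0r_neq0.
have f_fsum n : int01 (fun x => f x * fsum p n x) = \sum_(j < n) p j ^+ 2 * w j.
  elim: n => [|n IH].
    by rewrite big_ord0 -[RHS]int01_cst; apply: int01_ext => x _; rewrite /fsum big_ord0 mulr0.
  rewrite big_ord_recr /= -IH expr2 -mulrA -fe -int01Z; last exact: sqint_mul.
  rewrite -int01D; [|by apply: sqint_mul => //; exact: fsum_sqint|by apply: intbleZ; exact: sqint_mul].
  by apply: int01_ext => x _; rewrite /fsum big_ord_recr /=; ring.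
have rest n : int01 (fun x => (f x - fsum p n x) ^+ 2) =
    int01 (fun x => f x ^+ 2) - \sum_(j < n) p j ^+ 2 * w j.
  have s := fsum_sqint p n.
  have i1 : intble (fun x => f x * fsum p n x) by exact: sqint_mul.
  have [_ i2] := s; have [_ i3] := hf.
  transitivity (int01 (fun x => f x ^+ 2) + (int01 (fun x => fsum p n x ^+ 2)
     - 2 * int01 (fun x => f x * fsum p n x))); last by rewrite fsum_norm f_fsum; ring.
  have i4 := intbleZ 2 i1.
  rewrite -(int01Z 2 i1) -(int01B i2 i4) -(int01D i3 (intbleB i2 i4)).
  by apply: int01_ext => x _; ring.
have pw0 j : 0 <= p j ^+ 2 * w j by rewrite mulr_ge0 ?sqr_ge0 // ltW.
have bessel n : \sum_(j < n) p j ^+ 2 * w j <= int01 (fun x => f x ^+ 2).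
  by rewrite -subr_ge0 -rest; apply: int01_ge0 => x _; exact: sqr_ge0.
have fsB m n : (m <= n)%N ->
    int01 (fun x => (fsum p n x - fsum p m x) ^+ 2) =
    \sum_(j < n) p j ^+ 2 * w j - \sum_(j < m) p j ^+ 2 * w j.
  move=> mn; pose c j := if (j < m)%N then 0 else p j.
  transitivity (int01 (fun x => fsum c n x ^+ 2)).
    apply: int01_ext => x _; congr (_ ^+ 2).
    rewrite /fsum (big_ord_widen n (fun j => p j * e j x) mn) [X in _ - X]big_mkcond -sumrB.
    by apply: eq_bigr => j _; rewrite /c; case: ifP; rewrite ?subrr ?mul0r ?subr0.
  rewrite fsum_norm (big_ord_widen n (fun j => p j ^+ 2 * w j) mn) [X in _ - X]big_mkcond -sumrB.
  by apply: eq_bigr => j _; rewrite /c; case: ifP; rewrite ?subrr ?expr0n ?mul0r ?subr0.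
have [y hy yP] : exists2 y, sqint y & vanish (fun n => int01 (fun x => (fsum p n x - y x) ^+ 2)).
  apply: sqint_complete => [n|d d0]; first exact: fsum_sqint.
  have [n0 n0P] := bounded_sum_cauchy pw0 bessel d0.
  exists n0 => i j n0i n0j; have [ij|/ltnW ji] := leqP i j; last by rewrite fsB // n0P.
  rewrite (_ : int01 _ = int01 (fun x => (fsum p j x - fsum p i x) ^+ 2)).
    by rewrite fsB // n0P.
  by apply: int01_ext => x _; rewrite -sqrrN opprB.
have hd : sqint (fun x => f x - y x) by exact: sqintB.
have fy : (fun x => f x - y x) = (fun=> 0) %[ae mu in I01].
  apply: total => // k; apply/eqP; rewrite -normr_le0; apply/eqP.
  apply/eqP; apply: vanish_cst => d d0.
  have t0 : 0 < d / w k by rewrite divr_gt0.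
  have [n0 n0P] := yP _ (mulr_gt0 d0 t0).
  exists 0%N => _ _; pose n := maxn n0 k.+1.
  have lt_n : int01 (fun x => (fsum p n x - y x) ^+ 2) < d * (d / w k) by apply: n0P; exact: leq_maxl.
  have hs : sqint (fun x => fsum p n x - y x) by apply: sqintB => //; exact: fsum_sqint.
  have -> : int01 (fun x => (f x - y x) * e k x) = int01 (fun x => (fsum p n x - y x) * e k x).
    have i1 : intble (fun x => f x * e k x) by exact: sqint_mul.
    have i2 : intble (fun x => y x * e k x) by exact: sqint_mul.
    have i3 : intble (fun x => fsum p n x * e k x) by apply: sqint_mul => //; exact: fsum_sqint.
    transitivity (int01 (fun x => f x * e k x) - int01 (fun x => y x * e k x)).
      by rewrite -int01B //; apply: int01_ext => x _; rewrite mulrBl.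
    rewrite fe; have := fsum_e p n k; rewrite leq_max ltnSn orbT => <-.
    by rewrite -int01B //; apply: int01_ext => x _; rewrite mulrBl.
  have iu : intble (fun x => (fsum p n x - y x) * e k x) by exact: sqint_mul.
  apply: le_lt_trans (int01_abs iu) _.
  pose s := d / w k.
  have le1 : 2 * s * int01 (fun x => `|(fsum p n x - y x) * e k x|) <=
      int01 (fun x => (fsum p n x - y x) ^+ 2) + s ^+ 2 * int01 (fun x => e k x * e k x).
    have i4 : intble (fun x => e k x * e k x) by exact: sqint_mul.
    have [_ i5] := hs.
    have i6 := intbleZ (s ^+ 2) i4.
    rewrite -(int01Z (2 * s) (intble_abs iu)) -(int01Z (s ^+ 2) i4) -(int01D i5 i6).
    apply: int01_le; [by apply: intbleZ; exact: intble_abs|by apply: intbleD => //; exact: intbleZ|].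
    move=> x _; rewrite normrM -expr2 -[_ ^+ 2]real_normK ?num_real //.
    rewrite -[e k x ^+ 2]real_normK ?num_real //.
    by have := sqr_ge0 (`|fsum p n x - y x| - s * `|e k x|); lra.
  rewrite ortho eqxx in le1.
  have sw : s * w k = d by rewrite /s divfK // lt0r_neq0.
  have s0 : 0 < s by [].
  have : 2 * s * int01 (fun x => `|(fsum p n x - y x) * e k x|) < 2 * s * d.
    apply: le_lt_trans le1 _; rewrite expr2 -mulrA sw.
    by move: lt_n; rewrite -/s; lra.
  by rewrite ltr_pM2l // mulr_gt0.
exists p; apply: (@vanish_le _ 0 _ _ _ yP) => n _.
rewrite le_eqVlt; apply/orP; left; apply/eqP; apply: int01_ae.
- by apply: measurable_funX; apply: sqint_measurable; apply: sqintB => //; exact: fsum_sqint.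
- by apply: measurable_funX; apply: sqint_measurable; apply: sqintB => //; exact: fsum_sqint.
- apply: ae_imp fy => x fy Ix; have := fy Ix => /eqP; rewrite subr_eq0 => /eqP ->.
  by rewrite -sqrrN opprB.
Qed.

End OrthogonalExpansion.

Section Trigonometric.
Context {R : realType}.
Local Notation mu := (@lebesgue_measure R).
Local Notation I01 := (`]0%R, 1%R[%classic : set R).

Definition cosf (k : int) (x : R) : R := cos (pi * k%:~R * x).
Definition sinf (k : int) (x : R) : R := sin (pi * k%:~R * x).

Let mul_cont (c : R) : continuous (fun x : R => c * x).
Proof. by move=> x; apply: cvgM; [exact: cvg_cst|exact: cvg_id]. Qed.

Lemma cosf_continuous k : continuous (cosf k).
Proof. by move=> x; apply: continuous_comp; [exact: mul_cont|exact: continuous_cos]. Qed.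

Lemma sinf_continuous k : continuous (sinf k).
Proof. by move=> x; apply: continuous_comp; [exact: mul_cont|exact: continuous_sin]. Qed.

Lemma cosf_sqint k : sqint (cosf k).
Proof. by apply/continuous_sqint/continuous_subspaceT; exact: cosf_continuous. Qed.

Lemma sinf_sqint k : sqint (sinf k).
Proof. by apply/continuous_sqint/continuous_subspaceT; exact: sinf_continuous. Qed.

Let mul_derive (c x : R) : is_derive x 1 (fun y : R => c * y) c.
Proof.
have h : is_derive x 1 (c *: (@idfun R)) (c *: 1) by apply: is_deriveZ.
by rewrite /GRing.scale /= mulr1 in h.
Qed.

Lemma int01_cosf k : int01 (cosf k) = (k == 0)%:R.
Proof.
have [->|k0] := eqVneq k 0.
  by rewrite -[RHS]int01_cst; apply: int01_ext => x _; rewrite /cosf mulr0 mul0r cos0.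
pose c : R := pi * k%:~R; have c0 : c != 0.
  by rewrite mulf_neq0 ?intr_eq0 // lt0r_neq0 // pi_gt0.
have d (x : R) : is_derive x 1 (fun y => c^-1 * sin (c * y)) (cosf k x).
  have h := is_derive1_comp (is_derive_sin (c * x)) (mul_derive c x).
  have := is_deriveZ c^-1 h; rewrite /cosf -/c.
  have -> : c^-1 *: (cos (c * x) * c) = cos (c * x) by rewrite /GRing.scale /= mulrCA mulVf // mulr1.
  by [].
have hi := sqint_intble (cosf_sqint k).
have cF : continuous (fun y => c^-1 * sin (c * y)).
  move=> y; apply: differentiable_continuous; apply/derivable1_diffP.
  by have [] := d y.
rewrite int01_J01 // /Rintegral (continuous_FTC2 (F := fun y => c^-1 * sin (c * y)) ltr01).
- by rewrite /= mulr0 sin0 mulr1 /c sin_pi_int !mulr0 subrr.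
- by apply: continuous_subspaceT; exact: cosf_continuous.
- split => [x _||]; first by have [] := d x.
    by apply: cvg_at_right_filter; exact: cF.
  by apply: cvg_at_left_filter; exact: cF.
- by move=> x _; rewrite derive1E; have [] := d x.
Qed.

Let angleD j k x : pi * (j + k)%:~R * x = pi * j%:~R * x + pi * k%:~R * x :> R.
Proof. by rewrite intrD mulrDr mulrDl. Qed.

Let angleB j k x : pi * (j - k)%:~R * x = pi * j%:~R * x - pi * k%:~R * x :> R.
Proof. by rewrite intrB mulrBr mulrBl. Qed.

Lemma cosf_mul j k x : cosf j x * cosf k x = (cosf (j - k) x + cosf (j + k) x) / 2.
Proof. by rewrite /cosf angleB angleD cosB cosD; field. Qed.

Lemma sinf_mul j k x : sinf j x * sinf k x = (cosf (j - k) x - cosf (j + k) x) / 2.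
Proof. by rewrite /cosf /sinf angleB angleD cosB cosD; field. Qed.

Lemma sinf_cosf_mul j k x : sinf j x * cosf k x = (sinf (j + k) x + sinf (j - k) x) / 2.
Proof. by rewrite /cosf /sinf angleB angleD sinB sinD; field. Qed.

Lemma cosfN k x : cosf (- k) x = cosf k x.
Proof. by rewrite /cosf intrN mulrN mulNr cosN. Qed.

Lemma sinfN k x : sinf (- k) x = - sinf k x.
Proof. by rewrite /sinf intrN mulrN mulNr sinN. Qed.

Lemma int01_cosf_lin (a b : R) j k :
  int01 (fun x => a * cosf j x + b * cosf k x) = a * (j == 0)%:R + b * (k == 0)%:R.
Proof.
have ci l := sqint_intble (cosf_sqint l).
by rewrite int01D ?int01Z ?int01_cosf //; exact: intbleZ.
Qed.

Lemma cosf_ortho (i j : nat) : int01 (fun x => cosf i x * cosf j x) =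
  if i == j then (if (i == 0)%N then 1 else 1 / 2) else 0.
Proof.
transitivity (int01 (fun x => 1 / 2 * cosf (i%:Z - j%:Z) x + 1 / 2 * cosf (i%:Z + j%:Z) x)).
  by apply: int01_ext => x _; rewrite cosf_mul; ring.
rewrite int01_cosf_lin subr_eq0 eqz_nat -PoszD eqz_nat addn_eq0.
have [->|ij] := eqVneq i j; first by case: (j == 0)%N => /=; lra.
have -> : (i == 0)%N && (j == 0)%N = false.
  by apply/negbTE; apply: contra ij => /andP[/eqP -> /eqP ->].
by rewrite !mulr0 addr0.
Qed.

Lemma sinf_ortho (i j : nat) : int01 (fun x => sinf i.+1 x * sinf j.+1 x) =
  if i == j then 1 / 2 else 0.
Proof.
transitivity (int01 (fun x => 1 / 2 * cosf (i.+1%:Z - j.+1%:Z) x + - (1 / 2) * cosf (i.+1%:Z + j.+1%:Z) x)).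
  by apply: int01_ext => x _; rewrite sinf_mul; ring.
rewrite int01_cosf_lin subr_eq0 eqz_nat -PoszD eqz_nat addn_eq0 /= eqSS.
by case: (i == j) => /=; lra.
Qed.

Lemma bernoulli_ge (u : R) n : -1 <= u -> 1 + n%:R * u <= (1 + u) ^+ n.
Proof.
move=> u1; elim: n => [|n IH]; first by rewrite mul0r addr0 expr0.
rewrite exprS -natr1; have u0 : 0 <= 1 + u by lra.
apply: le_trans (ler_wpM2l u0 IH).
by have := ler0n R n; have := sqr_ge0 u; nra.
Qed.

(** The polynomials [(1 - z ^ n) ^ k] with [k] about [theta ^ - n] are bounded by
    one on [0, 1] and tend to the indicator function of [z < theta]. *)
Lemma step_polynomial (theta : R) : 0 < theta < 1 -> exists p : nat -> {poly R},
  [/\ forall n y, 0 <= y <= 1 -> 0 <= (p n).[y] <= 1,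
      forall y, 0 <= y < theta -> vanish (fun n => 1 - (p n).[y]) &
      forall y, theta < y <= 1 -> vanish (fun n => (p n).[y])].
Proof.
move=> /andP[th0 th1]; pose K n := Num.truncn ((theta ^+ n)^-1).
exists (fun n => (1 - 'X^n) ^+ K n).
have pE n y : ((1 - 'X^n) ^+ K n).[y] = (1 - y ^+ n) ^+ K n :> R.
  by rewrite horner_exp hornerD hornerN hornerXn hornerC.
have yn n (y : R) : 0 <= y <= 1 -> 0 <= y ^+ n <= 1.
  by move=> /andP[y0 y1]; rewrite exprn_ge0 // exprn_ile1.
have tn n : 0 < theta ^+ n by rewrite exprn_gt0.
have K_le n : (K n)%:R <= (theta ^+ n)^-1 by rewrite truncn_le // invr_ge0 ltW.
have K_gt n : (theta ^+ n)^-1 < (K n)%:R + 1 by rewrite natr1; exact: truncnS_gt.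
split.
- move=> n y /(yn n)/andP[y0 y1]; rewrite pE exprn_ge0 ?subr_ge0 //=.
  by rewrite exprn_ile1 ?subr_ge0 // lerBlDr lerDl.
- move=> y /andP[y0 yth].
  have q01 : 0 <= y / theta < 1 by rewrite divr_ge0 ?(ltW th0) //= ltr_pdivrMr // mul1r.
  apply: (@vanish_le _ 0 _ _ _ (vanish_expr q01)) => n _; rewrite pE.
  have y01 : 0 <= y <= 1 by rewrite y0 ltW // (lt_trans yth).
  have /andP[yn0 yn1] := yn n y y01.
  have := @bernoulli_ge (- y ^+ n) (K n); rewrite lerN2 => /(_ yn1).
  have : (K n)%:R * y ^+ n <= (y / theta) ^+ n.
    by rewrite expr_div_n mulrC ler_wpM2l.
  by rewrite mulrN; lra.
- move=> y /andP[yth y1].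
  have y0 : 0 < y by apply: lt_trans yth.
  have q01 : 0 <= theta / y < 1 by rewrite divr_ge0 ?(ltW y0) ?(ltW th0) //= ltr_pdivrMr // mul1r.
  apply: (@vanish_le _ 0 _ _ _ (vanish_expr q01)) => n _; rewrite pE.
  have yn0 : 0 < y ^+ n by rewrite exprn_gt0.
  have yn1 : y ^+ n <= 1 by rewrite exprn_ile1 // ltW.
  set u := y ^+ n in yn0 yn1 *.
  have h1 : (1 - u) ^+ K n * (1 + u) ^+ K n <= 1.
    rewrite -exprMn exprn_ile1 //; nra.
  have h2 : 1 + (K n)%:R * u <= (1 + u) ^+ K n by apply: bernoulli_ge; lra.
  have h3 : (y / theta) ^+ n <= 1 + (K n)%:R * u.
    rewrite expr_div_n -/u mulrC.
    have := ler_wpM2r (ltW yn0) (ltW (K_gt n)); lra.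
  have h4 : (theta / y) ^+ n * (y / theta) ^+ n = 1.
    by rewrite -exprMn mulrA divfK ?lt0r_neq0 // divff ?lt0r_neq0 // expr1n.
  have w0 : 0 <= (1 - u) ^+ K n by rewrite exprn_ge0 // subr_ge0.
  have q0 : 0 < (y / theta) ^+ n by rewrite exprn_gt0 // divr_gt0.
  suff : (1 - u) ^+ K n * (y / theta) ^+ n <= (theta / y) ^+ n * (y / theta) ^+ n.
    by rewrite (ler_pM2r q0).
  rewrite h4; apply: le_trans h1; apply: ler_wpM2l => //.
  exact: le_trans h3 h2.
Qed.

End Trigonometric.

Section Totality.
Context {R : realType}.
Local Notation mu := (@lebesgue_measure R).
Local Notation I01 := (`]0%R, 1%R[%classic : set R).

Lemma dominated_vanish (f : nat -> R -> R) (g : R -> R) : intble g ->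
  (forall n, measurable_fun I01 (f n)) ->
  (forall n x, I01 x -> `|f n x| <= g x) ->
  {ae mu, forall x, I01 x -> vanish (fun n => `|f n x|)} ->
  vanish (fun n => `|int01 (f n)|).
Proof.
move=> hg mf fg f0.
have i n : intble (f n) by exact: intble_le (mf n) hg (fg n).
have mfE n : measurable_fun I01 (EFin \o f n) by exact/measurable_EFinP.
have fae : {ae mu, forall x, I01 x -> (fun n => (EFin \o f n) x) @ \oo --> (0 : \bar R)}.
  apply: ae_imp f0 => x fx Ix; apply/fine_cvgP; split; first exact: nearW.
  apply/cvgrPdist_lt => e /(fx Ix)[n0 n0P]; exists n0 => // n /n0P.
  by rewrite /= sub0r normrN.
have dom : {ae mu, forall x n, I01 x -> (`|(EFin \o f n) x| <= (EFin \o g) x)%E}.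
  by apply: aeW => x n Ix /=; rewrite lee_fin fg.
have [_ _] := dominated_convergence measurable_I01 mfE (measurable_cst _) fae hg dom.
rewrite integral0 => /fine_cvgP[_ /cvgrPdist_lt cv] e /cv[n0 _ n0P].
by exists n0 => n /n0P; rewrite /= sub0r normrN.
Qed.

(** The function [z] increases from 0 to 1, and the polynomials in [z] are the
    trigonometric polynomials in cosines; so [h] is orthogonal to all of them.
    Approximating the indicator of [z x < z t] by polynomials in [z] shows that the
    integral of [h] over [0, t] vanishes. *)
Lemma cos_total (h : R -> R) : intble h ->
  (forall k : nat, int01 (fun x => h x * cosf k x) = 0) -> h = (fun=> 0) %[ae mu in I01].
Proof.
move=> hi.
move=> hc.
pose z (x : R) : R := (1 - cos (pi * x)) / 2.
have zE x : z x = 1 / 2 - 1 / 2 * cosf 1 x by rewrite /z /cosf mulr1; lra.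
have z01 x : 0 <= z x <= 1.
  by rewrite /z; have := cos_le1 (pi * x); have := cos_geN1 (pi * x); lra.
have mz : measurable_fun I01 z.
  have m := sqint_measurable (sqintB (sqint_cst (1 / 2 : R)) (sqintZ (1 / 2) (cosf_sqint 1))).
  by apply: eq_measurable_fun m => x _; rewrite zE.
have mh := intble_measurable hi.
have mc k := sqint_measurable (@cosf_sqint R k).
have bnd (g : R -> R) k j : intble g -> intble (fun x => g x * (z x ^+ j * cosf k x)).
  move=> gi; apply: intble_le (intble_abs gi) _.
    apply: measurable_funM; first exact: intble_measurable.
    by apply: measurable_funM => //; exact: measurable_funX.
  move=> x _; rewrite normrM ler_piMr // normrM.
  have /andP[z0 z1] := z01 x.
  have c1 : `|cosf k x| <= 1 by rewrite ler_norml /cosf cos_le1 cos_geN1.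
  by rewrite -[leRHS](mulr1 1) ler_pM // normrX ger0_norm // exprn_ile1.
have moment j (k : int) : int01 (fun x => h x * (z x ^+ j * cosf k x)) = 0.
  elim: j k => [|j IH] k.
    have -> : int01 (fun x => h x * (z x ^+ 0 * cosf k x)) = int01 (fun x => h x * cosf `|k|%N x).
      apply: int01_ext => x _; rewrite expr0 mul1r; congr (_ * _).
      by case: k => // n; rewrite NegzE cosfN.
    exact: hc.
  transitivity (int01 (fun x => 1 / 2 * (h x * (z x ^+ j * cosf k x)) -
      (1 / 4 * (h x * (z x ^+ j * cosf (1 - k) x)) + 1 / 4 * (h x * (z x ^+ j * cosf (1 + k) x))))).
    apply: int01_ext => x _; rewrite exprSr.
    have cc := cosf_mul 1 k x.
    transitivity (h x * (z x ^+ j * (1 / 2 * cosf k x - 1 / 2 * (cosf 1 x * cosf k x)))).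
      by rewrite zE; ring.
    by rewrite cc; field.
  rewrite int01B; [|exact/intbleZ/bnd|apply: intbleD; exact/intbleZ/bnd].
  rewrite int01D ?int01Z ?IH; try exact: bnd; try exact/intbleZ/bnd.
  by rewrite !mulr0 addr0 subrr.
have poly (p : {poly R}) : intble (fun x => h x * p.[z x]) /\ int01 (fun x => h x * p.[z x]) = 0.
  have zz j : intble (fun x => p`_j * (h x * (z x ^+ j * cosf 0 x))) by exact/intbleZ/bnd.
  have [i1 i2] := int01_sum (index_enum 'I_(size p)) (fun j : 'I_(size p) => zz j).
  have E x : \sum_(j < size p) p`_j * (h x * (z x ^+ j * cosf 0 x)) = h x * p.[z x].
    rewrite horner_coef mulr_sumr; apply: eq_bigr => j _.
    by rewrite /cosf mulr0 mul0r cos0 mulr1; ring.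
  split; first by apply: intble_ext i1 => x _; exact: E.
  under int01_ext do rewrite -E.
  by rewrite i2 big1 // => j _; rewrite int01Z ?moment ?mulr0 //; exact: bnd.
have h0 : int01 h = 0.
  rewrite -(hc 0%N); apply: int01_ext => x _.
  by rewrite /cosf mulr0 mul0r cos0 mulr1.
apply: prim_eq0 => // t /andP[t0 t1].
move: t0; rewrite le_eqVlt => /predU1P[<-|t0]; first exact: prim0.
move: t1; rewrite le_eqVlt => /predU1P[->|t1]; first by rewrite prim1.
have zt (x y : R) : 0 < x < 1 -> 0 < y < 1 -> x < y -> z x < z y.
  move=> /andP[x0 x1] /andP[y0 y1] xy; have p0 := @pi_gt0 R.
  rewrite /z ltr_pM2r // ltrD2l ltrN2 ltr_cos ?ltr_pM2l // in_itv /=; apply/andP; split.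
  - by rewrite mulr_ge0 // ltW.
  - by rewrite ler_piMr ?ltW.
  - by rewrite mulr_ge0 // ltW.
  - by rewrite ler_piMr ?ltW.
have th : 0 < z t < 1.
  have t01 : 0 < t < 1 by rewrite t0.
  have := @zt (t / 2) t; have := @zt t ((1 + t) / 2).
  have /andP[] := z01 (t / 2); have /andP[] := z01 ((1 + t) / 2).
  move=> _ a1 a0 _ b1 b0.
  have : z t < z ((1 + t) / 2) by apply: b1 => //; lra.
  have : z (t / 2) < z t by apply: b0 => //; lra.
  lra.
have [p [p01 pl pr]] := step_polynomial th.
pose f n x := h x * (p n).[z x] - h x * (t >= x)%R%:R.
have fi n : intble (f n) by apply: intbleB; [exact: (poly _).1|exact: intble_cut].
have fE n : int01 (f n) = - prim h t.
  rewrite int01B; [|exact: (poly _).1|exact: intble_cut].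
  by rewrite (poly _).2 sub0r primE // !ltW.
have : vanish (fun n => `|int01 (f n)|).
  apply: (dominated_vanish (g := fun x => `|h x|)).
  - exact: intble_abs.
  - by move=> n; exact: intble_measurable.
  - move=> n x _; rewrite /f -mulrBr normrM ler_piMr //.
    have /andP[a0 a1] := p01 n _ (z01 x); rewrite ler_norml.
    by case: (x <= t) => /=; lra.
  - have : {ae mu, forall x, x != t}.
      exists [set t]; split; [exact: measurable_set1|exact: lebesgue_measure_set1|].
      by move=> x /= /negP/negPn/eqP.
    apply: ae_imp => x xt; rewrite /= in_itv /= => x01.
    have t01 : 0 < t < 1 by rewrite t0.
    have /andP[zx0 zx1] := z01 x.
    have [xlt|tlx|/eqP] := ltgtP x t; last by rewrite (negbTE xt).
      have := vanishZ (normr_ge0 (h x)) (pl (z x) _); rewrite zx0 zt // => /(_ isT).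
      apply: (@vanish_le _ 0) => n _; rewrite /f (ltW xlt) -mulrBr normrM.
      have /andP[_ b1] := p01 n _ (z01 x).
      by rewrite [`|_ - _|]distrC [`|1 - _|]ger0_norm ?subr_ge0.
    have := vanishZ (normr_ge0 (h x)) (pr (z x) _); rewrite zx1 zt // => /(_ isT).
    apply: (@vanish_le _ 0) => n _; rewrite /f [x <= t]leNgt tlx /= mulr0 subr0 normrM.
    by rewrite [`|_.[_]|]ger0_norm //; have /andP[] := p01 n _ (z01 x).
under [X in vanish X]funext do rewrite fE normrN.
by move=> /vanish_cst; rewrite normr_le0 => /eqP.
Qed.

(** The product of [h] with [sin (pi x)] is orthogonal to all cosines, and
    [sin (pi x)] is positive inside the interval. *)
Lemma sin_total (h : R -> R) : intble h ->
  (forall k : nat, int01 (fun x => h x * sinf k.+1 x) = 0) -> h = (fun=> 0) %[ae mu in I01].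
Proof.
move=> hi hs.
have sb k x : `|@sinf R k x| <= 1 by rewrite ler_norml /sinf sin_le1 sin_geN1.
have si (g : R -> R) k : intble g -> intble (fun x => g x * sinf k x).
  move=> gi; apply: intble_le (intble_abs gi) _.
    apply: measurable_funM; first exact: intble_measurable.
    exact: sqint_measurable (sinf_sqint k).
  by move=> x _; rewrite normrM ler_piMr ?sb.
have all (k : int) : int01 (fun x => h x * sinf k x) = 0.
  have pos (n : nat) : int01 (fun x => h x * sinf n x) = 0.
    case: n => [|n]; last exact: hs.
    rewrite -[RHS]int01_cst; apply: int01_ext => x _.
    by rewrite /sinf mulr0 mul0r sin0 mulr0.
  case: k => n; first exact: pos.
  rewrite NegzE -[RHS](mulr0 (-1)) -(hs n) -int01Z; last exact: si.
  by apply: int01_ext => x _; rewrite sinfN; ring.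
have : (fun x => h x * sinf 1 x) = (fun=> 0) %[ae mu in I01].
  apply: cos_total; first exact: si.
  move=> k; transitivity (int01 (fun x => 1 / 2 * (h x * sinf (1 + k) x) + 1 / 2 * (h x * sinf (1 - k%:Z) x))).
    by apply: int01_ext => x _; rewrite -mulrA sinf_cosf_mul; field.
  by rewrite int01D ?int01Z ?all; try exact: si; try exact/intbleZ/si; rewrite !mulr0 addr0.
apply: ae_imp => x h0 Ix; have /= /eqP := h0 Ix; rewrite mulf_eq0 => /orP[/eqP //|].
move: Ix; rewrite /= in_itv /= => /andP[x0 x1].
have /sin_gt0_pi : 0 < pi * x < pi by rewrite mulr_gt0 ?pi_gt0 //= gtr_pMr ?pi_gt0.
by rewrite /sinf mulr1 => /gt_eqF ->.
Qed.

Lemma cos_expansion (f : R -> R) : sqint f -> exists p : nat -> R,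
  vanish (fun n => int01 (fun x => (f x - \sum_(j < n) p j * cosf j x) ^+ 2)).
Proof.
apply: (orthogonal_expansion (e := fun j : nat => cosf j)
  (w := fun i : nat => if (i == 0)%N then 1 else 1 / 2)).
- by move=> j; exact: cosf_sqint.
- by move=> j; case: ifP => _; lra.
- by move=> i j; exact: cosf_ortho.
- by move=> h hs; apply: cos_total; exact: sqint_intble.
Qed.

Lemma sin_expansion (f : R -> R) : sqint f -> exists p : nat -> R,
  vanish (fun n => int01 (fun x => (f x - \sum_(j < n) p j * sinf j.+1 x) ^+ 2)).
Proof.
apply: (orthogonal_expansion (e := fun j : nat => sinf j.+1) (w := fun=> 1 / 2)).
- by move=> j; exact: sinf_sqint.
- by move=> j; lra.
- by move=> i j; exact: sinf_ortho.
- by move=> h hs; apply: sin_total; exact: sqint_intble.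
Qed.

End Totality.

(** * Complex-valued functions on the unit interval *)

Section ComplexFunctions.
Context {R : realType}.
Local Notation C := R[i].
Local Notation mu := (@lebesgue_measure R).
Local Notation I01 := (`]0%R, 1%R[%classic : set R).
Implicit Types (f g h p : R -> C).

Definition ccont f : Prop :=
  {within `[0, 1], continuous (fun x => Re (f x))} /\
  {within `[0, 1], continuous (fun x => Im (f x))}.

Definition sqnorm f : R := int01 (fun x => normc (f x) ^+ 2).

Definition cprim h (x : R) : C := prim (fun t => Re (h t)) x +i* prim (fun t => Im (h t)) x.

Let sq_sum f : (fun x => normc (f x) ^+ 2) = (fun x => Re (f x) ^+ 2 + Im (f x) ^+ 2).
Proof. by apply/funext => x; rewrite sqr_normcE. Qed.

Lemma L2P f : L2 f <-> sqint (fun x => Re (f x)) /\ sqint (fun x => Im (f x)).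
Proof.
split => [[mr mi fin]|[[mr hr] [mi hi]]].
  have ms : measurable_fun I01 (fun x => normc (f x) ^+ 2).
    by rewrite sq_sum; apply: measurable_funD; exact: measurable_funX.
  have hs : intble (fun x => normc (f x) ^+ 2).
    apply/integrableP; split; first exact/measurable_EFinP.
    move: fin; congr (_ < _)%E; apply: eq_integral => x _ /=.
    by rewrite ger0_norm // sqr_ge0.
  split; split => //; apply: (intble_le _ hs); try exact: measurable_funX.
    by move=> x _; rewrite ger0_norm ?sqr_ge0 // sqr_normcE lerDl sqr_ge0.
  by move=> x _; rewrite ger0_norm ?sqr_ge0 // sqr_normcE lerDr sqr_ge0.
split => //; have := intbleD hr hi; rewrite -sq_sum => /integrableP[_].
congr (_ < _)%E; apply: eq_integral => x _ /=.
by rewrite ger0_norm // sqr_ge0.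
Qed.

Lemma sqnorm_intble f : L2 f -> intble (fun x => normc (f x) ^+ 2).
Proof. by move=> /L2P[[_ a] [_ b]]; rewrite sq_sum; exact: intbleD. Qed.

Lemma sqnormE f : L2 f ->
  sqnorm f = int01 (fun x => Re (f x) ^+ 2) + int01 (fun x => Im (f x) ^+ 2).
Proof. by move=> /L2P[[_ a] [_ b]]; rewrite /sqnorm sq_sum int01D. Qed.

Lemma sqnorm_ge0 f : 0 <= sqnorm f.
Proof. by apply: int01_ge0 => x _; exact: sqr_ge0. Qed.

Lemma L2D f g : L2 f -> L2 g -> L2 (fun x => f x + g x).
Proof.
move=> /L2P[a b] /L2P[c d]; apply/L2P; split.
  by have := sqintD a c; congr (sqint _); apply/funext => x; rewrite ReD.
by have := sqintD b d; congr (sqint _); apply/funext => x; rewrite ImD.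
Qed.

Lemma ccont_sqint k : ccont k -> sqint (fun x => Re (k x)) /\ sqint (fun x => Im (k x)).
Proof. by move=> [a b]; split; exact: continuous_sqint. Qed.

Lemma ccont_L2 k : ccont k -> L2 k.
Proof. by move=> ck; apply/L2P; exact: ccont_sqint. Qed.

Lemma L2M f k : L2 f -> ccont k -> L2 (fun x => f x * k x).
Proof.
move=> /L2P[a b] [cr ci]; have [mr [M _ rM]] := continuous_I01 cr.
have [mi [M' _ iM]] := continuous_I01 ci.
have in01 x : I01 x -> x \in `[0, 1] by apply: subset_itv_oo_cc.
have mb (u v : R -> R) (B : R) : sqint u -> measurable_fun I01 v ->
    (forall x, x \in `[0, 1] -> `|v x| <= B) -> sqint (fun x => u x * v x).
  by move=> su mv vB; apply: (sqint_mulb (M := B)) => // x /in01; exact: vB.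
apply/L2P; split.
  have := sqintB (mb _ _ _ a mr rM) (mb _ _ _ b mi iM).
  by congr (sqint _); apply/funext => x; rewrite ReM.
have := sqintD (mb _ _ _ a mi iM) (mb _ _ _ b mr rM).
by congr (sqint _); apply/funext => x; rewrite ImM.
Qed.

Lemma ccont_cst (c : C) : ccont (fun=> c).
Proof. by split; apply: continuous_subspaceT => x; exact: cvg_cst. Qed.

Lemma L2Z (c : C) f : L2 f -> L2 (fun x => c * f x).
Proof.
move=> hf; have := L2M hf (ccont_cst c).
by congr L2; apply/funext => x; rewrite mulrC.
Qed.

Lemma L2B f g : L2 f -> L2 g -> L2 (fun x => f x - g x).
Proof.
move=> hf hg; have := L2D hf (L2Z (-1) hg).
by congr L2; apply/funext => x; rewrite mulN1r.
Qed.

Lemma L2_0 : L2 (fun=> 0 : C).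
Proof. exact/ccont_L2/ccont_cst. Qed.

(** The free weight [t] makes this bound additive over the components of a
    sum of squared norms; optimizing in [t] gives the triangle inequality. *)
Lemma normc_sqrD_le (t : R) (a b : C) : 0 < t ->
  normc (a + b) ^+ 2 <= (1 + t) * normc a ^+ 2 + (1 + t^-1) * normc b ^+ 2.
Proof.
move=> t0; have h := normcD_le a b; have := normc_ge0 (a + b).
have := normc_ge0 a; have := normc_ge0 b.
move: (normc _) (normc a) (normc b) h => s x y h y0 x0 s0.
have : s ^+ 2 <= (x + y) ^+ 2 by rewrite ler_pXn2r // nnegrE // addr_ge0.
have : 0 <= (t * x - y) ^+ 2 / t by rewrite divr_ge0 ?sqr_ge0 // ltW.
have -> : (t * x - y) ^+ 2 / t = t * x ^+ 2 - 2 * x * y + t^-1 * y ^+ 2.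
  by field; rewrite lt0r_neq0.
by move: (t^-1) => q; rewrite !sqrrD; lra.
Qed.

Lemma sqnormD_le (t : R) f g : 0 < t -> L2 f -> L2 g ->
  sqnorm (fun x => f x + g x) <= (1 + t) * sqnorm f + (1 + t^-1) * sqnorm g.
Proof.
move=> t0 hf hg; have a := sqnorm_intble hf; have b := sqnorm_intble hg.
rewrite -!int01Z // -int01D; try exact: intbleZ.
apply: int01_le; [exact/sqnorm_intble/L2D|by apply: intbleD; exact: intbleZ|].
by move=> x _; exact: normc_sqrD_le.
Qed.

Lemma sqnormZ (c : C) f : L2 f -> sqnorm (fun x => c * f x) = normc c ^+ 2 * sqnorm f.
Proof.
move=> hf; rewrite -int01Z; last exact: sqnorm_intble.
by apply: int01_ext => x _; rewrite normcM exprMn.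
Qed.

Lemma sqnorm_ae f g : L2 f -> L2 g -> f = g %[ae mu in I01] -> sqnorm f = sqnorm g.
Proof.
move=> hf hg fg; apply: int01_ae.
- by apply: intble_measurable; exact: sqnorm_intble.
- by apply: intble_measurable; exact: sqnorm_intble.
by apply: ae_imp fg => x h Ix; rewrite /= h.
Qed.

Lemma sqnorm_eq0 f : L2 f -> sqnorm f <= 0 -> f = (fun=> 0) %[ae mu in I01].
Proof.
move=> hf f0.
have e0 : (fun x => normc (f x) ^+ 2) = (fun=> 0) %[ae mu in I01].
  by apply: int01_ge0_eq0 => //; [exact: sqnorm_intble|move=> x _; exact: sqr_ge0].
apply: ae_imp e0 => x h Ix; have /= /eqP := h Ix.
by rewrite expf_eq0 /= normc_eq0 => /eqP.
Qed.

Lemma L2_complete (u : nat -> R -> C) : (forall n, L2 (u n)) ->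
  (forall e, 0 < e -> exists n0, forall i j, (n0 <= i)%N -> (n0 <= j)%N ->
     sqnorm (fun x => u i x - u j x) < e) ->
  exists2 f, L2 f & vanish (fun n => sqnorm (fun x => u n x - f x)).
Proof.
move=> hu cu.
have le_re i j : int01 (fun x => (Re (u i x) - Re (u j x)) ^+ 2) <= sqnorm (fun x => u i x - u j x).
  rewrite sqnormE; last exact: L2B.
  rewrite ler_wpDr ?int01_ge0 // => [x _|]; first exact: sqr_ge0.
  by rewrite le_eqVlt; apply/orP; left; apply/eqP/int01_ext => x _; rewrite ReD ReN.
have le_im i j : int01 (fun x => (Im (u i x) - Im (u j x)) ^+ 2) <= sqnorm (fun x => u i x - u j x).
  rewrite sqnormE; last exact: L2B.
  rewrite ler_wpDl ?int01_ge0 // => [x _|]; first exact: sqr_ge0.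
  by rewrite le_eqVlt; apply/orP; left; apply/eqP/int01_ext => x _; rewrite ImD ImN.
have [||a ha va] := sqint_complete (u := fun n x => Re (u n x)).
- by move=> n; have /L2P[] := hu n.
- move=> e /cu[n0 n0P]; exists n0 => i j ii jj.
  by apply: le_lt_trans (le_re i j) _; exact: n0P.
have [||b hb vb] := sqint_complete (u := fun n x => Im (u n x)).
- by move=> n; have /L2P[] := hu n.
- move=> e /cu[n0 n0P]; exists n0 => i j ii jj.
  by apply: le_lt_trans (le_im i j) _; exact: n0P.
have hf : L2 (fun x => a x +i* b x) by apply/L2P.
exists (fun x => a x +i* b x) => //.
apply: (@vanish_le _ 0 _ _ _ (vanishD va vb)) => n _.
rewrite sqnormE; last exact: L2B.
by rewrite le_eqVlt; apply/orP; left; apply/eqP; congr (_ + _);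
  apply: int01_ext => x _; rewrite ?ReD ?ReN ?ImD ?ImN.
Qed.

Lemma L2_intble f : L2 f -> intble (fun x => Re (f x)) /\ intble (fun x => Im (f x)).
Proof. by move=> /L2P[a b]; split; exact: sqint_intble. Qed.

Lemma weak_derivE f h :
  weak_deriv f h <-> rweak (fun x => Re (f x)) (fun x => Re (h x)) /\
                     rweak (fun x => Im (f x)) (fun x => Im (h x)).
Proof.
have re (z : C) (r : R) : Re (z * r%:C) = Re z * r by rewrite ReM /= mulr0 subr0.
have im (z : C) (r : R) : Im (z * r%:C) = Im z * r by rewrite ImM /= mulr0 add0r.
have E (u v : R -> C) (s t : R -> R) :
    cintegral (fun x => u x * (s x)%:C) = - cintegral (fun x => v x * (t x)%:C) <->
    int01 (fun x => Re (u x) * s x) = - int01 (fun x => Re (v x) * t x) /\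
    int01 (fun x => Im (u x) * s x) = - int01 (fun x => Im (v x) * t x).
  have c (w : R -> C) (r : R -> R) : cintegral (fun x => w x * (r x)%:C) =
      int01 (fun x => Re (w x) * r x) +i* int01 (fun x => Im (w x) * r x).
    apply: complex_ext => /=; apply: int01_ext => x _; [exact: re|exact: im].
  rewrite !c; split => [e|[a b]].
    by split; [have := congr1 (@Re R) e|have := congr1 (@Im R) e].
  by apply: complex_ext.
split => [w|[a b] phi tphi].
  by split => phi /w /E[].
by apply/E; split; [exact: a|exact: b].
Qed.

Lemma weak_derivP f h : ccont f -> L2 h ->
  weak_deriv f h <-> (forall x, 0 <= x <= 1 -> f x = f 0 + cprim h x).
Proof.
move=> [cr ci] /L2_intble[ir ii]; rewrite weak_derivE (rweakP cr ir) (rweakP ci ii).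
split => [[a b] x x01|e].
  by apply: complex_ext; [rewrite ReD; exact: a|rewrite ImD; exact: b].
by split => x /e E; [have := congr1 (@Re R) E; rewrite ReD|have := congr1 (@Im R) E; rewrite ImD].
Qed.

Lemma cprim0 h : cprim h 0 = 0.
Proof. by rewrite /cprim !prim0. Qed.

Lemma cprim_ccont h : L2 h -> ccont (cprim h).
Proof. by move=> /L2_intble[a b]; split; exact: prim_continuous. Qed.

Lemma cprimD f g x : L2 f -> L2 g -> 0 <= x <= 1 ->
  cprim (fun t => f t + g t) x = cprim f x + cprim g x.
Proof.
move=> /L2_intble[a b] /L2_intble[c d] x01; apply: complex_ext => /=.
  by rewrite -primD //; congr prim; apply/funext => t; rewrite ReD.
by rewrite -primD //; congr prim; apply/funext => t; rewrite ImD.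
Qed.

Lemma cprimZ (c : C) f x : L2 f -> 0 <= x <= 1 ->
  cprim (fun t => c * f t) x = c * cprim f x.
Proof.
move=> /L2_intble[a b] x01; apply: complex_ext; rewrite ?ReM ?ImM /=.
  rewrite -!primZ // -primB //; try exact: intbleZ.
  by congr prim; apply/funext => t; rewrite ReM.
rewrite -!primZ // -primD //; try exact: intbleZ.
by congr prim; apply/funext => t; rewrite ImM.
Qed.

Lemma cprimB f g x : L2 f -> L2 g -> 0 <= x <= 1 ->
  cprim (fun t => f t - g t) x = cprim f x - cprim g x.
Proof.
move=> hf hg x01; rewrite -[- cprim g x]mulN1r -cprimZ // -cprimD //; last exact: L2Z.
by congr cprim; apply/funext => t; rewrite mulN1r.
Qed.

Lemma cprim_sqr_le h x : L2 h -> 0 <= x <= 1 -> normc (cprim h x) ^+ 2 <= sqnorm h.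
Proof.
move=> hh x01; have /L2P[a b] := hh.
by rewrite sqr_normcE sqnormE // lerD //; exact: prim_sqr_le.
Qed.

Lemma cprim_ae f g x : L2 f -> L2 g -> f = g %[ae mu in I01] -> 0 <= x <= 1 ->
  cprim f x = cprim g x.
Proof.
move=> /L2_intble[a b] /L2_intble[c d] fg x01; apply: complex_ext => /=.
  by apply: prim_ae => //; apply: ae_imp fg => t h It; rewrite /= h.
by apply: prim_ae => //; apply: ae_imp fg => t h It; rewrite /= h.
Qed.

Lemma cprim_inj f g : L2 f -> L2 g -> (forall x, 0 <= x <= 1 -> cprim f x = cprim g x) ->
  f = g %[ae mu in I01].
Proof.
move=> hf hg e; have [a b] := L2_intble (L2B hf hg).
have z x : 0 <= x <= 1 -> cprim (fun t => f t - g t) x = 0.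
  by move=> x01; rewrite cprimB // e // subrr.
have ra : (fun x => Re (f x - g x)) = (fun=> 0) %[ae mu in I01].
  by apply: prim_eq0 => // x /z/(congr1 (@Re R)).
have ia : (fun x => Im (f x - g x)) = (fun=> 0) %[ae mu in I01].
  by apply: prim_eq0 => // x /z/(congr1 (@Im R)).
apply: ae_imp2 ra ia => x h1 h2 Ix; apply/eqP; rewrite -subr_eq0; apply/eqP.
by apply: complex_ext; [exact: h1|exact: h2].
Qed.

Lemma ccontD f g : ccont f -> ccont g -> ccont (fun x => f x + g x).
Proof.
move=> [a b] [c d]; split.
  rewrite (_ : (fun x => _) = (fun x => Re (f x) + Re (g x))).
    by move=> x; apply: cvgD; [exact: a|exact: c].
  by apply/funext => x; rewrite ReD.
rewrite (_ : (fun x => _) = (fun x => Im (f x) + Im (g x))).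
  by move=> x; apply: cvgD; [exact: b|exact: d].
by apply/funext => x; rewrite ImD.
Qed.

Lemma ccontM f g : ccont f -> ccont g -> ccont (fun x => f x * g x).
Proof.
move=> [a b] [c d]; split.
  rewrite (_ : (fun x => _) = (fun x => Re (f x) * Re (g x) - Im (f x) * Im (g x))).
    by move=> x; apply: cvgB; apply: cvgM; [exact: a|exact: c|exact: b|exact: d].
  by apply/funext => x; rewrite ReM.
rewrite (_ : (fun x => _) = (fun x => Re (f x) * Im (g x) + Im (f x) * Re (g x))).
  by move=> x; apply: cvgD; apply: cvgM; [exact: a|exact: d|exact: b|exact: c].
by apply/funext => x; rewrite ImM.
Qed.

Lemma H1P f : H1 f <->
  exists2 h, L2 h & forall x, 0 <= x <= 1 -> f x = f 0 + cprim h x.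
Proof.
split => [[cr ci [h hh w]]|[h hh e]].
  by exists h => //; apply/(weak_derivP (conj cr ci) hh).
have cf : ccont f.
  have [pr pi] := ccontD (ccont_cst (f 0)) (cprim_ccont hh).
  have E (F : C -> R) : {within `[0, 1], continuous (fun x => F (f 0 + cprim h x))} ->
     {within `[0, 1], continuous (fun x => F (f x))}.
    move=> cE; apply: (subspace_eq_continuous _ cE) => x /set_mem; rewrite /= in_itv /= => x01.
    by rewrite /from_subspace (e x x01).
  by split; exact: E.
have [cr ci] := cf; split => //; exists h => //; exact/(weak_derivP cf hh).
Qed.

Lemma H1_ccont f : H1 f -> ccont f. Proof. by case. Qed.

Lemma wderivP f : H1 f -> L2 (wderiv f) /\ weak_deriv f (wderiv f).
Proof.
move=> [_ _ [h hh w]]; apply: (xgetPex (fun=> 0) (P := [set h | L2 h /\ weak_deriv f h])).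
by exists h.
Qed.

Lemma wderivE f x : H1 f -> 0 <= x <= 1 -> f x = f 0 + cprim (wderiv f) x.
Proof.
by move=> hf; have [l w] := wderivP hf; move/(weak_derivP (H1_ccont hf) l): w; apply.
Qed.

Lemma wderiv_ae f h : H1 f -> L2 h -> (forall x, 0 <= x <= 1 -> f x = f 0 + cprim h x) ->
  wderiv f = h %[ae mu in I01].
Proof.
move=> hf hh e; have [l _] := wderivP hf; apply: cprim_inj => // x x01.
by apply: (addrI (f 0)); rewrite -wderivE // e.
Qed.

Lemma sqnorm_wderiv f h : L2 h -> (forall x, 0 <= x <= 1 -> f x = f 0 + cprim h x) ->
  sqnorm (wderiv f) = sqnorm h.
Proof.
move=> hh e; have hf : H1 f by apply/H1P; exists h.
by apply: sqnorm_ae => //; [have [] := wderivP hf|exact: wderiv_ae].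
Qed.

End ComplexFunctions.

(** * The state space *)

Section StateSpace.
Context {R : realType} (m a alpha : R) (hm : 0 < m) (ha : 0 < a) (halpha : 0 < alpha).
Local Notation C := R[i].
Local Notation mu := (@lebesgue_measure R).
Local Notation I01 := (`]0%R, 1%R[%classic : set R).
Local Notation N := (normH m a alpha).
Implicit Types (u v : state R) (p q : R -> C).

Definition kappa : R := (m + alpha * a)^-1.

Lemma kappa_gt0 : 0 < kappa.
Proof. by rewrite invr_gt0 addr_gt0 // mulr_gt0. Qed.

Let kappa_ge0 : 0 <= kappa. Proof. exact/ltW/kappa_gt0. Qed.

(** Carrying a derivative [p] along avoids the choice made in [wderiv], which is
    linear almost everywhere only. *)
Definition state_rep u p : Prop :=
  [/\ L2 p, forall x, 0 <= x <= 1 -> u.1.1 x = cprim p x & L2 u.1.2].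

Lemma inHP u : inH u <-> exists p, state_rep u p.
Proof.
split => [[[hf f0] hg]|[p [hp e hg]]].
  exists (wderiv u.1.1); split => //; first by have [] := wderivP hf.
  by move=> x x01; rewrite (wderivE hf x01) f0 add0r.
have f0 : u.1.1 0 = 0 by rewrite e ?lexx ?ler01 // cprim0.
split => //; split => //; apply/H1P; exists p => // x x01.
by rewrite f0 add0r e.
Qed.

Lemma state_rep_inH u p : state_rep u p -> inH u.
Proof. by move=> h; apply/inHP; exists p. Qed.

Lemma normH_rep u p : state_rep u p ->
  N u ^+ 2 = sqnorm p + sqnorm u.1.2 + kappa * normc u.2 ^+ 2.
Proof.
move=> [hp e hg].
have f0 : u.1.1 0 = 0 by rewrite e ?lexx ?ler01 // cprim0.
have e' x : 0 <= x <= 1 -> u.1.1 x = u.1.1 0 + cprim p x by rewrite f0 add0r; exact: e.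
have hf : H1 u.1.1 by apply/H1P; exists p.
have [hw _] := wderivP hf.
have E : \int[mu]_(x in I01) (normc (wderiv u.1.1 x) ^+ 2 + normc (u.1.2 x) ^+ 2) =
    sqnorm p + sqnorm u.1.2.
  rewrite -(sqnorm_wderiv hp e'); apply: int01D; exact: sqnorm_intble.
have k0 := mulr_ge0 kappa_ge0 (sqr_ge0 (normc u.2)).
have s0 := sqnorm_ge0 p; have s1 := sqnorm_ge0 u.1.2.
by rewrite /normH E -/kappa sqr_sqrtr // !addr_ge0.
Qed.

Lemma state_repD u v p q : state_rep u p -> state_rep v q ->
  state_rep (u + v) (fun x => p x + q x).
Proof.
move=> [hp e hg] [hq e' hg']; split.
- exact: L2D.
- by move=> x x01; rewrite cprimD // -e // -e'.
- exact (L2D hg hg').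
Qed.

Lemma state_scale1 (k : C) u x : (k *: u).1.1 x = k * u.1.1 x.
Proof. by case: u => [[f g] e]; rewrite [LHS]/=; reflexivity. Qed.

Lemma state_scale2 (k : C) u : (k *: u).1.2 = (fun x => k * u.1.2 x).
Proof. by case: u => [[f g] e]; apply/funext => x; rewrite [LHS]/=; reflexivity. Qed.

Lemma state_repZ (k : C) u p : state_rep u p -> state_rep (k *: u) (fun x => k * p x).
Proof.
move=> [hp e hg]; split.
- exact: L2Z.
- by move=> x x01; rewrite state_scale1 cprimZ // -e.
- by rewrite state_scale2; exact: L2Z.
Qed.

Lemma state_repB u v p q : state_rep u p -> state_rep v q ->
  state_rep (u - v) (fun x => p x - q x).
Proof.
move=> [hp e hg] [hq e' hg']; split.
- exact: L2B.
- by move=> x x01; rewrite cprimB // -e // -e'.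
- exact (L2B hg hg').
Qed.

Lemma state_rep0 : state_rep 0 (fun=> 0).
Proof.
split; try exact: L2_0.
move=> x x01; have := cprimB L2_0 L2_0 x01; rewrite [RHS]subrr => E.
apply: etrans (esym E) _; congr (cprim _ x).
by apply/funext => t; rewrite subrr.
Qed.

Lemma normH_ge0 u : 0 <= N u. Proof. exact: sqrtr_ge0. Qed.

Lemma normH_seminormed : seminormed (inH (R := R)) N.
Proof.
split.
- exact: state_rep_inH state_rep0.
- by move=> u v /inHP[p hp] /inHP[q hq]; exact: state_rep_inH (state_repD hp hq).
- by move=> k u /inHP[p hp]; exact: state_rep_inH (state_repZ k hp).
- exact: normH_ge0.
- move=> u v /inHP[p hp] /inHP[q hq].
  have [hp1 _ hp2] := hp; have [hq1 _ hq2] := hq.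
  have u0 := normH_ge0 u; have v0 := normH_ge0 v.
  (* The best weight is N v / N u; the terms e / 2 below guard against a
     vanishing denominator. *)
  have bound t : 0 < t -> N (u + v) ^+ 2 <= (1 + t) * N u ^+ 2 + (1 + t^-1) * N v ^+ 2.
    move=> t0; rewrite (normH_rep (state_repD hp hq)) (normH_rep hp) (normH_rep hq).
    rewrite -[(u + v).1.2]/(fun x => u.1.2 x + v.1.2 x) -[(u + v).2]/(u.2 + v.2).
    have := sqnormD_le t0 hp1 hq1; have := sqnormD_le t0 hp2 hq2.
    have := ler_wpM2l kappa_ge0 (normc_sqrD_le u.2 v.2 t0).
    move: kappa (t^-1) (normc u.2 ^+ 2) (normc v.2 ^+ 2) => k s y z.
    lra.
  apply/ler_addgt0Pr => e e0; have e20 : 0 < e / 2 by rewrite divr_gt0.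
  have a0 : 0 < N u + e / 2 by rewrite ltr_wpDl.
  have b0 : 0 < N v + e / 2 by rewrite ltr_wpDl.
  rewrite -(ler_pXn2r (_ : 0 < 2)%N) ?nnegrE ?normH_ge0 ?addr_ge0 ?(ltW e0) //.
  apply: le_trans (bound ((N v + e / 2) / (N u + e / 2)) (divr_gt0 b0 a0)) _.
  rewrite invf_div; set x := N u + e / 2 in a0 *; set y := N v + e / 2 in b0 *.
  have -> : (N u + N v + e) ^+ 2 = (1 + y / x) * x ^+ 2 + (1 + x / y) * y ^+ 2.
    have -> : N u + N v + e = x + y by rewrite /x /y; lra.
    by field; rewrite !lt0r_neq0.
  apply: lerD; apply: ler_wpM2l.
  + by rewrite addr_ge0 // divr_ge0 ?ltW.
  + by rewrite ler_pXn2r ?nnegrE ?(ltW a0) // lerDl ltW.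
  + by rewrite addr_ge0 // divr_ge0 ?ltW.
  + by rewrite ler_pXn2r ?nnegrE ?(ltW b0) // lerDl ltW.
- move=> k u /inHP[p hp].
  apply/eqP; rewrite -(eqrXn2 (_ : 0 < 2)%N) ?normH_ge0 ?mulr_ge0 ?normH_ge0 ?normc_ge0 //.
  have [hp1 _ hp2] := hp.
  rewrite exprMn (normH_rep (state_repZ k hp)) (normH_rep hp) sqnormZ //.
  rewrite state_scale2 sqnormZ //.
  by rewrite -[(k *: u).2]/(k * u.2) normcM exprMn; apply/eqP; ring.
Qed.

Lemma normH_complete : seminorm_complete (inH (R := R)) N.
Proof.
move=> u hu cu; have /choice[p hp] : forall n, exists p, state_rep (u n) p.
  by move=> n; apply/inHP.
have Nij i j := normH_rep (state_repB (hp i) (hp j)).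
have small e : 0 < e -> exists n0, forall i j, (n0 <= i)%N -> (n0 <= j)%N ->
    N (u i - u j) ^+ 2 < e.
  move=> e0; have s0 : 0 < Num.sqrt e by rewrite sqrtr_gt0.
  have [n0 n0P] := cu _ s0; exists n0 => i j ii jj.
  by rewrite -[ltRHS]sqr_sqrtr ?(ltW e0) // ltr_pXn2r ?nnegrE ?normH_ge0 ?ltW ?n0P.
have [||P hP vP] := L2_complete (u := p).
- by move=> n; have [] := hp n.
- move=> e /small[n0 n0P]; exists n0 => i j ii jj.
  apply: le_lt_trans (n0P i j ii jj); rewrite Nij -addrA lerDl addr_ge0 ?sqnorm_ge0 //.
  by rewrite mulr_ge0 ?sqr_ge0.
have [||g hg vg] := L2_complete (u := fun n => (u n).1.2).
- by move=> n; have [] := hp n.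
- move=> e /small[n0 n0P]; exists n0 => i j ii jj.
  apply: le_lt_trans (n0P i j ii jj); rewrite Nij -addrA addrCA lerDl addr_ge0 ?sqnorm_ge0 //.
  by rewrite mulr_ge0 ?sqr_ge0.
have [|eta veta] := complex_cauchy_cvg (u := fun n => (u n).2).
  move=> e e0; have [|n0 n0P] := small (kappa * e ^+ 2).
    by rewrite mulr_gt0 ?kappa_gt0 ?exprn_gt0.
  exists n0 => i j ii jj.
  rewrite -(ltr_pXn2r (_ : 0 < 2)%N) ?nnegrE ?normc_ge0 ?(ltW e0) //.
  rewrite -(ltr_pM2l kappa_gt0); apply: le_lt_trans (n0P i j ii jj).
  by rewrite Nij lerDr addr_ge0 ?sqnorm_ge0.
have hx : state_rep (cprim P, g, eta) P by [].
exists (cprim P, g, eta); first exact: state_rep_inH hx.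
apply: vanish_sqr => [n|]; first exact: normH_ge0.
have veta2 : vanish (fun n => normc ((u n).2 - eta) ^+ 2).
  move=> e e0; have s0 : 0 < Num.sqrt e by rewrite sqrtr_gt0.
  have [n0 n0P] := veta _ s0; exists n0 => n /n0P nP.
  by rewrite -[ltRHS]sqr_sqrtr ?(ltW e0) // ltr_pXn2r ?nnegrE ?normc_ge0 ?ltW.
apply: (@vanish_le _ 0 _ _ _ (vanishD (vanishD vP vg) (vanishZ kappa_ge0 veta2))) => n _.
by rewrite (normH_rep (state_repB (hp n) hx)).
Qed.

Lemma normH_null u v : inH u -> inH v -> N (u - v) = 0 <-> eqH u v.
Proof.
move=> /inHP[p hp] /inHP[q hq]; have hd := normH_rep (state_repB hp hq).
have [hp1 ep hp2] := hp; have [hq1 eq hq2] := hq.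
have s1 := sqnorm_ge0 (fun x => p x - q x).
have s2 := sqnorm_ge0 (u - v).1.2.
have s3 : 0 <= kappa * normc (u - v).2 ^+ 2 by rewrite mulr_ge0 ?sqr_ge0.
split => [N0|[e1 e2 e3]].
  have : 0 = sqnorm (fun x => p x - q x) + sqnorm (u - v).1.2 + kappa * normc (u - v).2 ^+ 2.
    by rewrite -hd N0 expr0n.
  move=> E.
  have /(sqnorm_eq0 (L2B hp1 hq1)) p0 : sqnorm (fun x => p x - q x) <= 0 by lra.
  have /(sqnorm_eq0 (L2B hp2 hq2)) g0 : sqnorm (u - v).1.2 <= 0 by lra.
  have /eqP : kappa * normc (u - v).2 ^+ 2 = 0 by lra.
  rewrite mulf_eq0 (gt_eqF kappa_gt0) /= expf_eq0 /= normc_eq0 subr_eq0 => /eqP e3.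
  split => //.
  - move=> x; rewrite in_itv /= => x01; rewrite ep // eq //.
    apply: cprim_ae => //; apply: ae_imp p0 => t h It; apply/eqP.
    by rewrite -subr_eq0; apply/eqP; exact: h.
  - apply: ae_imp g0 => t h It; apply/eqP.
    by rewrite -subr_eq0; apply/eqP; exact: h.
have pq : p = q %[ae mu in I01].
  by apply: cprim_inj => // x x01; rewrite -ep // -eq // e1 // in_itv.
have z f g : L2 f -> L2 g -> f = g %[ae mu in I01] -> sqnorm (fun x => f x - g x) = 0.
  move=> hf hg fg; have -> : 0 = sqnorm (fun=> 0 : C).
    rewrite -[LHS]int01_cst; apply: int01_ext => x _.
    by rewrite normc0 expr0n.
  apply: sqnorm_ae; [exact: L2B|exact: L2_0|].
  by apply: ae_imp fg => t h It; rewrite h // subrr.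
have : N (u - v) ^+ 2 = 0.
  rewrite hd z // -[(u - v).1.2]/(fun x => u.1.2 x - v.1.2 x) z //.
  by rewrite -[(u - v).2]/(u.2 - v.2) e3 subrr normc0 expr0n mulr0 !addr0.
by move=> /eqP; rewrite expf_eq0 => /eqP.
Qed.

End StateSpace.

(** * The operator and its bounded inverse *)

(** The closure of the domain is a linear subspace. *)
Lemma relation_dense_span (R : realType) (V : lmodType R[i]) (H : set V) (N : V -> R)
    (G : V -> V -> Prop) (phi : nat -> V) :
  seminormed H N -> (forall u v, G u v -> H u /\ H v) ->
  (forall (k : R[i]) u v u' v', G u v -> G u' v' -> G (k *: u + u') (k *: v + v')) ->
  G 0 0 -> (forall n, H (phi n)) ->
  (forall x, H x -> forall eps : R, 0 < eps ->
     exists n (c : nat -> R[i]), N (x - \sum_(i < n) c i *: phi i) < eps) ->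
  (forall n e, 0 < e -> exists u v, G u v /\ N (phi n - u) < e) ->
  forall x, H x -> forall e, 0 < e -> exists u v, G u v /\ N (x - u) < e.
Proof.
move=> sH Gdom Glin G0 hphi dense app x hx e e0.
have e20 : 0 < e / 2 by rewrite divr_gt0.
have [n [c nc]] := dense x hx (e / 2) e20.
have hcomb k : H (\sum_(i < k) c i *: phi i).
  elim: k => [|k IH]; first by rewrite big_ord0; exact: (semi0 sH).
  by rewrite big_ord_recr; apply: (semiD sH) => //; exact: (semiZ sH).
suff [u [v [Guv uv]]] : exists u v, G u v /\ N (\sum_(i < n) c i *: phi i - u) < e / 2.
  exists u, v; split => //.
  have hu := (Gdom _ _ Guv).1.
  have -> : x - u = (x - \sum_(i < n) c i *: phi i) + (\sum_(i < n) c i *: phi i - u).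
    by rewrite addrA subrK.
  have := seminormD sH (semiB sH hx (hcomb n)) (semiB sH (hcomb n) hu).
  by move: nc uv; move: (N _) (N _) (N _) => p q r; lra.
elim: n (e / 2) e20 {nc} => [|n IH] d d0.
  exists 0, 0; split => //.
  rewrite big_ord0 subr0 -[X in N X](scale0r (0 : V)) (seminormZ sH); last exact: (semi0 sH).
  by rewrite normc0 mul0r.
have d20 : 0 < d / 2 by rewrite divr_gt0.
have [u [v [Guv uv]]] := IH _ d20.
have k0 : 0 < 1 + normc (c n) by rewrite ltr_pwDl ?normc_ge0.
have [u' [v' [Guv' uv']]] := app n (d / 2 / (1 + normc (c n))) (divr_gt0 d20 k0).
exists (c n *: u' + u), (c n *: v' + v); split; first exact: Glin.
rewrite big_ord_recr /=; have hS := hcomb n; set S := \sum_(i < n) _ in uv hS *.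
have h1 := semiB sH (hphi n) (Gdom _ _ Guv').1; have h2 := semiB sH hS (Gdom _ _ Guv).1.
have -> : S + c n *: phi n - (c n *: u' + u) = c n *: (phi n - u') + (S - u).
  by rewrite scalerBr opprD [S + c n *: phi n]addrC addrACA.
apply: le_lt_trans (seminormD sH (semiZ sH (c n) h1) h2) _.
rewrite (seminormZ sH) //.
have : normc (c n) * N (phi n - u') <= d / 2.
  have n0 := seminorm_ge0 sH (phi n - u'); have c0 := normc_ge0 (c n).
  move: uv'; rewrite ltr_pdivlMr // => uv'; move: (d / 2) uv' => d2 uv'; nra.
by lra.
Qed.

Section InverseOperator.
Context {R : realType} (m a alpha : R) (hm : 0 < m) (ha : 0 < a) (halpha : 0 < alpha).
Local Notation C := R[i].
Local Notation mu := (@lebesgue_measure R).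
Local Notation I01 := (`]0%R, 1%R[%classic : set R).
Local Notation N := (normH m a alpha).
Local Notation G := (graphA m a alpha).
Implicit Types (u v : state R) (p q : R -> C).

Let in1 : 0 <= (1 : R) <= 1. Proof. by rewrite ler01 lexx. Qed.
Let in0 : 0 <= (0 : R) <= 1. Proof. by rewrite ler01 lexx. Qed.

Let affine_ccont (c : C) h : L2 h -> ccont (fun x => c + cprim h x).
Proof. by move=> hh; apply: ccontD; [exact: ccont_cst|exact: cprim_ccont]. Qed.

Let pointwise_ae (f g : R -> C) : (forall x : R, 0 <= x <= 1 -> f x = g x) ->
  f = g %[ae mu in I01].
Proof.
move=> e; apply: aeW => x; rewrite /= in_itv /= => /andP[x0 x1].
by apply: e; rewrite !ltW.
Qed.

(** [A u = v] amounts to integrating [v] twice, the constant [c] being the value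
    at the left end of the derivative of the first component of [u]. *)
Lemma graphAP u v : G u v <-> inH v /\ exists c : C,
  [/\ L2 u.1.2, u.1.2 = v.1.1 %[ae mu in I01],
      forall x, 0 <= x <= 1 -> u.1.1 x = cprim (fun t => c + cprim v.1.2 t) x,
      u.2 = m%:C * v.1.1 1 + a%:C * (c + cprim v.1.2 1) &
      v.2 = - (c + cprim v.1.2 1) - alpha%:C * v.1.1 1].
Proof.
split => [[hv [g [p [[hu [hf _] [hg ug] [hp wp] eu] [vg wv ev]]]]]|].
  have [[hv1 hv10] hv2] := hv; have [_ hu2] := hu.
  have cp := H1_ccont hp.
  have pE x : 0 <= x <= 1 -> p x = p 0 + cprim v.1.2 x.
    by move/(weak_derivP cp hv2): wv; apply.
  have vg1 x : 0 <= x <= 1 -> v.1.1 x = g x by move=> x01; apply: vg; rewrite in_itv.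
  split => //; exists (p 0); split => //.
  - apply: ae_imp2 ug (pointwise_ae vg1) => x e1 e2 Ix.
    by rewrite (e1 Ix) (e2 Ix).
  - move=> x x01; have [hf1 hf0] := hf.
    move/(weak_derivP (H1_ccont hf1) (ccont_L2 cp)): wp => /(_ x x01) ->.
    rewrite hf0 add0r; apply: cprim_ae => //; first exact: ccont_L2.
      exact/ccont_L2/affine_ccont.
    exact: pointwise_ae.
  - by rewrite -(pE 1 in1) vg1.
  - by rewrite -(pE 1 in1) vg1.
move=> [hv [c [hu2 ug fE eu ev]]]; split => //.
have [[hv1 hv10] hv2] := hv.
pose p := fun t => c + cprim v.1.2 t; exists v.1.1, p.
have cp : ccont p by exact: affine_ccont.
have p0 : p 0 = c by rewrite /p cprim0 addr0.
have hp : H1 p by apply/H1P; exists v.1.2 => // x _; rewrite p0.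
have f0 : u.1.1 0 = 0 by rewrite fE // cprim0.
have fE' x : 0 <= x <= 1 -> u.1.1 x = u.1.1 0 + cprim p x by move=> x01; rewrite f0 add0r fE.
have hf : H1 u.1.1 by apply/H1P; exists p => //; exact: ccont_L2.
have wf : weak_deriv u.1.1 p by apply/(weak_derivP (H1_ccont hf) (ccont_L2 cp)).
split; last first.
  split => //; apply/(weak_derivP cp hv2) => x _; by rewrite p0.
split => //.
by split => //; split => //; exists p.
Qed.

Let lin11 (k : C) u v : (k *: u + v).1.1 = (fun x => k * u.1.1 x + v.1.1 x).
Proof.
case: u => [[f g] e]; case: v => [[f' g'] e'].
by apply/funext => x; rewrite [LHS]/=; reflexivity.
Qed.

Let lin12 (k : C) u v : (k *: u + v).1.2 = (fun x => k * u.1.2 x + v.1.2 x).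
Proof.
case: u => [[f g] e]; case: v => [[f' g'] e'].
by apply/funext => x; rewrite [LHS]/=; reflexivity.
Qed.

Let lin2 (k : C) u v : (k *: u + v).2 = k * u.2 + v.2.
Proof. by case: u => [[? ?] ?]; case: v => [[? ?] ?]. Qed.

Lemma graphA_inH u v : G u v -> inH u /\ inH v.
Proof. by move=> [hv [g [p [[hu _ _ _ _] _]]]]. Qed.

Lemma graphA_lin (k : C) u v u' v' : G u v -> G u' v' -> G (k *: u + u') (k *: v + v').
Proof.
move=> /graphAP[hv [c [h1 h2 h3 h4 h5]]] /graphAP[hv' [c' [h1' h2' h3' h4' h5']]].
apply/graphAP; have sH := normH_seminormed hm ha halpha.
have [[_ _] g1] := hv; have [[_ _] g2] := hv'.
have hkv : inH (k *: v + v') by apply: (semiD sH) => //; exact: (semiZ sH).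
split => //; exists (k * c + c'); rewrite !lin11 !lin12 !lin2 {hkv}.
have cE x : 0 <= x <= 1 ->
    cprim (fun t => k * v.1.2 t + v'.1.2 t) x = k * cprim v.1.2 x + cprim v'.1.2 x.
  by move=> x01; rewrite -cprimZ // -cprimD //; exact: L2Z.
split.
- by apply: L2D h1'; exact: L2Z.
- apply: ae_imp2 h2 h2' => x e1 e2 Ix.
  by rewrite (e1 Ix) (e2 Ix).
- move=> x x01; have L := ccont_L2 (affine_ccont c g1); have L' := ccont_L2 (affine_ccont c' g2).
  have Lk := L2Z k L; have e1 := cprimZ k L x01; have e2 := cprimD Lk L' x01.
  apply: etrans (congr2 (fun s t => k * s + t) (h3 x x01) (h3' x x01)) _.
  apply: etrans (congr1 (fun s => s + _) (esym e1)) _.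
  apply: etrans (esym e2) _; apply: cprim_ae x01.
  + exact: L2D Lk L'.
  + by apply/ccont_L2/affine_ccont; apply: L2D g2; exact: L2Z.
  + by apply: pointwise_ae => t t01; rewrite cE //; ring.
- by rewrite cE // h4 h4'; ring.
- by rewrite cE // h5 h5'; ring.
Qed.

Lemma graphA_surj v : inH v -> exists u, G u v.
Proof.
move=> hv; have [[hv1 _] hv2] := hv.
pose c := - v.2 - alpha%:C * v.1.1 1 - cprim v.1.2 1.
exists (cprim (fun t => c + cprim v.1.2 t), v.1.1, m%:C * v.1.1 1 + a%:C * (c + cprim v.1.2 1)).
apply/graphAP; split => //; exists c; split => //.
- exact/ccont_L2/H1_ccont.
- exact: pointwise_ae.
- by rewrite /c; ring.
Qed.

Lemma graphA_null u v u' : G u v -> inH u' -> N (u - u') = 0 -> G u' v.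
Proof.
move=> Gu hu' N0; have [hu _] := graphA_inH Gu.
move: N0 => /(normH_null hm ha halpha hu hu')[e1 e2 e3].
move: Gu => /graphAP[hv [c [h1 h2 h3 h4 h5]]]; apply/graphAP.
split => //; exists c; split => //.
- by have [] := hu'.
- by apply: ae_imp2 e2 h2 => x i1 i2 Ix; rewrite -(i1 Ix) (i2 Ix).
- by move=> x x01; rewrite -e1 ?in_itv // h3.
- by rewrite -e3.
Qed.

Lemma sqnorm_le_cst (f : R -> C) (B : R) : ccont f ->
  (forall x, 0 <= x <= 1 -> normc (f x) ^+ 2 <= B) -> sqnorm f <= B.
Proof.
move=> cf fB; rewrite -[B]int01_cst; apply: int01_le.
- exact/sqnorm_intble/ccont_L2.
- exact: intble_cst.
- by move=> x; rewrite /= in_itv /= => /andP[x0 x1]; apply: fB; rewrite !ltW.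
Qed.

Let normc_sqrB_le (x y : C) : normc (x - y) ^+ 2 <= 2 * normc x ^+ 2 + 2 * normc y ^+ 2.
Proof. by have := normc_sqrD_le x (- y) ltr01; rewrite normcN' invr1. Qed.

Let normc_sqrD2_le (x y : C) : normc (x + y) ^+ 2 <= 2 * normc x ^+ 2 + 2 * normc y ^+ 2.
Proof. by have := normc_sqrD_le x y ltr01; rewrite invr1. Qed.

Lemma graphA_bound : exists2 K, 0 <= K & forall u v, G u v -> N u <= K * N v.
Proof.
pose k := kappa m a alpha; have k0 : 0 < k by exact: kappa_gt0.
pose B := 2 / k + 2 * alpha ^+ 2; pose K2 := 2 * B + 8 + 1 + k * (2 * m ^+ 2 + 2 * a ^+ 2 * B).
have B0 : 0 <= B.
  by have := divr_ge0 (ler0n R 2) (ltW k0); have := sqr_ge0 alpha; rewrite /B; lra.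
have K20 : 0 <= K2.
  have := mulr_ge0 (sqr_ge0 a) B0; have := sqr_ge0 m; move=> m2 a2.
  have /(mulr_ge0 (ltW k0)) : 0 <= 2 * m ^+ 2 + 2 * a ^+ 2 * B by lra.
  by rewrite /K2; lra.
exists (Num.sqrt K2); first exact: sqrtr_ge0.
move=> u v /graphAP[hv [c [h1 h2 h3 h4 h5]]].
rewrite -(ler_pXn2r (_ : 0 < 2)%N) ?nnegrE ?mulr_ge0 ?normH_ge0 ?sqrtr_ge0 //.
rewrite exprMn (sqr_sqrtr K20).
have /inHP[q hq] := hv; have [hq1 hq2 hq3] := hq.
set V := N v ^+ 2; have VE : V = _ := normH_rep hm ha halpha hq; rewrite -/k in VE.
have sq0 := sqnorm_ge0 q; have sg0 := sqnorm_ge0 v.1.2.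
have se0 : 0 <= k * normc v.2 ^+ 2 by rewrite mulr_ge0 ?sqr_ge0 ?ltW.
have vle x : 0 <= x <= 1 -> normc (v.1.1 x) ^+ 2 <= V.
  by move=> x01; rewrite hq2 //; have := cprim_sqr_le hq1 x01; lra.
have gle x : 0 <= x <= 1 -> normc (cprim v.1.2 x) ^+ 2 <= V.
  by move=> x01; have := cprim_sqr_le hq3 x01; lra.
have ele : normc v.2 ^+ 2 <= V / k.
  by rewrite ler_pdivlMr // mulrC; lra.
pose p t := c + cprim v.1.2 t; have cp : ccont p by exact: affine_ccont.
have p1E : normc (p 1) ^+ 2 <= B * V.
  have -> : p 1 = - v.2 - alpha%:C * v.1.1 1 by rewrite h5 /p; ring.
  have := normc_sqrB_le (- v.2) (alpha%:C * v.1.1 1); rewrite normcN' normcM normcR exprMn.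
  rewrite real_normK ?num_real // => h.
  have h' := ler_wpM2l (sqr_ge0 alpha) (vle 1 in1).
  have -> : B * V = 2 * (V / k) + 2 * (alpha ^+ 2 * V) by rewrite /B; ring.
  by apply: le_trans h _; lra.
have ple x : 0 <= x <= 1 -> normc (p x) ^+ 2 <= (2 * B + 8) * V.
  move=> x01; have -> : p x = p 1 + (cprim v.1.2 x - cprim v.1.2 1) by rewrite /p; ring.
  have := normc_sqrD2_le (p 1) (cprim v.1.2 x - cprim v.1.2 1).
  have := normc_sqrB_le (cprim v.1.2 x) (cprim v.1.2 1).
  have := gle x x01; have := gle 1 in1; lra.
have hu : state_rep u p by split => //; exact: ccont_L2.
rewrite (normH_rep hm ha halpha hu) -/k.
have s1 : sqnorm p <= (2 * B + 8) * V by exact: sqnorm_le_cst.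
have [[hv1 _] _] := hv; have cv := H1_ccont hv1.
have s2 : sqnorm u.1.2 <= V.
  by rewrite (sqnorm_ae h1 (ccont_L2 cv) h2); exact: sqnorm_le_cst.
have s3 : normc u.2 ^+ 2 <= (2 * m ^+ 2 + 2 * a ^+ 2 * B) * V.
  rewrite h4; apply: le_trans (normc_sqrD2_le _ _) _.
  rewrite !normcM !normcR !exprMn !real_normK ?num_real //.
  have := ler_wpM2l (sqr_ge0 m) (vle 1 in1); have := ler_wpM2l (sqr_ge0 a) p1E.
  rewrite -/(p 1); lra.
have := ler_wpM2l (ltW k0) s3; rewrite /K2; lra.
Qed.

Lemma graphA_dense_span (phi : nat -> state R) : riesz_basis (inH (R := R)) N phi ->
  (forall n e, 0 < e -> exists u v, G u v /\ N (phi n - u) < e) ->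
  forall x, inH x -> forall e, 0 < e -> exists u v, G u v /\ N (x - u) < e.
Proof.
move=> [hphi dense _]; apply: (relation_dense_span (normH_seminormed hm ha halpha)) => //.
- exact: graphA_inH.
- exact: graphA_lin.
- have [u Gu] := graphA_surj (semi0 (normH_seminormed hm ha halpha)).
  by have := graphA_lin (-1) Gu Gu; rewrite !scaleN1r !addNr.
Qed.

End InverseOperator.

(** * Hyperbolic functions and the eigenvectors *)

Section Hyperbolic.
Context {R : realType}.
Local Notation C := R[i].
Local Notation mu := (@lebesgue_measure R).
Local Notation I01 := (`]0%R, 1%R[%classic : set R).
Implicit Types (z w : C) (x : R).

Let in1 : 0 <= (1 : R) <= 1. Proof. by rewrite ler01 lexx. Qed.

Lemma prim_ftc (F f : R -> R) x : (forall y : R, is_derive y 1 F (f y)) -> continuous f ->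
  0 <= x -> prim f x = F x - F 0.
Proof.
move=> d cf; rewrite le_eqVlt => /predU1P[<-|x0]; first by rewrite prim0 subrr.
have cF : continuous F.
  by move=> y; apply: differentiable_continuous; apply/derivable1_diffP; have [] := d y.
rewrite /prim /Rintegral (continuous_FTC2 (F := F) x0) //.
- exact: continuous_subspaceT.
- split => [y _||]; first by have [] := d y.
    by apply: cvg_at_right_filter; exact: cF.
  by apply: cvg_at_left_filter; exact: cF.
- by move=> y _; rewrite derive1E; have [] := d y.
Qed.

Definition cderiv (F f : R -> C) : Prop := forall x,
  is_derive x 1 (fun y => Re (F y)) (Re (f x)) /\ is_derive x 1 (fun y => Im (F y)) (Im (f x)).

Definition ccontinuous (f : R -> C) : Prop :=
  continuous (fun y => Re (f y)) /\ continuous (fun y => Im (f y)).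

Lemma ccontinuous_ccont f : ccontinuous f -> ccont f.
Proof. by move=> [a b]; split; exact: continuous_subspaceT. Qed.

Lemma cderiv_ccontinuous F f : cderiv F f -> ccontinuous F.
Proof.
move=> d; split => x; apply: differentiable_continuous; apply/derivable1_diffP.
  by have [[]] := d x.
by have [_ []] := d x.
Qed.

Lemma cderivZ w F f : cderiv F f -> cderiv (fun x => w * F x) (fun x => w * f x).
Proof.
move=> d x; have [dr di] := d x; split.
  rewrite ReM (_ : (fun y => _) = Re w *: (fun y => Re (F y)) - Im w *: (fun y => Im (F y))).
    exact: is_deriveB (is_deriveZ (Re w) dr) (is_deriveZ (Im w) di).
  by apply/funext => y; rewrite ReM.
rewrite ImM (_ : (fun y => _) = Re w *: (fun y => Im (F y)) + Im w *: (fun y => Re (F y))).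
  exact: is_deriveD (is_deriveZ (Re w) di) (is_deriveZ (Im w) dr).
by apply/funext => y; rewrite ImM.
Qed.

Lemma cderivD F f G g : cderiv F f -> cderiv G g ->
  cderiv (fun x => F x + G x) (fun x => f x + g x).
Proof.
move=> d d' x; have [dr di] := d x; have [dr' di'] := d' x; split.
  rewrite ReD (_ : (fun y => _) = (fun y => Re (F y)) + (fun y => Re (G y))).
    exact: is_deriveD dr dr'.
  by apply/funext => y; rewrite ReD.
rewrite ImD (_ : (fun y => _) = (fun y => Im (F y)) + (fun y => Im (G y))).
  exact: is_deriveD di di'.
by apply/funext => y; rewrite ImD.
Qed.

Lemma cprim_ftc F f x : cderiv F f -> ccontinuous f -> 0 <= x -> cprim f x = F x - F 0.
Proof.
move=> d [cr ci] x0; apply: complex_ext => /=; rewrite ?ReD ?ReN ?ImD ?ImN.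
  by apply: (prim_ftc (F := fun y => Re (F y))) => // y; have [] := d y.
by apply: (prim_ftc (F := fun y => Im (F y))) => // y; have [] := d y.
Qed.

Definition cexpf z x : C := cexp (z * x%:C).

Lemma ReMr z x : Re (z * x%:C) = Re z * x. Proof. by rewrite ReM /= mulr0 subr0. Qed.
Lemma ImMr z x : Im (z * x%:C) = Im z * x. Proof. by rewrite ImM /= mulr0 add0r. Qed.

Let mul_derive (c x : R) : is_derive x 1 (fun y : R => c * y) c.
Proof.
have h : is_derive x 1 (c *: (@idfun R)) (c *: 1) by apply: is_deriveZ.
by rewrite /GRing.scale /= mulr1 in h.
Qed.

Lemma cexpf_deriv z : cderiv (cexpf z) (fun x => z * cexpf z x).
Proof.
move=> x; have e := is_derive1_comp (is_derive_expR (Re z * x)) (mul_derive (Re z) x).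
have c := is_derive1_comp (is_derive_cos (Im z * x)) (mul_derive (Im z) x).
have s := is_derive1_comp (is_derive_sin (Im z * x)) (mul_derive (Im z) x).
have reE y : Re (cexpf z y) = expR (Re z * y) * cos (Im z * y).
  by rewrite -ReMr -ImMr.
have imE y : Im (cexpf z y) = expR (Re z * y) * sin (Im z * y).
  by rewrite -ReMr -ImMr.
split.
  rewrite ReM reE imE (_ : (fun y => _) = (expR \o (fun y => Re z * y)) * (cos \o (fun y => Im z * y))).
    by apply: (is_derive_eq (is_deriveM e c)); rewrite /GRing.scale /=; ring.
  by apply/funext => y; exact: reE.
rewrite ImM reE imE (_ : (fun y => _) = (expR \o (fun y => Re z * y)) * (sin \o (fun y => Im z * y))).
  by apply: (is_derive_eq (is_deriveM e s)); rewrite /GRing.scale /=; ring.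
by apply/funext => y; exact: imE.
Qed.

Lemma cexpf_continuous z : ccontinuous (cexpf z).
Proof. exact: cderiv_ccontinuous (cexpf_deriv z). Qed.

Lemma cexpf0 z : cexpf z 0 = 1. Proof. by rewrite /cexpf mulr0 cexp0. Qed.

Definition cosh z x : C := (cexpf z x + cexpf (- z) x) / 2.
Definition sinh z x : C := (cexpf z x - cexpf (- z) x) / 2.

Lemma cosh0 z : cosh z 0 = 1. Proof. by rewrite /cosh !cexpf0; field. Qed.
Lemma sinh0 z : sinh z 0 = 0. Proof. by rewrite /sinh !cexpf0 subrr mul0r. Qed.

Lemma coshDsinh z x : cosh z x + sinh z x = cexpf z x.
Proof. by rewrite /cosh /sinh; field. Qed.

Lemma coshBsinh z x : cosh z x - sinh z x = cexpf (- z) x.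
Proof. by rewrite /cosh /sinh; field. Qed.

Lemma cosh_deriv z : cderiv (cosh z) (fun x => z * sinh z x).
Proof.
have := cderivD (cderivZ 2^-1 (cexpf_deriv z)) (cderivZ 2^-1 (cexpf_deriv (- z))).
by congr cderiv; apply/funext => x; rewrite /cosh /sinh; field.
Qed.

Lemma sinh_deriv z : cderiv (sinh z) (fun x => z * cosh z x).
Proof.
have := cderivD (cderivZ 2^-1 (cexpf_deriv z)) (cderivZ (- 2^-1) (cexpf_deriv (- z))).
by congr cderiv; apply/funext => x; rewrite /cosh /sinh; field.
Qed.

Lemma cosh_ccont z : ccont (cosh z).
Proof. exact: ccontinuous_ccont (cderiv_ccontinuous (cosh_deriv z)). Qed.

Lemma sinh_ccont z : ccont (sinh z).
Proof. exact: ccontinuous_ccont (cderiv_ccontinuous (sinh_deriv z)). Qed.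

Lemma cprim_cosh z x : z != 0 -> 0 <= x -> cprim (cosh z) x = sinh z x / z.
Proof.
move=> z0 x0; have d := cderivZ z^-1 (sinh_deriv z).
have e : (fun x => z^-1 * (z * cosh z x)) = cosh z by apply/funext => y; rewrite mulKf.
rewrite e in d; rewrite (cprim_ftc d) //; last exact: cderiv_ccontinuous (cosh_deriv z).
by rewrite sinh0 mulr0 subr0 mulrC.
Qed.

Lemma cprim_sinh z x : 0 <= x <= 1 -> cprim (fun t => z * sinh z t) x = cosh z x - 1.
Proof.
move=> /andP[x0 x1]; rewrite (cprim_ftc (cosh_deriv z)) ?cosh0 //.
have := cderiv_ccontinuous (cderivZ z (sinh_deriv z)); exact.
Qed.

Lemma prim_abs_mono (h g : R -> R) x : intble h -> intble g ->
  (forall t, 0 <= t <= 1 -> `|h t| <= g t) -> 0 <= x <= 1 -> `|prim h x| <= prim g x.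
Proof.
move=> hh hg hle x01; rewrite !primE //.
apply: le_trans (int01_abs (intble_cut x hh)) _.
apply: int01_le; [exact/intble_abs/intble_cut|exact: intble_cut|].
move=> t; rewrite /= in_itv /= => /andP[t0 t1]; rewrite normrM.
have ht : `|h t| <= g t by apply: hle; rewrite !ltW.
by case: (t <= x); rewrite ?normr1 ?mulr1 // normr0 !mulr0.
Qed.

(** Gronwall's argument: an estimate by a multiple of [expR (L * x)] with [L] large
    enough improves by the factor [1 / 2] under the integral equation. *)
Lemma volterra_eq0 z y : ccont y ->
  (forall x, 0 <= x <= 1 -> y x = cprim (fun t => z * y t) x) ->
  forall x, 0 <= x <= 1 -> y x = 0.
Proof.
move=> cy yE.
pose K := normc z + 1; have K0 : 0 < K by rewrite ltr_wpDl ?normc_ge0.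
pose L := 4 * K; have L0 : 0 < L by rewrite mulr_gt0.
have eL : continuous (fun x : R => expR (L * x)).
  move=> x; apply: continuous_comp; last exact: continuous_expR.
  by apply: cvgM; [exact: cvg_cst|exact: cvg_id].
have eI (B : R) : intble (fun x => B * expR (L * x)).
  by apply/intbleZ/sqint_intble/continuous_sqint/continuous_subspaceT.
have eP x : 0 <= x <= 1 -> prim (fun x => expR (L * x)) x <= L^-1 * expR (L * x).
  move=> /andP[x0 _].
  have d (t : R) : is_derive t 1 (fun x => L^-1 * expR (L * x)) (expR (L * t)).
    have h := is_deriveZ L^-1 (is_derive1_comp (is_derive_expR (L * t)) (mul_derive L t)).
    by apply: (is_derive_eq h); rewrite /GRing.scale /= mulrCA mulVf ?mulr1 ?lt0r_neq0.
  rewrite (prim_ftc d eL x0).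
  by rewrite lerBlDr lerDl mulr_ge0 ?invr_ge0 ?expR_ge0 ?ltW.
have [zr zi] := L2_intble (L2Z z (ccont_L2 cy)).
have step B : 0 <= B -> (forall x, 0 <= x <= 1 -> normc (y x) <= B * expR (L * x)) ->
    forall x, 0 <= x <= 1 -> normc (y x) <= B / 2 * expR (L * x).
  move=> B0 yB x x01; rewrite yE //; apply: le_trans (normc_le_ReIm _) _.
  have zyB t : 0 <= t <= 1 -> normc (z * y t) <= K * B * expR (L * t).
    move=> t01; rewrite normcM -mulrA ler_pM ?normc_ge0 ?yB //.
    by rewrite /K lerDl.
  have KB := eI (K * B).
  have h1 := prim_abs_mono zr KB (fun t t01 => le_trans (normc_Re _) (zyB t t01)) x01.
  have h2 := prim_abs_mono zi KB (fun t t01 => le_trans (normc_Im _) (zyB t t01)) x01.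
  have E : prim (fun t => K * B * expR (L * t)) x <= B / 4 * expR (L * x).
    rewrite primZ //; last by have := eI 1; under eq_fun do rewrite mul1r.
    have := ler_wpM2l (mulr_ge0 (ltW K0) B0) (eP x x01).
    have -> : K * B * (L^-1 * expR (L * x)) = B / 4 * expR (L * x) by rewrite /L; field; lra.
    by [].
  have -> : B / 2 * expR (L * x) = B / 4 * expR (L * x) + B / 4 * expR (L * x) by field.
  by apply: lerD; [exact: le_trans h1 E|exact: le_trans h2 E].
have [[_ [M1 M10 hM1]] [_ [M2 M20 hM2]]] := (continuous_I01 cy.1, continuous_I01 cy.2).
have yM x : 0 <= x <= 1 -> normc (y x) <= (M1 + M2) * expR (L * x).
  move=> x01; have e1 : 1 <= expR (L * x).
    by have /andP[x0 _] := x01; rewrite -expR0 ler_expR mulr_ge0 // ltW.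
  apply: le_trans (normc_le_ReIm _) _; have i01 : x \in `[0, 1] by rewrite in_itv.
  apply: le_trans (lerD (hM1 x i01) (hM2 x i01)) _.
  by rewrite ler_peMr // addr_ge0.
have M0 : 0 <= M1 + M2 by rewrite addr_ge0.
have yn n x : 0 <= x <= 1 -> normc (y x) <= (M1 + M2) * (1 / 2) ^+ n * expR (L * x).
  elim: n x => [|n IH] x x01; first by rewrite expr0 mulr1 yM.
  have q0 : 0 <= (M1 + M2) * (1 / 2 : R) ^+ n by rewrite mulr_ge0 // exprn_ge0.
  by have := step _ q0 IH x x01; rewrite exprSr mul1r mulrA.
move=> x x01; apply/eqP; rewrite -normc_eq0 eq_le normc_ge0 andbT.
have q1 : 0 <= (1 / 2 : R) < 1 by lra.
apply: vanish_cst; apply: (@vanish_le _ 0 _ _ _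
  (vanishZ (mulr_ge0 M0 (expR_ge0 (L * x))) (vanish_expr q1))) => n _.
by have := yn n x x01; rewrite mulrAC.
Qed.

(** This is the Cauchy problem for [y' = z y], integrated once. *)
Lemma exponential_unique z (c : C) y : ccont y ->
  (forall x, 0 <= x <= 1 -> y x = c + cprim (fun t => z * y t) x) ->
  forall x, 0 <= x <= 1 -> y x = c * cexpf z x.
Proof.
move=> cy yE x x01; apply/eqP; rewrite -subr_eq0; apply/eqP.
have ce := ccontinuous_ccont (cexpf_continuous z).
have cz : ccont (fun t => y t + - c * cexpf z t).
  by apply: ccontD => //; apply: ccontM => //; exact: ccont_cst.
rewrite -mulNr; apply: (volterra_eq0 cz (z := z)) x01 => t t01.
have l1 := L2Z z (ccont_L2 cy).
have l2 := L2Z (- c) (L2Z z (ccont_L2 ce)).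
have -> : (fun s => z * (y s + - c * cexpf z s)) =
   (fun s => z * y s + - c * (z * cexpf z s)) by apply/funext => s; ring.
rewrite (cprimD l1 l2 t01) (cprimZ (- c) (L2Z z (ccont_L2 ce)) t01).
have /andP[t0 _] := t01.
rewrite (cprim_ftc (cexpf_deriv z)) //; last first.
  exact: cderiv_ccontinuous (cderivZ z (cexpf_deriv z)).
by rewrite yE // cexpf0; ring.
Qed.

End Hyperbolic.

Section Eigenvectors.
Context {R : realType} (m a alpha : R) (hm : 0 < m) (ha : 0 < a) (halpha : 0 < alpha).
Local Notation C := R[i].
Local Notation mu := (@lebesgue_measure R).
Local Notation I01 := (`]0%R, 1%R[%classic : set R).
Local Notation G := (graphA m a alpha).
Implicit Types (z : C) (u v : state R).

Let in1 : 0 <= (1 : R) <= 1. Proof. by rewrite ler01 lexx. Qed.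

Let cprim_zero (x : R) : 0 <= x <= 1 -> cprim (fun=> 0) x = 0.
Proof. by move=> x01; have [_ h _] := @state_rep0 R; rewrite -h. Qed.

(** The first two components of an eigenvector for [z]; the third is left free,
    being 0 in the reference basis. *)
Definition hyp_state (z eta : C) : state R := (fun x => sinh z x / z, sinh z, eta).

(** The third component that puts this vector into the domain. *)
Definition bdry_value z : C := m%:C * sinh z 1 + a%:C * cosh z 1.

Lemma hyp_state_rep z eta : z != 0 -> state_rep (hyp_state z eta) (cosh z).
Proof.
move=> z0; split; [exact/ccont_L2/cosh_ccont| |exact/ccont_L2/sinh_ccont].
by move=> x /andP[x0 _]; rewrite cprim_cosh.
Qed.

Let image z : state R := (sinh z, fun x => z * sinh z x, - cosh z 1 - alpha%:C * sinh z 1).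

Let image_inH z : inH (image z).
Proof.
apply: (@state_rep_inH _ _ (fun x => z * cosh z x)); split.
- exact (L2Z z (ccont_L2 (cosh_ccont z))).
- move=> x /andP[x0 _]; rewrite (cprim_ftc (sinh_deriv z)) ?sinh0 ?subr0 //.
  exact: cderiv_ccontinuous (cderivZ z (cosh_deriv z)).
- exact (L2Z z (ccont_L2 (sinh_ccont z))).
Qed.

Let hyp_state_image z : z != 0 -> G (hyp_state z (bdry_value z)) (image z).
Proof.
move=> z0; apply/(graphAP m a alpha); split; first exact: image_inH.
exists 1; have pE (x : R) : 0 <= x <= 1 -> 1 + cprim (fun t => z * sinh z t) x = cosh z x.
  by move=> x01; rewrite cprim_sinh //; ring.
have [hc he hs] := hyp_state_rep (bdry_value z) z0; split => //.
- exact: aeW.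
- move=> x x01; rewrite he //; apply: cprim_ae => //.
    by apply/ccont_L2/ccontD; [exact: ccont_cst|apply: cprim_ccont; have [] := image_inH z].
  by apply: aeW => t; rewrite /= in_itv /= => /andP[t0 t1]; rewrite pE // !ltW.
- by rewrite [in RHS]/= pE.
- by rewrite [in RHS]/= pE.
Qed.

Lemma hyp_state_dom z : z != 0 -> exists v, G (hyp_state z (bdry_value z)) v.
Proof. by move=> z0; exists (image z); exact: hyp_state_image. Qed.

(** Twice the boundary condition for the exponentials, multiplied by [cexp z],
    is the characteristic function. *)
Lemma char_fun_hyp z : char_fun m a alpha z =
  2 * cexp z * (z * bdry_value z + cosh z 1 + alpha%:C * sinh z 1).
Proof.
rewrite /char_fun /bdry_value /cosh /sinh /cexpf !mulr1 cexpN mulr_natl mulr2n cexpD rmorphD rmorphB /=.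
by field; exact: cexp_neq0.
Qed.

Lemma char_fun0 : char_fun m a alpha 0 = 2.
Proof. by rewrite /char_fun !mulr0 cexp0; ring. Qed.

Lemma char_fun_neq0 z : char_fun m a alpha z = 0 -> z != 0.
Proof.
by move=> e; apply/eqP => z0; move: e; rewrite z0 char_fun0 => /eqP; rewrite pnatr_eq0.
Qed.

Lemma char_fun_graph z : char_fun m a alpha z = 0 ->
  G (hyp_state z (bdry_value z)) (z *: hyp_state z (bdry_value z)).
Proof.
move=> e; have z0 := char_fun_neq0 e.
have e' : z * bdry_value z = - cosh z 1 - alpha%:C * sinh z 1.
  move: e; rewrite char_fun_hyp => /eqP; rewrite mulf_eq0 mulf_eq0 pnatr_eq0 (negbTE (cexp_neq0 z)) /=.
  by move=> /eqP e; rewrite -[LHS]subr0 -e; ring.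
have -> : z *: hyp_state z (bdry_value z) = image z.
  rewrite /image -e'; congr (_, _, _); apply/funext => x.
  by rewrite -[LHS]/(z * (sinh z x / z)) mulrC divfK.
exact: hyp_state_image.
Qed.

(** If [sinh] vanished on the interval then [cosh] would be the constant 1, whose
    primitive does not vanish. *)
Lemma sinh_cosh_state_neq0 z : z != 0 -> ~ eqH (hyp_state z (bdry_value z)) 0.
Proof.
move=> z0 [e1 _ _].
have s0 x : 0 <= x <= 1 -> sinh z x = 0.
  move=> x01; have /= h : (hyp_state z (bdry_value z)).1.1 x = 0 by apply: e1; rewrite in_itv.
  by apply/eqP; move/eqP: h; rewrite mulf_eq0 invr_eq0 (negbTE z0) orbF.
have Ic : L2 (fun=> 1 : C) by exact/ccont_L2/ccont_cst.
have s_0 : (fun t => z * sinh z t) = (fun=> 0) %[ae mu in I01].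
  apply: aeW => t; rewrite /= in_itv /= => /andP[t0 t1].
  by rewrite s0 ?mulr0 // !ltW.
have c1 x : 0 <= x <= 1 -> cosh z x = 1.
  move=> x01; apply/eqP; rewrite -subr_eq0 -cprim_sinh //; apply/eqP.
  rewrite (cprim_ae (L2Z z (ccont_L2 (sinh_ccont z))) L2_0 s_0) //.
  exact: cprim_zero.
have c1' : cosh z = (fun=> 1) %[ae mu in I01].
  by apply: aeW => t; rewrite /= in_itv /= => /andP[t0 t1]; rewrite c1 // !ltW.
have := cprim_cosh z0 (ler01 : 0 <= (1 : R)); rewrite s0 // mul0r.
rewrite (cprim_ae (ccont_L2 (cosh_ccont z)) Ic c1' in1) => /(congr1 (@Re R)) /=.
by rewrite prim1 ?int01_cst; [move/eqP; rewrite oner_eq0|exact: intble_cst].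
Qed.

(** With [p] the derivative of the first component [f], both [p + z f] and
    [p - z f] solve a linear equation of first order. *)
Lemma eigenvalue_char z : eigenvalueA m a alpha z -> char_fun m a alpha z = 0.
Proof.
move=> [u [hu u0 /(graphAP m a alpha)[_ [c [h1 h2 h3 h4 h5]]]]].
have [[hu1 _] _] := hu; have cf := H1_ccont hu1; have lf := ccont_L2 cf.
set f := u.1.1 in h2 h3 h4 h5 cf lf hu1.
have zu12 : (z *: u).1.2 = (fun t => z * u.1.2 t) by exact: state_scale2.
have zu11 x : (z *: u).1.1 x = z * f x by exact: state_scale1.
have zu2 : (z *: u).2 = z * u.2 by case: (u) => [[? ?] ?].
rewrite zu11 zu2 zu12 in h4 h5; rewrite zu12 in h3.
pose p x := c + cprim (fun t => z * u.1.2 t) x.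
have cp : ccont p by apply: ccontD; [exact: ccont_cst|apply: cprim_ccont; exact: L2Z].
have pE x : 0 <= x <= 1 -> p x = c + cprim (fun t => z * (z * f t)) x.
  move=> x01; congr (_ + _); apply: cprim_ae x01; [exact: L2Z|exact/L2Z/L2Z|].
  by apply: ae_imp h2 => t h It; rewrite (h It) zu11.
have fE x : 0 <= x <= 1 -> f x = cprim p x by exact: h3.
have lp := ccont_L2 cp.
have expE (s : C) : s * s = z * z -> forall x, 0 <= x <= 1 -> p x + s * f x = c * cexpf s x.
  move=> ss; apply: exponential_unique.
    by apply: ccontD => //; apply: ccontM => //; exact: ccont_cst.
  move=> x x01; have -> : (fun t => s * (p t + s * f t)) = (fun t => s * p t + z * (z * f t)).
    by apply/funext => t; rewrite mulrDr !mulrA ss.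
  rewrite (cprimD (L2Z s lp) (L2Z z (L2Z z lf)) x01) (cprimZ s lp x01) -fE //.
  by rewrite pE //; ring.
have ep := expE z erefl; have em := expE (- z) (mulrNN z z).
have pc x : 0 <= x <= 1 -> p x = c * cosh z x.
  by move=> x01; have := ep x x01; have := em x x01; rewrite /cosh mulrA mulrDr => <- <-; field.
have fs x : 0 <= x <= 1 -> z * f x = c * sinh z x.
  by move=> x01; have := ep x x01; have := em x x01; rewrite /sinh mulrA mulrBr => <- <-; field.
have c0 : c != 0.
  apply/eqP => c0; apply: u0.
  have p0 x : 0 <= x <= 1 -> p x = 0 by move=> /pc ->; rewrite c0 mul0r.
  have f0 x : 0 <= x <= 1 -> f x = 0.
    move=> x01; rewrite fE // (cprim_ae lp L2_0 _ x01).
      exact: cprim_zero.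
    by apply: aeW => t; rewrite /= in_itv /= => /andP[t0 t1]; rewrite p0 // !ltW.
  split.
  - by move=> x; rewrite in_itv /=; exact: f0.
  - apply: ae_imp h2 => t h It; rewrite (h It) zu11; move: It; rewrite /= in_itv /= => /andP[t0 t1].
    by rewrite f0 ?mulr0 // !ltW.
  - by rewrite h4 -/(p 1) p0 // fs // c0 mul0r !mulr0 addr0.
rewrite char_fun_hyp /bdry_value; apply/eqP; rewrite !mulf_eq0 pnatr_eq0 (negbTE (cexp_neq0 z)) /=.
have : c * (z * (m%:C * sinh z 1 + a%:C * cosh z 1) + cosh z 1 + alpha%:C * sinh z 1) = 0.
  move: h5; rewrite h4 -/(p 1) fs // pc // => h5.
  transitivity (z * (m%:C * (c * sinh z 1) + a%:C * (c * cosh z 1)) -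
    (- (c * cosh z 1) - alpha%:C * (c * sinh z 1))); first by ring.
  by rewrite h5 subrr.
by move/eqP; rewrite mulf_eq0 (negbTE c0).
Qed.

End Eigenvectors.

(** * A reference Riesz basis *)

Section TrigonometricSums.
Context {R : realType}.
Local Notation C := R[i].
Local Notation mu := (@lebesgue_measure R).
Local Notation I01 := (`]0%R, 1%R[%classic : set R).
Implicit Types (b : nat -> C) (x : R).

Lemma Re_sum (I : Type) (r : seq I) (F : I -> C) :
  Re (\sum_(i <- r) F i) = \sum_(i <- r) Re (F i).
Proof. by elim: r => [|i r IH]; rewrite ?big_nil ?big_cons // ReD IH. Qed.

Lemma Im_sum (I : Type) (r : seq I) (F : I -> C) :
  Im (\sum_(i <- r) F i) = \sum_(i <- r) Im (F i).
Proof. by elim: r => [|i r IH]; rewrite ?big_nil ?big_cons // ImD IH. Qed.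

Definition cos_sum b n x : C := \sum_(i < n) b i * (cosf (zenum i) x)%:C.
Definition sin_sum b n x : C := \sum_(i < n) b i * (sinf (zenum i) x)%:C.

Lemma ccont_sum (I : Type) (r : seq I) (F : I -> R -> C) : (forall i, ccont (F i)) ->
  ccont (fun x => \sum_(i <- r) F i x).
Proof.
move=> h; elim: r => [|i r IH].
  by have := ccont_cst (0 : C); congr ccont; apply/funext => x; rewrite big_nil.
by have := ccontD (h i) IH; congr ccont; apply/funext => x; rewrite big_cons.
Qed.

Lemma ccont_real (f : R -> R) : continuous f -> ccont (fun x => (f x)%:C).
Proof. by move=> cf; split; apply: continuous_subspaceT => // x; exact: cvg_cst. Qed.

Lemma cos_sum_ccont b n : ccont (cos_sum b n).
Proof.
apply: (ccont_sum (index_enum 'I_n) (F := fun (i : 'I_n) x => b i * (cosf (zenum i) x)%:C)) => i.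
by apply: ccontM; [exact: ccont_cst|exact/ccont_real/cosf_continuous].
Qed.

Lemma sin_sum_ccont b n : ccont (sin_sum b n).
Proof.
apply: (ccont_sum (index_enum 'I_n) (F := fun (i : 'I_n) x => b i * (sinf (zenum i) x)%:C)) => i.
by apply: ccontM; [exact: ccont_cst|exact/ccont_real/sinf_continuous].
Qed.

Let real_norm (beta : nat -> R) n :
  int01 (fun x => (\sum_(i < n) beta i * cosf (zenum i) x) ^+ 2 +
                  (\sum_(i < n) beta i * sinf (zenum i) x) ^+ 2) = \sum_(i < n) beta i ^+ 2.
Proof.
have E x : (\sum_(i < n) beta i * cosf (zenum i) x) ^+ 2 +
    (\sum_(i < n) beta i * sinf (zenum i) x) ^+ 2 =
    \sum_(i < n) \sum_(j < n) beta i * beta j * cosf (zenum i - zenum j) x.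
  rewrite !expr2 !big_distrlr /= -big_split; apply: eq_bigr => i _.
  rewrite -big_split; apply: eq_bigr => j _ /=.
  have h1 := cosf_mul (zenum i) (zenum j) x; have h2 := sinf_mul (zenum i) (zenum j) x.
  transitivity (beta i * beta j * (cosf (zenum i) x * cosf (zenum j) x +
     sinf (zenum i) x * sinf (zenum j) x)); first by ring.
  by rewrite h1 h2; field.
have z (i j : nat) : intble (fun x => beta i * beta j * cosf (zenum i - zenum j) x).
  by apply/intbleZ/sqint_intble/cosf_sqint.
have zs (i : nat) : intble (fun x => \sum_(j < n) beta i * beta j * cosf (zenum i - zenum j) x).
  by have [] := int01_sum (index_enum 'I_n) (fun j : 'I_n => z i j).
transitivity (int01 (fun x => \sum_(i < n) \sum_(j < n) beta i * beta j * cosf (zenum i - zenum j) x)).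
  by apply: int01_ext => x _; exact: E.
have [_ ->] := int01_sum (index_enum 'I_n) (fun i : 'I_n => zs i).
apply: eq_bigr => i _.
have [_ ->] := int01_sum (index_enum 'I_n) (fun j : 'I_n => z i j).
rewrite (bigD1 i) //= big1 ?addr0.
  by rewrite int01Z ?int01_cosf ?subrr ?eqxx ?mulr1 ?expr2 //; exact/sqint_intble/cosf_sqint.
move=> j ji; rewrite int01Z ?int01_cosf; last exact/sqint_intble/cosf_sqint.
rewrite subr_eq0 (inj_eq zenum_inj) -(inj_eq val_inj) in ji *.
by rewrite eq_sym (negbTE ji) mulr0.
Qed.

(** Expanding the squares, [cos u cos v + sin u sin v = cos (u - v)] integrates to
    zero unless the two frequencies agree. *)
Lemma trig_sum_norm b n :
  int01 (fun x => normc (cos_sum b n x) ^+ 2 + normc (sin_sum b n x) ^+ 2) =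
  \sum_(i < n) normc (b i) ^+ 2.
Proof.
have ReE f x : Re (\sum_(i < n) b i * (f i x)%:C) = \sum_(i < n) Re (b i) * f i x.
  by rewrite Re_sum; apply: eq_bigr => i _; rewrite ReMr.
have ImE f x : Im (\sum_(i < n) b i * (f i x)%:C) = \sum_(i < n) Im (b i) * f i x.
  by rewrite Im_sum; apply: eq_bigr => i _; rewrite ImMr.
have sq (beta : nat -> R) (f : nat -> R -> R) : (forall i, continuous (f i)) ->
    intble (fun x => (\sum_(i < n) beta i * f i x) ^+ 2).
  move=> cf; have [_] : sqint (fun x => \sum_(i < n) beta i * f i x).
    apply: continuous_sqint; have [+ _] : ccont (fun x => \sum_(i < n) (beta i)%:C * (f i x)%:C).
      apply: (ccont_sum (index_enum 'I_n) (F := fun (i : 'I_n) x => (beta i)%:C * (f i x)%:C)) => i.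
      by apply: ccontM; [exact: ccont_cst|exact: ccont_real].
    rewrite (_ : (fun x => Re _) = (fun x => \sum_(i < n) beta i * f i x)) //.
    by apply/funext => x; rewrite Re_sum; apply: eq_bigr => i _; rewrite ReMr.
  by [].
pose S (beta : nat -> R) x := (\sum_(i < n) beta i * cosf (zenum i) x) ^+ 2 +
                 (\sum_(i < n) beta i * sinf (zenum i) x) ^+ 2 : R.
have iS beta : intble (S beta).
  have i1 := sq beta (fun i => cosf (zenum i)) (fun i => @cosf_continuous R (zenum i)).
  have i2 := sq beta (fun i => sinf (zenum i)) (fun i => @sinf_continuous R (zenum i)).
  exact (intbleD i1 i2).
transitivity (int01 (fun x => S (fun i => Re (b i)) x + S (fun i => Im (b i)) x)).
  apply: int01_ext => x _; rewrite !sqr_normcE.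
  rewrite (ReE (fun i => cosf (zenum i))) (ImE (fun i => cosf (zenum i))).
  by rewrite (ReE (fun i => sinf (zenum i))) (ImE (fun i => sinf (zenum i))) addrACA.
rewrite int01D // !real_norm -big_split; apply: eq_bigr => i _.
by rewrite sqr_normcE.
Qed.

(** The frequencies [j] and [- j] occupy the places [2 j - 1] and [2 j] of the
    enumeration; their half sum and half difference carry the coefficients of
    [cos (j pi x)] and [sin (j pi x)]. *)
Definition pair_coef (p q : nat -> C) (i : nat) : C :=
  if i is k.+1 then (p k./2.+1 + (if odd k then - q k./2 else q k./2)) / 2 else p 0%N.

Arguments pair_coef : simpl never.

Lemma pair_coef_sums p q n x :
  cos_sum (pair_coef p q) n.*2.+1 x = \sum_(j < n.+1) p j * (cosf j x)%:C /\
  sin_sum (pair_coef p q) n.*2.+1 x = \sum_(j < n) q j * (sinf j.+1 x)%:C.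
Proof.
have z1 k : zenum k.*2.+1 = k.+1 :> int by rewrite /zenum /= odd_double /=; lia.
have z2 k : zenum k.*2.+2 = - k.+1%:Z by rewrite /zenum /= odd_double /=; lia.
elim: n => [|n [IHc IHs]].
  split; first by rewrite /cos_sum !big_ord_recr !big_ord0 /=.
  rewrite /sin_sum big_ord_recr !big_ord0 /= add0r.
  by rewrite /sinf mulr0 mul0r sin0 mulr0.
have b1 : pair_coef p q n.*2.+1 = (p n.+1 + q n) / 2.
  by rewrite /pair_coef odd_double doubleK.
have b2 : pair_coef p q n.*2.+2 = (p n.+1 - q n) / 2.
  by rewrite /pair_coef /= odd_double /= uphalf_double.
rewrite doubleS; split.
  rewrite [RHS]big_ord_recr /= -IHc /cos_sum 2!big_ord_recr /= -addrA; congr (_ + _).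
  by rewrite b1 b2 z1 z2 cosfN; field.
rewrite [RHS]big_ord_recr /= -IHs /sin_sum 2!big_ord_recr /= -addrA; congr (_ + _).
by rewrite b1 b2 z1 z2 sinfN rmorphN /=; field.
Qed.

Lemma trig_approximation (W V : R -> C) : L2 W -> L2 V ->
  exists b, vanish (fun n => int01 (fun x =>
    normc (W x - cos_sum b n.*2.+1 x) ^+ 2 + normc (V x - sin_sum b n.*2.+1 x) ^+ 2)).
Proof.
move=> hW hV; have /L2P[wr wi] := hW; have /L2P[vr vi] := hV.
have [p1 v1] := cos_expansion wr; have [p2 v2] := cos_expansion wi.
have [q1 v3] := sin_expansion vr; have [q2 v4] := sin_expansion vi.
pose p j := p1 j +i* p2 j; pose q j := q1 j +i* q2 j.
have shift (u : nat -> R) : vanish u -> vanish (fun n => u n.+1).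
  by move=> h e /h[n0 n0P]; exists n0 => n nn; apply: n0P; exact: leqW.
exists (pair_coef p q).
apply: (@vanish_le _ 0 _ _ _ (vanishD (vanishD (shift _ v1) (shift _ v2)) (vanishD v3 v4))) => n _.
have l1 : L2 (fun x => W x - cos_sum (pair_coef p q) n.*2.+1 x).
  exact: L2B hW (ccont_L2 (cos_sum_ccont _ _)).
have l2 : L2 (fun x => V x - sin_sum (pair_coef p q) n.*2.+1 x).
  exact: L2B hV (ccont_L2 (sin_sum_ccont _ _)).
rewrite int01D; [|exact: sqnorm_intble|exact: sqnorm_intble].
rewrite -/(sqnorm _) -[X in _ + X]/(sqnorm _) !sqnormE // le_eqVlt; apply/orP; left; apply/eqP.
congr (_ + _ + (_ + _)); apply: int01_ext => x _; have [cE sE] := pair_coef_sums p q n x.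
- by rewrite cE ReD ReN Re_sum; congr ((_ - _) ^+ 2); apply: eq_bigr => i _; rewrite ReMr.
- by rewrite cE ImD ImN Im_sum; congr ((_ - _) ^+ 2); apply: eq_bigr => i _; rewrite ImMr.
- by rewrite sE ReD ReN Re_sum; congr ((_ - _) ^+ 2); apply: eq_bigr => i _; rewrite ReMr.
- by rewrite sE ImD ImN Im_sum; congr ((_ - _) ^+ 2); apply: eq_bigr => i _; rewrite ImMr.
Qed.

End TrigonometricSums.

Section ReferenceBasis.
Context {R : realType} (m a alpha : R) (hm : 0 < m) (ha : 0 < a) (halpha : 0 < alpha).
Hypothesis ham : a != m.
Local Notation C := R[i].
Local Notation mu := (@lebesgue_measure R).
Local Notation I01 := (`]0%R, 1%R[%classic : set R).
Local Notation N := (normH m a alpha).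
Local Notation nu := (nu m a).
Local Notation nu0 := (nu0 m a).
Implicit Types (b c : nat -> C) (x : R) (p g : R -> C).

Let nuE n : nu n = nu0 + (0 +i* zfreq n). Proof. by []. Qed.

Lemma nu_neq0 n : nu n != 0.
Proof.
apply/eqP => e; have := cexp_nu hm ha ham n; rewrite e mulr0 cexp0 => /(congr1 (@Re R)) /= h.
have s0 : m + a != 0 by rewrite lt0r_neq0 // addr_gt0.
have : m - a = m + a by rewrite -[LHS](divfK s0) -h mul1r.
by move: ha; lra.
Qed.

(** Eigenvectors with the frequencies replaced by their asymptotic values, and the
    third component split off. *)
Definition ref_basis n : state R :=
  if n is k.+1 then hyp_state (nu k) 0 else (fun=> 0, fun=> 0, 1).

Let rP n : R -> C := if n is k.+1 then cosh (nu k) else fun=> 0.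
Let rG n : R -> C := if n is k.+1 then sinh (nu k) else fun=> 0.
Let rE n : C := if n is k.+1 then 0 else 1.

Let cprim_zero (x : R) : 0 <= x <= 1 -> cprim (fun=> 0) x = 0.
Proof. by move=> x01; have [_ h _] := @state_rep0 R; rewrite -h. Qed.

Let ref_rep n : state_rep (ref_basis n) (rP n).
Proof.
case: n => [|k]; last exact/hyp_state_rep/nu_neq0.
by split; [exact: L2_0|move=> x x01; rewrite cprim_zero|exact: L2_0].
Qed.

Lemma ref_basis_inH n : inH (ref_basis n).
Proof. exact: state_rep_inH (ref_rep n). Qed.

Let comb_rep c n : [/\ state_rep (comb ref_basis c n) (fun x => \sum_(i < n) c i * rP i x),
  (comb ref_basis c n).1.2 = (fun x => \sum_(i < n) c i * rG i x) &
  (comb ref_basis c n).2 = \sum_(i < n) c i * rE i].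
Proof.
elim: n => [|n [IH1 IH2 IH3]].
  rewrite /comb !big_ord0; split => //; last by apply/funext => x; rewrite big_ord0.
  have := @state_rep0 R; congr state_rep; apply/funext => x; by rewrite big_ord0.
have cE : comb ref_basis c n.+1 = comb ref_basis c n + c n *: ref_basis n.
  by rewrite /comb big_ord_recr.
have h := state_repD IH1 (state_repZ (c n) (ref_rep n)); rewrite -cE in h; split.
- by move: h; congr state_rep; apply/funext => x; rewrite big_ord_recr.
- rewrite cE; apply/funext => x; rewrite big_ord_recr.
  transitivity ((comb ref_basis c n).1.2 x + c n * (ref_basis n).1.2 x); first by [].
  by rewrite IH2; case: (n).
- rewrite cE big_ord_recr.
  transitivity ((comb ref_basis c n).2 + c n * (ref_basis n).2); first by [].
  by rewrite IH3; case: (n).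
Qed.

Let Cs b n x := \sum_(i < n) b i * cosh (nu i) x.
Let Sn b n x := \sum_(i < n) b i * sinh (nu i) x.

Let comb_repS c n : let b i := c i.+1 in
  [/\ state_rep (comb ref_basis c n.+1) (Cs b n), (comb ref_basis c n.+1).1.2 = Sn b n &
      (comb ref_basis c n.+1).2 = c 0%N].
Proof.
move=> b; have [h1 h2 h3] := comb_rep c n.+1; split.
- move: h1; congr state_rep; apply/funext => x.
  by rewrite big_ord_recl mulr0 add0r.
- by rewrite h2; apply/funext => x; rewrite big_ord_recl mulr0 add0r.
- by rewrite h3 big_ord_recl big1 ?addr0 ?mulr1 // => i _; rewrite mulr0.
Qed.

Let I : C := 0 +i* 1.
Let II : I * I = -1. Proof. by apply: complex_ext; rewrite ?ReM ?ImM /=; ring. Qed.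

Let cexp_imag (w x : R) : cexp ((0 +i* w) * x%:C) = (cos (w * x))%:C + I * (sin (w * x))%:C.
Proof.
rewrite /cexp ReMr ImMr [Re _]/= [Im _]/= mul0r expR0 !mul1r.
by apply: complex_ext; rewrite ?ReD ?ImD ?ReM ?ImM /=; ring.
Qed.

Let cexpf_split n x : cexpf (nu n) x =
  cexpf nu0 x * ((cosf (zenum n) x)%:C + I * (sinf (zenum n) x)%:C).
Proof. by rewrite /cexpf nuE mulrDl cexpD cexp_imag. Qed.

Let cexpf_splitN n x : cexpf (- nu n) x =
  cexpf (- nu0) x * ((cosf (zenum n) x)%:C - I * (sinf (zenum n) x)%:C).
Proof.
have e : - (0 +i* zfreq n) = 0 +i* (- zfreq n) :> C by apply: complex_ext; rewrite /= ?oppr0.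
rewrite /cexpf nuE opprD mulrDl cexpD e cexp_imag [- zfreq n * x]mulNr cosN sinN rmorphN /= mulrN.
by [].
Qed.

Let CsDSn b n x : Cs b n x + Sn b n x = cexpf nu0 x * (cos_sum b n x + I * sin_sum b n x).
Proof.
rewrite /Cs /Sn /cos_sum /sin_sum mulr_sumr -!big_split mulr_sumr; apply: eq_bigr => i _ /=.
by rewrite -mulrDr coshDsinh cexpf_split; ring.
Qed.

Let CsBSn b n x : Cs b n x - Sn b n x = cexpf (- nu0) x * (cos_sum b n x - I * sin_sum b n x).
Proof.
rewrite /Cs /Sn /cos_sum /sin_sum mulr_sumr -!sumrB mulr_sumr; apply: eq_bigr => i _ /=.
by rewrite -mulrBr coshBsinh cexpf_splitN; ring.
Qed.

Let r : R := `|Re nu0|.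

Let normc_cexpf z x : 0 <= x <= 1 -> `|Re z| <= r ->
  expR (- (2 * r)) <= normc (cexpf z x) ^+ 2 <= expR (2 * r).
Proof.
move=> /andP[x0 x1]; rewrite ler_norml => /andP[z1 z2].
have r0 : 0 <= r by exact: normr_ge0.
rewrite /cexpf normc_cexp ReMr -expRM_natl !ler_expR mulr_natl mulr2n.
by apply/andP; split; nra.
Qed.

(** In the characteristic variables [p + g] and [p - g] the factors
    [cexpf nu0] and [cexpf (- nu0)] split off; their moduli lie between
    [expR (- r)] and [expR r]. *)
Let frame (p g X Y : C) x : 0 <= x <= 1 ->
  p + g = cexpf nu0 x * (X + I * Y) -> p - g = cexpf (- nu0) x * (X - I * Y) ->
  expR (- (2 * r)) * (normc X ^+ 2 + normc Y ^+ 2) <= normc p ^+ 2 + normc g ^+ 2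
    <= expR (2 * r) * (normc X ^+ 2 + normc Y ^+ 2).
Proof.
move=> x01 e1 e2.
have par (u v : C) : normc u ^+ 2 + normc v ^+ 2 = (normc (u + v) ^+ 2 + normc (u - v) ^+ 2) / 2.
  by rewrite !sqr_normcE !ReD !ImD !ReN !ImN; field.
have -> : normc X ^+ 2 + normc Y ^+ 2 = normc X ^+ 2 + normc (I * Y) ^+ 2.
  by rewrite normcM (_ : normc I = 1) ?mul1r // /I /normc /= expr0n add0r expr1n sqrtr1.
rewrite (par p g) (par X) e1 e2 !normcM !exprMn.
have r1 : `|Re nu0| <= r by [].
have r2 : `|Re (- nu0)| <= r by rewrite ReN normrN.
have /andP[a1 a2] := normc_cexpf x01 r1; have /andP[b1 b2] := normc_cexpf x01 r2.
move: (sqr_ge0 (normc (X + I * Y))) (sqr_ge0 (normc (X - I * Y))).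
move: (normc _ ^+ 2) (normc _ ^+ 2) (normc (cexpf nu0 x) ^+ 2) (normc (cexpf (- nu0) x) ^+ 2) a1 a2 b1 b2.
by move: (expR _) (expR _) => e e' u v s t *; apply/andP; split; nra.
Qed.

Let kap := kappa m a alpha.
Let kap_gt0 : 0 < kap. Proof. exact: kappa_gt0. Qed.

Let ref_bounds : exists c1 c2 : R, riesz_bounds N ref_basis c1 c2.
Proof.
exists (Num.min (expR (- (2 * r))) kap), (expR (2 * r) + kap); split.
- by rewrite lt_min expR_gt0.
- by rewrite addr_gt0 ?expR_gt0.
case=> [|n] c.
  have [h _ _] := comb_rep c 0; rewrite big_ord0 !mulr0 /comb big_ord0.
  have sH := normH_seminormed hm ha halpha.
  have -> : N 0 = 0.
    by rewrite -[X in N X](scale0r (0 : state R)) (seminormZ sH) ?normc0 ?mul0r //; exact: (semi0 sH).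
  by rewrite expr0n lexx.
pose b i := c i.+1; have [h1 h2 h3] := comb_repS c n.
rewrite (normH_rep hm ha halpha h1) h2 h3 big_ord_recl -/kap.
have hp : L2 (Cs b n) by have [] := h1.
have hg : L2 (Sn b n) by have [_ _] := h1; rewrite h2.
rewrite -[sqnorm _ + sqnorm _]int01D; try exact: sqnorm_intble.
have it : intble (fun x => normc (cos_sum b n x) ^+ 2 + normc (sin_sum b n x) ^+ 2).
  by apply: intbleD; apply: sqnorm_intble; apply: ccont_L2; [exact: cos_sum_ccont|exact: sin_sum_ccont].
have ip : intble (fun x => normc (Cs b n x) ^+ 2 + normc (Sn b n x) ^+ 2).
  by apply: intbleD; exact: sqnorm_intble.
have lo : int01 (fun x => expR (- (2 * r)) * (normc (cos_sum b n x) ^+ 2 + normc (sin_sum b n x) ^+ 2))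
    <= int01 (fun x => normc (Cs b n x) ^+ 2 + normc (Sn b n x) ^+ 2).
  apply: int01_le => [|//|x Ix]; first exact: intbleZ.
  by have /andP[] := frame (subset_itv_oo_cc Ix) (CsDSn b n x) (CsBSn b n x).
have hi : int01 (fun x => normc (Cs b n x) ^+ 2 + normc (Sn b n x) ^+ 2) <=
    int01 (fun x => expR (2 * r) * (normc (cos_sum b n x) ^+ 2 + normc (sin_sum b n x) ^+ 2)).
  apply: int01_le => [//||x Ix]; first exact: intbleZ.
  by have /andP[] := frame (subset_itv_oo_cc Ix) (CsDSn b n x) (CsBSn b n x).
rewrite int01Z // trig_sum_norm in lo; rewrite int01Z // trig_sum_norm in hi.
rewrite /= -[\sum_(i < n) normc (c _) ^+ 2]/(\sum_(i < n) normc (b i) ^+ 2).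
have s0 : 0 <= \sum_(i < n) normc (b i) ^+ 2 by apply: sumr_ge0 => i _; exact: sqr_ge0.
have c0 := sqr_ge0 (normc (c 0%N)).
have m1 : Num.min (expR (- (2 * r))) kap <= expR (- (2 * r)) by rewrite ge_min lexx.
have m2 : Num.min (expR (- (2 * r))) kap <= kap by rewrite ge_min lexx orbT.
have q1 := ler_wpM2r s0 m1; have q2 := ler_wpM2r c0 m2.
have q3 := mulr_ge0 (expR_ge0 (2 * r)) c0; have q4 := mulr_ge0 (ltW kap_gt0) s0.
by rewrite -[fun i : nat => c i.+1]/b; apply/andP; split; lra.
Qed.

(** For the density, undo the two exponential factors, expand the half sum in
    cosines and the half difference in sines, and transport the approximation
    back. *)
Theorem ref_basis_riesz : riesz_basis (inH (R := R)) N ref_basis.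
Proof.
have [c1 [c2 bnd]] := ref_bounds.
apply: (riesz_basis_intro ref_basis_inH bnd) => u /inHP[p hu] e e0.
have [hp pe hg] := hu; set g := u.1.2 in hg.
have ce (z : C) : ccont (cexpf z) by exact: ccontinuous_ccont (cexpf_continuous z).
pose wp x := (p x + g x) * cexpf (- nu0) x; pose wm x := (p x - g x) * cexpf nu0 x.
have lp : L2 wp := L2M (L2D hp hg) (ce _).
have lm : L2 wm := L2M (L2B hp hg) (ce _).
pose W x := 2^-1 * (wp x + wm x); pose V x := (- I / 2) * (wp x - wm x).
have hW : L2 W := L2Z _ (L2D lp lm).
have hV : L2 V := L2Z _ (L2B lp lm).
have [b vb] := trig_approximation hW hV.
have [n0 n0P] := vanishZ (ltW (expR_gt0 (2 * r))) vb (exprn_gt0 2 e0).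
have {n0P} small := n0P n0 (leqnn n0); set n := n0.*2.+1 in small.
pose c i := if i is k.+1 then b k else u.2.
exists (comb ref_basis c n.+1); first by exists n.+1, c.
have [h1 h2 h3] := comb_repS c n; have hd := state_repB hu h1.
rewrite -(ltr_pXn2r (_ : 0 < 2)%N) ?nnegrE ?normH_ge0 ?(ltW e0) //.
apply: le_lt_trans small; rewrite (normH_rep hm ha halpha hd).
have -> : (u - comb ref_basis c n.+1).2 = u.2 - (comb ref_basis c n.+1).2 by [].
rewrite h3 subrr normc0 expr0n mulr0 addr0.
have -> : (u - comb ref_basis c n.+1).1.2 = (fun x => g x - Sn b n x).
  by rewrite -h2.
have lCs : L2 (fun x => p x - Cs b n x) by have [] := hd.
have lSn : L2 (fun x => g x - Sn b n x) by have [_ _] := hd; rewrite -h2.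
have i1 := sqnorm_intble lCs; have i2 := sqnorm_intble lSn.
have i3 := sqnorm_intble (L2B hW (ccont_L2 (cos_sum_ccont b n))).
have i4 := sqnorm_intble (L2B hV (ccont_L2 (sin_sum_ccont b n))).
rewrite -int01Z -?int01D //; last exact: intbleD.
apply: int01_le; [exact: intbleD|exact/intbleZ/intbleD|] => x Ix.
have EE : cexpf nu0 x * cexpf (- nu0) x = 1 by rewrite /cexpf -cexpD mulNr subrr cexp0.
have WV : W x + I * V x = wp x.
  transitivity (2^-1 * (wp x + wm x) - (I * I) / 2 * (wp x - wm x)); first by rewrite /W /V; ring.
  by rewrite II; field.
have WV' : W x - I * V x = wm x.
  transitivity (2^-1 * (wp x + wm x) + (I * I) / 2 * (wp x - wm x)); first by rewrite /W /V; ring.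
  by rewrite II; field.
have q1 : (p x - Cs b n x) + (g x - Sn b n x) =
    cexpf nu0 x * ((W x - cos_sum b n x) + I * (V x - sin_sum b n x)).
  transitivity ((p x + g x) - (Cs b n x + Sn b n x)); first by ring.
  rewrite CsDSn; transitivity (cexpf nu0 x * ((W x + I * V x) - (cos_sum b n x + I * sin_sum b n x))); last by ring.
  by rewrite WV mulrBr /wp [_ * ((_ + _) * _)]mulrCA EE mulr1.
have q2 : (p x - Cs b n x) - (g x - Sn b n x) =
    cexpf (- nu0) x * ((W x - cos_sum b n x) - I * (V x - sin_sum b n x)).
  transitivity ((p x - g x) - (Cs b n x - Sn b n x)); first by ring.
  rewrite CsBSn; transitivity (cexpf (- nu0) x * ((W x - I * V x) - (cos_sum b n x - I * sin_sum b n x))); last by ring.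
  by rewrite WV' [RHS]mulrBr /wm [_ * ((_ - _) * _)]mulrCA [cexpf (- nu0) x * cexpf nu0 x]mulrC EE mulr1.
by have /andP[] := frame (subset_itv_oo_cc Ix) q1 q2.
Qed.

End ReferenceBasis.

(** * Domain density and asymptotics of the eigenvectors *)

Section Asymptotics.
Context {R : realType} (m a alpha : R) (hm : 0 < m) (ha : 0 < a) (halpha : 0 < alpha).
Hypothesis ham : a != m.
Local Notation C := R[i].
Local Notation mu := (@lebesgue_measure R).
Local Notation I01 := (`]0%R, 1%R[%classic : set R).
Local Notation N := (normH m a alpha).
Local Notation G := (graphA m a alpha).
Local Notation nu := (nu m a).
Local Notation nu0 := (nu0 m a).
Local Notation phi := (ref_basis m a).
Implicit Types (x : R) (z w : C).

Let sH : seminormed (inH (R := R)) N := normH_seminormed hm ha halpha.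

Let cprim_zero x : 0 <= x <= 1 -> cprim (fun=> 0) x = 0.
Proof. by move=> x01; have [_ h _] := @state_rep0 R; rewrite -h. Qed.

Let mono_deriv n (t : R) : is_derive t 1 (fun x => x ^+ n.+1) (n.+1%:R * t ^+ n).
Proof.
split; first exact: exprn_derivable.
by rewrite exp_derive /= /GRing.scale /= mulr1.
Qed.

Let mono_cont n : continuous (fun x : R => x ^+ n).
Proof. exact: exprn_continuous. Qed.

(** The third component of a vector of the domain involves the value of its second
    component at 1, which the norm does not control: the power [x ^ n] is small
    in the mean but equal to 1 there. *)
Let boundary_layer n : exists v, G (fun=> 0, fun x => (m^-1 * x ^+ n.+1)%:C, 1) v.
Proof.
pose q x : C := (m^-1 * (n.+1%:R * x ^+ n))%:C.
have cq : ccontinuous q.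
  split; last by move=> x; exact: cst_continuous.
  move=> x; apply: cvgM; first exact: cvg_cst.
  by apply: cvgM; [exact: cvg_cst|exact: mono_cont].
have dq : cderiv (fun x => (m^-1 * x ^+ n.+1)%:C) q.
  move=> x; split; last exact: is_derive_cst.
  have d := mono_deriv n x.
  have h : is_derive x 1 (m^-1 *: (fun y : R => y ^+ n.+1)) (m^-1 *: (n.+1%:R * x ^+ n)).
    exact: is_deriveZ.
  exact h.
have cg : ccont (fun x => (m^-1 * x ^+ n.+1)%:C : C).
  exact: ccontinuous_ccont (cderiv_ccontinuous dq).
exists ((fun x => (m^-1 * x ^+ n.+1)%:C), fun=> 0, - (alpha / m)%:C).
apply/(graphAP m a alpha); split.
  apply: (@state_rep_inH _ _ q); split; [exact/ccont_L2/ccontinuous_ccont| |exact: L2_0].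
  by move=> x /andP[x0 _]; rewrite (cprim_ftc dq cq x0) /= expr0n /= mulr0 subr0.
have in1 : 0 <= (1 : R) <= 1 by rewrite ler01 lexx.
exists 0; split => /=.
- exact: ccont_L2.
- exact: aeW.
- move=> x x01; rewrite -[LHS](cprim_zero x01); apply: cprim_ae x01; [exact: L2_0| |].
    by apply: L2D L2_0 _; exact/ccont_L2/cprim_ccont/L2_0.
  apply: aeW => t; rewrite /= in_itv /= => /andP[t0 t1].
  by rewrite cprim_zero ?addr0 // !ltW.
- by rewrite cprim_zero // expr1n mulr1 addr0 mulr0 addr0 -rmorphM /= divff // lt0r_neq0.
- by rewrite cprim_zero // expr1n mulr1 addr0 oppr0 sub0r -rmorphM.
Qed.

Let layer_small n : N (phi 0 - (fun=> 0, fun x => (m^-1 * x ^+ n.+1)%:C, 1)) ^+ 2 <= (m^-1) ^+ 2 * n.+2%:R^-1.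
Proof.
have in1 : 0 <= (1 : R) <= 1 by rewrite ler01 lexx.
have cg k : ccont (fun x => (x ^+ k)%:C : C) by apply: ccont_real; exact: mono_cont.
have l0 : state_rep (phi 0) (fun=> 0).
  by split; [exact: L2_0|move=> x x01; rewrite cprim_zero|exact: L2_0].
have l1 : state_rep ((fun=> 0, fun x => (m^-1 * x ^+ n.+1)%:C, 1) : state R) (fun=> 0).
  split; [exact: L2_0|by move=> x x01; rewrite cprim_zero|].
  have := L2Z (m^-1)%:C (ccont_L2 (cg n.+1)).
  by congr L2; apply/funext => x; rewrite -[RHS]/((m^-1 * x ^+ n.+1)%:C) rmorphM.
rewrite (normH_rep hm ha halpha (state_repB l0 l1)).
have -> : (phi 0 - (fun=> 0, fun x => (m^-1 * x ^+ n.+1)%:C, 1)).1.2 =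
   (fun x => (- (m^-1)%:C) * (x ^+ n.+1)%:C).
  by apply/funext => x; rewrite -[LHS]/(0 - (m^-1 * x ^+ n.+1)%:C) sub0r rmorphM mulNr.
have -> : (phi 0 - (fun=> 0, fun x => (m^-1 * x ^+ n.+1)%:C, 1)).2 = 0 by rewrite -[LHS]/(1 - 1 : C) subrr.
have -> : sqnorm (fun x => 0 - 0 : C) = 0.
  by rewrite -[RHS]int01_cst; apply: int01_ext => x _; rewrite subrr normc0 expr0n.
rewrite normc0 expr0n mulr0 addr0 add0r sqnormZ; last exact/ccont_L2/cg.
rewrite normcN' normcR real_normK ?num_real //; apply: ler_wpM2l; first exact: sqr_ge0.
have ix k : intble (fun x => x ^+ k : R).
  by apply/sqint_intble/continuous_sqint/continuous_subspaceT; exact: mono_cont.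
have h1 : int01 (fun x => n.+2%:R * x ^+ n.+1) = 1.
  rewrite -prim1; last exact: intbleZ.
  rewrite (prim_ftc (mono_deriv n.+1)) ?expr1n ?expr0n ?subr0 //.
  by move=> x; apply: cvgM; [exact: cvg_cst|exact: mono_cont].
rewrite int01Z // in h1.
have n0 : n.+2%:R != 0 :> R by rewrite pnatr_eq0.
have -> : n.+2%:R^-1 = int01 (fun x => x ^+ n.+1) by apply: (mulfI n0); rewrite divff.
apply: int01_le; [exact/sqnorm_intble/ccont_L2/cg|exact: ix|].
move=> x; rewrite /= in_itv /= => /andP[x0 x1].
have x00 : 0 <= x ^+ n.+1 by rewrite exprn_ge0 // ltW.
have x11 : x ^+ n.+1 <= 1 by rewrite exprn_ile1 // ltW.
have h : normc ((x ^+ n.+1)%:C : C) ^+ 2 <= x ^+ n.+1 by rewrite normcR ger0_norm // expr2 ler_piMl.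
exact h.
Qed.

Let layer_dense e : 0 < e -> exists u v, G u v /\ N (phi 0 - u) < e.
Proof.
move=> e0; have v0 := vanishZ (sqr_ge0 (m^-1)) (@vanish_inv R).
have [n nP] := v0 _ (exprn_gt0 2 e0).
have [v Gv] := boundary_layer n; eexists; exists v; split; first exact: Gv.
rewrite -(ltr_pXn2r (_ : 0 < 2)%N) ?nnegrE ?normH_ge0 ?(ltW e0) //.
exact: le_lt_trans (layer_small n) (nP n.+1 (leqnSn n)).
Qed.

Lemma hyp_stateE z (eta : C) : hyp_state z eta = hyp_state z 0 + eta *: phi 0.
Proof.
rewrite /hyp_state /=; congr (_, _, _).
- by apply/funext => x; rewrite -[RHS]/(sinh z x / z + eta * 0) mulr0 addr0.
- by apply/funext => x; rewrite -[RHS]/(sinh z x + eta * 0) mulr0 addr0.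
- by rewrite -[RHS]/(0 + eta * 1) mulr1 add0r.
Qed.

Lemma domain_dense u : inH u -> forall e, 0 < e -> exists u' v, G u' v /\ N (u - u') < e.
Proof.
apply: (graphA_dense_span hm ha halpha (ref_basis_riesz hm ha halpha ham)) => {u} -[|n] e e0.
  exact: layer_dense.
have [v Gv] := hyp_state_dom m a alpha (nu_neq0 hm ha ham n).
set eta := bdry_value m a (nu n) in Gv.
have k0 : 0 < 1 + normc eta by rewrite ltr_pwDl ?normc_ge0.
have [u [w [Gu small]]] := layer_dense (divr_gt0 e0 k0).
exists ((- eta) *: u + hyp_state (nu n) eta), ((- eta) *: w + v); split; first exact: graphA_lin.
have -> : phi n.+1 - ((- eta) *: u + hyp_state (nu n) eta) = (- eta) *: (phi 0 - u).
  rewrite hyp_stateE -[phi n.+1]/(hyp_state (nu n) 0).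
  move: (hyp_state (nu n) 0) (phi 0) => A P.
  by rewrite addrCA opprD addrA subrr add0r scalerBr !scaleNr opprK opprD opprK addrC.
rewrite (seminormZ sH); last first.
  apply: (semiB sH); first exact: (ref_basis_inH hm ha ham).
  by have [] := graphA_inH Gu.
have h0 := normH_ge0 m a alpha (phi 0 - u); have c0 := normc_ge0 eta.
move: small; rewrite normcN' ltr_pdivlMr // => small; nra.
Qed.

Let r : R := `|Re nu0|.

Let cexpf_le z x : `|Re z| <= r + 1 / 2 -> 0 <= x <= 1 -> normc (cexpf z x) <= expR (r + 1 / 2).
Proof.
move=> zr /andP[x0 x1]; rewrite /cexpf normc_cexp ReMr ler_expR.
by apply: le_trans zr; apply: le_trans (ler_norm _) _; rewrite normrM (ger0_norm x0) ler_piMr.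
Qed.

Let cexpf_diff z w x : `|Re w| <= r + 1 / 2 -> normc (z - w) <= 1 / 2 -> 0 <= x <= 1 ->
  normc (cexpf z x - cexpf w x) <= 4 * expR (r + 1 / 2) * normc (z - w).
Proof.
move=> wr zw x01; have -> : cexpf z x - cexpf w x = cexpf w x * (cexp ((z - w) * x%:C) - 1).
  by rewrite mulrBr mulr1 /cexpf -cexpD; congr (cexp _ - _); ring.
have /andP[x0 x1] := x01; have n0 := normc_ge0 (z - w).
have hx : normc ((z - w) * x%:C) <= normc (z - w).
  by rewrite normcM normcR ger0_norm // ler_piMr.
have h := cexp_sub1_le (le_trans hx zw).
rewrite normcM -mulrA mulrCA; apply: ler_pM; rewrite ?normc_ge0 //; first exact: cexpf_le.
by apply: le_trans h _; lra.
Qed.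

(** The first two components are Lipschitz in the frequency; the characteristic
    equation bounds the third by a multiple of [1 / z]. *)
Lemma hyp_state_close : exists2 D : R, 0 <= D & forall z w, z != 0 -> w != 0 ->
  char_fun m a alpha z = 0 -> `|Re w| <= r -> normc (z - w) <= 1 / 2 ->
  N (hyp_state z (bdry_value m a z) - hyp_state w 0) ^+ 2 <=
    D * (normc (z - w) ^+ 2 + (normc z)^-1 ^+ 2).
Proof.
pose E := expR (r + 1 / 2); have E0 : 0 < E by exact: expR_gt0.
pose k := kappa m a alpha; have k0 : 0 < k by exact: kappa_gt0.
pose D1 := 2 * (4 * E) ^+ 2; pose D2 := k * ((1 + alpha) * E) ^+ 2.
have D10 : 0 <= D1 by rewrite mulr_ge0 ?sqr_ge0.
have D20 : 0 <= D2 by rewrite mulr_ge0 ?sqr_ge0 ?ltW.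
exists (D1 + D2); first exact: addr_ge0.
move=> z w z0 w0 cz wr zw; have n0 := normc_ge0 (z - w).
have hd := state_repB (hyp_state_rep (bdry_value m a z) z0) (hyp_state_rep 0 w0).
have wr' : `|Re w| <= r + 1 / 2 by lra.
have zr' : `|Re z| <= r + 1 / 2.
  have -> : Re z = Re w + Re (z - w) by rewrite ReD ReN; ring.
  apply: le_trans (ler_normD _ _) _; have := normc_Re (z - w); lra.
have d1 x : 0 <= x <= 1 -> normc (cexpf z x - cexpf w x) <= 4 * E * normc (z - w).
  by move=> x01; exact: cexpf_diff.
have d2 x : 0 <= x <= 1 -> normc (cexpf (- z) x - cexpf (- w) x) <= 4 * E * normc (z - w).
  move=> x01; have <- : normc (- z - - w) = normc (z - w) by rewrite -opprD normcN'.
  by apply: cexpf_diff => //; rewrite ?ReN ?normrN // -opprD normcN'.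
have half (s : C) : normc (s / 2) = normc s / 2.
  rewrite normcM; congr (_ * _); rewrite (_ : 2^-1 = (2^-1 : R)%:C :> C).
    by rewrite normcR ger0_norm.
  by rewrite fmorphV rmorph_nat.
have dc x : 0 <= x <= 1 -> normc (cosh z x - cosh w x) <= 4 * E * normc (z - w).
  move=> x01; have -> : cosh z x - cosh w x =
    ((cexpf z x - cexpf w x) + (cexpf (- z) x - cexpf (- w) x)) / 2 by rewrite /cosh; field.
  rewrite half; have := normcD_le (cexpf z x - cexpf w x) (cexpf (- z) x - cexpf (- w) x).
  by have := d1 x x01; have := d2 x x01; lra.
have ds x : 0 <= x <= 1 -> normc (sinh z x - sinh w x) <= 4 * E * normc (z - w).
  move=> x01; have -> : sinh z x - sinh w x =
    ((cexpf z x - cexpf w x) - (cexpf (- z) x - cexpf (- w) x)) / 2 by rewrite /sinh; field.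
  rewrite half; have := normcB_le (cexpf z x - cexpf w x) (cexpf (- z) x - cexpf (- w) x).
  by have := d1 x x01; have := d2 x x01; lra.
have sq (f : R -> C) : ccont f -> (forall x, 0 <= x <= 1 -> normc (f x) <= 4 * E * normc (z - w)) ->
    sqnorm f <= (4 * E) ^+ 2 * normc (z - w) ^+ 2.
  move=> cf fB; apply: sqnorm_le_cst => // x x01; rewrite -exprMn ler_pXn2r ?fB //.
    by rewrite nnegrE normc_ge0.
  by rewrite nnegrE mulr_ge0 // mulr_ge0 // ltW.
have cB (f g : R -> C) : ccont f -> ccont g -> ccont (fun x => f x - g x).
  move=> cf cg; have := ccontD cf (ccontM (ccont_cst (-1)) cg).
  by congr ccont; apply/funext => x; rewrite mulN1r.
have in1 : 0 <= (1 : R) <= 1 by rewrite ler01 lexx.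
have e1 : normc (cexpf z 1) <= E by exact: cexpf_le.
have e2 : normc (cexpf (- z) 1) <= E by apply: cexpf_le; rewrite // ReN normrN.
have c1 : normc (cosh z 1) <= E.
  by rewrite /cosh half; have := normcD_le (cexpf z 1) (cexpf (- z) 1); lra.
have s1 : normc (sinh z 1) <= E.
  by rewrite /sinh half; have := normcB_le (cexpf z 1) (cexpf (- z) 1); lra.
have eta : normc (bdry_value m a z) <= (1 + alpha) * E * (normc z)^-1.
  have nz : 0 < normc z by rewrite normc_gt0.
  rewrite ler_pdivlMr // -normcM mulrC.
  have -> : z * bdry_value m a z = - (cosh z 1 + alpha%:C * sinh z 1).
    move: cz; rewrite char_fun_hyp => /eqP; rewrite mulf_eq0 mulf_eq0 pnatr_eq0.
    rewrite (negbTE (cexp_neq0 z)) /= => /eqP cz; rewrite -[LHS]subr0 -cz; ring.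
  rewrite normcN'; apply: le_trans (normcD_le _ _) _; rewrite (normcM alpha%:C) normcR (gtr0_norm halpha).
  by have := ler_wpM2l (ltW halpha) s1; lra.
rewrite (normH_rep hm ha halpha hd).
have b1 := sq _ (cB _ _ (cosh_ccont z) (cosh_ccont w)) dc.
have b2 := sq _ (cB _ _ (sinh_ccont z) (sinh_ccont w)) ds.
have b3 : k * normc (bdry_value m a z - 0) ^+ 2 <= D2 * (normc z)^-1 ^+ 2.
  rewrite subr0 /D2 -mulrA -exprMn; apply: ler_wpM2l; first exact: ltW.
  rewrite ler_pXn2r ?eta // nnegrE ?normc_ge0 //.
  by apply: le_trans eta; exact: normc_ge0.
have p1 := mulr_ge0 D20 (sqr_ge0 (normc (z - w))).
have p2 := mulr_ge0 D10 (sqr_ge0 (normc z)^-1).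
rewrite -/k -[(_ - _).1.2]/(fun x => sinh z x - sinh w x) -[(_ - _).2]/(bdry_value m a z - 0).
rewrite /D1 in p2 *; move: b1 b2 b3 p1 p2; rewrite !mulrDl !mulrDr; lra.
Qed.

End Asymptotics.

(** * Chains of root vectors *)

Section Chains.
Context {R : realType} {V : lmodType R[i]}.
Local Notation C := R[i].
Variables (H : set V) (N : V -> R) (G : V -> V -> Prop) (K : R).
Hypotheses (sH : seminormed H N) (GP : boundedly_invertible H N G K).

(** Add to [u] a preimage of [d], which is null because the inverse is bounded. *)
Let inv_null_right u v d : G u v -> H d -> N d = 0 -> G u (v + d).
Proof.
move=> Gu hd d0; have [y Gy] := inv_surj GP hd.
have [hu _] := inv_dom GP Gu.
have Guy : G (1 *: y + u) (1 *: d + v) := inv_lin GP 1 Gy Gu.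
rewrite !scale1r in Guy; rewrite addrC; apply: (inv_null GP Guy) => //.
rewrite addrK; apply/eqP; rewrite eq_le (seminorm_ge0 sH) andbT.
by have := inv_bound GP Gy; rewrite d0 mulr0.
Qed.

(** Take the last vector of the chain that is not null. *)
Lemma chain_eigenvector (a : C) k (x : nat -> V) : N (x 0%N) <> 0 -> N (x k) = 0 ->
  (forall i, G (x i) (a *: x i - x i.+1)) ->
  exists u, [/\ H u, N u <> 0 & G u (a *: u)].
Proof.
move=> x0 xk Gx; have hx i := (inv_dom GP (Gx i)).1.
suff [i [xi xi1]] : exists i, N (x i) <> 0 /\ N (x i.+1) = 0.
  exists (x i); split => //; rewrite -[a *: x i](subrK (x i.+1)).
  exact: inv_null_right.
elim: k xk => [//|k IH] xk; have [/eqP e|/eqP n] := boolP (N (x k) == 0); first exact: IH.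
by exists k.
Qed.

End Chains.

Section RootVectors.
Context {R : realType} (m a alpha : R) (hm : 0 < m) (ha : 0 < a) (halpha : 0 < alpha).
Hypothesis ham : a != m.
Local Notation C := R[i].
Local Notation N := (normH m a alpha).
Local Notation G := (graphA m a alpha).

Let sH : seminormed (inH (R := R)) N := normH_seminormed hm ha halpha.

Lemma graphA_boundedly_invertible : exists K, boundedly_invertible (inH (R := R)) N G K.
Proof.
have [K K0 bound] := graphA_bound hm ha halpha; exists K; split => //.
- exact: graphA_inH.
- exact: graphA_lin.
- exact: graphA_surj.
- exact: domain_dense.
- exact: graphA_null.
Qed.

Let null0 (u : state R) : inH u -> N u = 0 <-> eqH u 0.
Proof.
by move=> hu; have := normH_null hm ha halpha hu (semi0 sH); rewrite subr0.
Qed.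

Lemma eigenvalueP z : eigenvalueA m a alpha z <-> char_fun m a alpha z = 0.
Proof.
split; first exact: eigenvalue_char.
move=> cz; have z0 := char_fun_neq0 cz; exists (hyp_state z (bdry_value m a z)); split.
- exact: state_rep_inH (hyp_state_rep _ z0).
- exact: sinh_cosh_state_neq0.
- exact: char_fun_graph.
Qed.

Let chain_ker_pow (z : C) (x : nat -> state R) :
  (forall i, G (x i) (z *: x i - x i.+1)) ->
  forall k i, x (i + k)%N = 0 -> ker_pow m a alpha z k (x i).
Proof.
move=> Gx; elim=> [|k IH] i.
  by rewrite addn0 => -> /=; split => //; exact: aeW.
move=> e; exists (z *: x i - x i.+1) => //.
by rewrite subKr; apply: IH; rewrite addSnnS.
Qed.

Lemma chain_generalized_eigenfunction (z : C) k (x : nat -> state R) : inH (x 0%N) ->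
  N (x 0%N) <> 0 -> x k = 0 -> (forall i, G (x i) (z *: x i - x i.+1)) ->
  generalized_eigenfunction m a alpha (x 0%N).
Proof.
move=> hx x0 xk Gx; have [K GP] := graphA_boundedly_invertible.
split => //; first by move/(null0 hx).
exists z, k; split; last exact: chain_ker_pow.
  have Nk : N (x k) = 0 by rewrite xk; apply/(null0 (semi0 sH)); split => //; exact: aeW.
  have [u [hu u0 Gu]] := chain_eigenvector sH GP x0 Nk Gx.
  by exists u; split => //; move/(null0 hu).
case: k xk => // xk; exfalso; apply: x0; rewrite xk.
by apply/(null0 (semi0 sH)); split => //; exact: aeW.
Qed.

Lemma root_vector_riesz_basis : exists phi : nat -> state R,
  (forall n, generalized_eigenfunction m a alpha (phi n)) /\ riesz_basis (inH (R := R)) N phi.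
Proof.
have [K GP] := graphA_boundedly_invertible.
have [n0 [A [lam [root linj loo half]]]] := eigenvalue_sequence alpha hm ha ham.
have [D D0 close] := hyp_state_close hm ha halpha.
pose psi n : state R := if n is k.+1 then hyp_state (lam k) (bdry_value m a (lam k)) else 0.
have big n : (maxn n0.+1 6 <= n)%N -> exists k, [/\ n = k.+1, (n0 <= k)%N & (5 <= k)%N].
  by case: n => [|k]; rewrite geq_max ?ltnS ?ltn0 // => /andP[h1 h2]; exists k.
have [phi' [basis chains]] : exists phi', riesz_basis (inH (R := R)) N phi' /\
    forall n, exists (z : C) k (x : nat -> state R),
      [/\ x 0%N = phi' n, x k = 0 & forall i, G (x i) (z *: x i - x i.+1)].
  apply: (root_vector_basis sH (normH_complete hm ha halpha) GP (psi := psi)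
    (lam := fun n => lam n.-1) (n0 := maxn n0.+1 6) (D := D * (A ^+ 2 + 4))
    (ref_basis_riesz hm ha halpha ham)).
  - move=> n /big[k [-> nk _]]; have [cz _] := root k nk.
    exact: char_fun_graph.
  - move=> p q /big[k [-> nk _]] /big[l [-> nl _]] /= e.
    by rewrite (linj _ _ nk nl e).
  - move=> M; have [n1 n1P] := loo M; exists n1.+1 => -[//|n] nn; exact: n1P.
  - move=> n /big[k [-> nk k5]]; have [cz near] := root k nk; have hf := half k nk.
    have z0 := char_fun_neq0 cz; have w0 := nu_neq0 hm ha ham k.
    have wr : `|Re (nu m a k)| <= `|Re (nu0 m a)| by rewrite Re_nu.
    apply: le_trans (close _ _ z0 w0 cz wr hf) _.
    rewrite -mulrA; apply: ler_wpM2l => //; rewrite mulrDl; apply: lerD.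
      rewrite -expr_div_n ler_pXn2r ?nnegrE ?normc_ge0 //.
      by apply: le_trans near; exact: normc_ge0.
    have k5' : (5 : R) <= k%:R by rewrite ler_nat.
    have zk : k.+2%:R / 2 <= normc (lam k).
      have h1 : k%:R - 1 <= normc (nu m a k) by exact: normc_nu_ge.
      have h2 := normcB_ge (nu m a k) (lam k).
      rewrite normcB in h2; rewrite -[k.+2%:R]natr1 -natr1; lra.
    have k0 : 0 < k.+2%:R / 2 :> R by rewrite divr_gt0.
    have -> : 4 / k.+2%:R ^+ 2 = (k.+2%:R / 2)^-1 ^+ 2 :> R.
      have : k.+2%:R != 0 :> R by rewrite pnatr_eq0.
      by move: (k.+2%:R : R) => s s0; field.
    rewrite ler_pXn2r ?nnegrE ?invr_ge0 ?normc_ge0 ?(ltW k0) //.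
    by rewrite lef_pV2 ?posrE // (lt_le_trans k0 zk).
exists phi'; split => // n; have [hphi _ [c1 [c2 [c10 c20 bnd]]]] := basis.
have [z [k [x [xe xk Gx]]]] := chains n; rewrite -xe.
apply: chain_generalized_eigenfunction xk Gx; rewrite xe //.
move=> N0; have /andP[+ _] := bnd n.+1 (fun i => (i == n)%:R).
rewrite [X in N X](_ : _ = phi' n); last first.
  rewrite big_ord_recr /= eqxx scale1r big1 ?add0r // => i _.
  by rewrite (ltn_eqF (ltn_ord i)) scale0r.
rewrite N0 expr0n /= big_ord_recr /= eqxx normc1 expr1n big1 ?add0r ?mulr1 => [|i _].
  by rewrite leNgt c10.
by rewrite (ltn_eqF (ltn_ord i)) normc0 expr0n.
Qed.

End RootVectors.

Theorem lemma3 (R : realType) (m a alpha : R)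
    (hm : 0 < m) (ha : 0 < a) (halpha : 0 < alpha) (ham : a <> m) :
  (exists phi : nat -> state R,
     (forall n, generalized_eigenfunction m a alpha (phi n)) /\
     riesz_basis inH (normH m a alpha) phi) /\
  (forall lambda : R[i],
     eigenvalueA m a alpha lambda <->
     cexp (2 * lambda) * (1 + alpha%:C + (a + m)%:C * lambda)
       + (1 - alpha%:C) + (a - m)%:C * lambda = 0).
Proof.
have ham' : a != m by exact/eqP.
split; first exact: root_vector_riesz_basis.
exact: eigenvalueP.
Qed.
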